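(* Let $d\ge1$, $0<\beta\le2$, $1\le p,q\le\infty$, $s\in\mathbb{R}$, and $\alpha=1-\beta/2\in[0,1)$. If $$\|S_\beta(t)u\|_{L^p(I\times\mathbb{R}^d)}\le C\|u\|_{M^{s,\alpha}_{p,q}}\quad\text{for all }u\in M^{s,\alpha}_{p,q},$$ then $$s\ge \max\Big\{0,\ \frac{\beta d}{2}\Big(\frac1p-\frac1q\Big),\ \frac{\beta d}{2}\Big(1-\frac1p-\frac1q\Big)-\frac\beta p\Big\}.$$
   Context: $I=[0,1]$. For $\beta>0$, $S_\beta(t)=\mathcal{F}^{-1}e^{it|\xi|^\beta}\mathcal{F}$ on $\mathbb{R}^d$. $\langle x\rangle=(1+|x|^2)^{1/2}$. $\alpha$-modulation spaces: for $\alpha\in[0,1)$ let $\{\eta_k^\alpha\}_{k\in\mathbb{Z}^d}$ be Schwartz functions with $|\eta_k^\alpha(\xi)|\gtrsim1$ if $|\xi-\langle k\rangle^{\alpha/(1-\alpha)}k|<c\langle k\rangle^{\alpha/(1-\alpha)}$, $\operatorname{supp}\eta_k^\alpha\subseteq\{\xi:|\xi-\langle k\rangle^{\alpha/(1-\alpha)}k|<C\langle k\rangle^{\alpha/(1-\alpha)}\}$, $\sum_k\eta_k^\alpha\equiv1$, $|\partial^\gamma\eta_k^\alpha|\le C_{\alpha,\gamma}\langle k\rangle^{-\alpha|\gamma|/(1-\alpha)}$. Set $\Box_k^\alpha=\mathcal{F}^{-1}\eta_k^\alpha\mathcal{F}$ and $\|f\|_{M^{s,\alpha}_{p,q}}=\big(\sum_{k}\langle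 k\rangle^{sq/(1-\alpha)}\|\Box_k^\alpha f\|_{L^p}^q\big)^{1/q}$ (usual modification for $q=\infty$). *)

(* Defs.v *)
From HB Require Import structures.
From mathcomp Require Import all_boot all_order all_algebra.
From mathcomp Require Import all_classical all_reals all_analysis.
From mathcomp Require Import complex.
Set Implicit Arguments. Unset Strict Implicit. Unset Printing Implicit Defensive.
Import Order.TTheory GRing.Theory Num.Theory.
Import numFieldNormedType.Exports.
Local Open Scope classical_set_scope.
Local Open Scope ring_scope.

(** * Lebesgue measure on R^d, as the d-fold product of the Lebesgue
    measure on R (R^0 = unit with the Dirac mass). *)
Fixpoint RdT (R : realType) (n : nat) : {dp : measure_display & measurableType dp} :=
  match n with
  | 0 => existT _ _ (unit : measurableType _)
  | n.+1 => existT _ _ ((measurableTypeR R * projT2 (RdT R n))%type : measurableType _)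
  end.

Fixpoint lebRd (R : realType) (n : nat) : {measure set (projT2 (RdT R n)) -> \bar R} :=
  match n return {measure set (projT2 (RdT R n)) -> \bar R} with
  | 0 => (\d_tt : {measure set unit -> \bar R})
  | n.+1 => (((@lebesgue_measure R) \x^ lebRd R n)%E : {measure set _ -> \bar R})
  end.

Fixpoint coordRd (R : realType) (n : nat) : projT2 (RdT R n) -> nat -> R :=
  match n return projT2 (RdT R n) -> nat -> R with
  | 0 => fun _ _ => 0
  | n.+1 => fun y i => if i is i'.+1 then @coordRd R n y.2 i' else y.1
  end.

Definition vecRd (R : realType) (n : nat) (y : projT2 (RdT R n)) : 'rV[R]_n :=
  \row_(i < n) coordRd y i.

Section Defs.
Variables (R : realType) (d : nat).
Local Notation C := (R[i]).
Local Notation V := ('rV[R]_d).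

Definition dotR (x y : V) : R := \sum_(i < d) x 0 i * y 0 i.
Definition enorm (x : V) : R := Num.sqrt (dotR x x).

Definition cabs (z : C) : R := Num.sqrt (complex.Re z ^+ 2 + complex.Im z ^+ 2).
Definition cexp (t : R) : C := Complex (cos t) (sin t).

Definition intRd (f : V -> R) : R := Rintegral (lebRd R d) setT (fun y => f (vecRd y)).
Definition cintRd (f : V -> C) : C :=
  Complex (intRd (fun x => complex.Re (f x))) (intRd (fun x => complex.Im (f x))).

Definition fourier (f : V -> C) (xi : V) : C := cintRd (fun x => cexp (- dotR x xi) * f x).
Definition ifourier (g : V -> C) (x : V) : C :=
  Complex ((2 * pi) ^- d) 0 * cintRd (fun xi => cexp (dotR x xi) * g xi).

Definition pderiv (j : 'I_d) (g : V -> R) : V -> R := fun x => derive g x (delta_mx 0 j).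
Definition pderivs (js : seq 'I_d) (g : V -> R) : V -> R := foldr pderiv g js.

Definition rschwartz (g : V -> R) : Prop :=
  forall js : seq 'I_d,
    (forall x (j : 'I_d), derivable (pderivs js g) x (delta_mx 0 j)) /\
    (forall m : nat, exists M : R, forall x, (1 + dotR x x) ^+ m * `|pderivs js g x| <= M).

Definition cschwartz (f : V -> C) : Prop :=
  rschwartz (fun x => complex.Re (f x)) /\ rschwartz (fun x => complex.Im (f x)).

Definition cpderivs (js : seq 'I_d) (f : V -> C) : V -> C :=
  fun x => Complex (pderivs js (fun y => complex.Re (f y)) x)
                   (pderivs js (fun y => complex.Im (f y)) x).

Definition kR (k : 'rV[int]_d) : V := map_mx (fun z : int => z%:~R) k.
Definition jb (k : 'rV[int]_d) : R := Num.sqrt (1 + dotR (kR k) (kR k)).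
Definition kcenter (alpha : R) (k : 'rV[int]_d) : V :=
  (jb k `^ (alpha / (1 - alpha))) *: kR k.

Definition admissible (alpha : R) (eta : 'rV[int]_d -> V -> C) : Prop :=
  [/\ forall k, cschwartz (eta k),
      exists c c0 : R, 0 < c /\ 0 < c0 /\
        forall k xi, enorm (xi - kcenter alpha k) < c * jb k `^ (alpha / (1 - alpha)) ->
          c0 <= cabs (eta k xi),
      exists Csup : R, forall k xi,
        Csup * jb k `^ (alpha / (1 - alpha)) <= enorm (xi - kcenter alpha k) ->
          eta k xi = 0,
      forall xi, exists K : seq 'rV[int]_d,
        [/\ uniq K, (forall k, k \notin K -> eta k xi = 0) & \sum_(k <- K) eta k xi = 1]
    & forall js : seq 'I_d, exists Cg : R, forall k xi,
        cabs (cpderivs js (eta k) xi) <= Cg * jb k `^ (- (alpha * (size js)%:R / (1 - alpha)))].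

Definition boxop (eta : 'rV[int]_d -> V -> C) (k : 'rV[int]_d) (u : V -> C) : V -> C :=
  ifourier (fun xi => eta k xi * fourier u xi).

Definition LpRd (p : \bar R) (f : V -> C) : \bar R :=
  Lnorm (lebRd R d) p (fun y => (cabs (f (vecRd y)))%:E).

Definition Mnorm (alpha s : R) (eta : 'rV[int]_d -> V -> C) (p q : \bar R) (u : V -> C)
  : \bar R :=
  match q with
  | r%:E => ((\esum_(k in [set: 'rV[int]_d])
               ((jb k `^ (s * r / (1 - alpha)))%:E * LpRd p (boxop eta k u) `^ r)) `^ r^-1)%E
  | _ => ereal_sup [set ((jb k `^ (s / (1 - alpha)))%:E * LpRd p (boxop eta k u))%E
                   | k in [set: 'rV[int]_d]]
  end.

Definition Sbeta (beta t : R) (u : V -> C) : V -> C :=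
  ifourier (fun xi => cexp (t * enorm xi `^ beta) * fourier u xi).

Definition LpIRd (p : \bar R) (F : R -> V -> C) : \bar R :=
  Lnorm ((@lebesgue_measure R) \x^ lebRd R d)%E p
    (fun z => if (0 <= z.1 <= 1) then (cabs (F z.1 (vecRd z.2)))%:E else 0%E).

End Defs.

Definition einv (R : realType) (p : \bar R) : R := if p is r%:E then r^-1 else 0.

(* Main.v *)
Require Import Defs.
From HB Require Import structures.
From mathcomp Require Import all_boot all_order all_algebra.
From mathcomp Require Import all_classical all_reals all_analysis.
From mathcomp Require Import measurable_realfun ess_sup_inf.
From mathcomp Require Import complex ring lra.
Import Order.TTheory GRing.Theory Num.Theory.
Import numFieldNormedType.Exports.
Local Open Scope classical_set_scope.
Local Open Scope ring_scope.
Set Implicit Arguments. Unset Strict Implicit. Unset Printing Implicit Defensive.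

(** The inequality is tested on finite sums of modulated Gaussians, whose Fourier
    transforms are explicit Gaussians. Put a = alpha/(1-alpha) = 2/beta - 1,
    so that the k-th frequency block has centre <k>^a k and radius <k>^a.

    - A Gaussian adapted to the block k (frequency width N^a, |k| ~ N) keeps its
      height for t in a fixed interval [0, tau], along a ball of radius ~ N^(-a)
      moving with the group velocity: the second-order part of the phase
      t |xi|^beta is of size t N^((a+1)(beta-2)+2a) = t. Placing the Gaussians of
      n such blocks at very distant positions makes them essentially disjoint,
      which gives n^(1/p) <= C N^(2s/beta) n^(1/q). With n = 1 this yields s >= 0,
      and with all the n = N^d lattice points of a cube it yields the second bound.
    - A Gaussian of frequency width M = N^(a+1) at the origin keeps its height for
      t <= tau M^(-beta) = tau N^(-2) on a ball of radius ~ 1/M; it meets about N^d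
      blocks, and this yields the third bound.

    The modulation norm is bounded from above by Lp estimates of each block, where
    the decay in space comes from finite differences of the amplitude. *)

(** * Integration on R^d *)

(** Of [eta] only the support and derivative bounds are known, and the phase |xi|^beta is not smooth
    at 0; both facts shape the proof. Every quantity becomes an integral [osc z f] of exp(i z.xi)
    f(xi), with f a Gaussian times [eta j] or times the propagator, so neither Fourier inversion nor
    Plancherel occurs. Moving xi by h e_i with z_i h = pi changes the sign of the exponential:
    differences of the amplitude thus replace integrations by parts and rest on translation
    invariance alone. For the propagator one difference is enough, since |xi|^beta is a Holder
    function of |xi|^2 and the far tails only have to be small, without a rate. The phase is
    expanded as a power of |xi|^2 around |c|^2, which is valid for all xi, the origin included. Lp
    norms are sandwiched between a measurable set of tubes and a majorant with values in [0, 1], and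
    [einv] treats p = oo together with finite p. The bound s >= 0 has to precede the third one,
    whose upper estimate relies on weights that grow with the frequency. *)

Section SigmaFinite.
Context (dp : measure_display) (T : measurableType dp) (R : realType).

(** An alias of [m] indexed by a proof of sigma-finiteness, so that the structure asked by the
    Tonelli theorems can be declared on it. For [lebRd] this proof is an induction on the
    dimension. *)
Definition sfmeas (m : {measure set T -> \bar R}) (s : sigma_finite setT m)
  : set T -> \bar R := m.

Variables (m : {measure set T -> \bar R}) (s : sigma_finite setT m).
HB.instance Definition _ := isMeasure.Build dp T R (sfmeas s)
  (measure0 m) (measure_ge0 m) (@measure_semi_sigma_additive _ _ _ m).
HB.instance Definition _ := @Measure_isSigmaFinite.Build dp T R (sfmeas s) s.
End SigmaFinite.

Section NonnegIntegral.
Local Open Scope ereal_scope.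
Context (dp : measure_display) (T : measurableType dp) (R : realType).
Variable mu : {measure set T -> \bar R}.

(* The integral of a nonnegative function is a supremum over simple minorants,
   hence it is monotone even without measurability. *)
Lemma le_integral_nonmeas (f g : T -> \bar R) :
  (forall x, 0 <= f x) -> (forall x, f x <= g x) ->
  \int[mu]_x f x <= \int[mu]_x g x.
Proof.
move=> f0 fg; have g0 x : 0 <= g x by exact: le_trans (fg x).
rewrite !ge0_integralTE//; apply: le_ereal_sup => _ [h hf <-].
by exists h => // x; exact: le_trans (fg x).
Qed.

Lemma integrable_scale (r : R) (h : T -> R) : mu.-integrable setT (EFin \o h) ->
  mu.-integrable setT (EFin \o (fun x => r * h x)%R).
Proof.
move=> ih; rewrite (_ : _ \o _ = (fun x => r%:E * (EFin \o h) x)).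
  exact: integrableZl.
by apply/funext => x /=; rewrite EFinM.
Qed.
End NonnegIntegral.

Section Caratheodory.
Context (R : realType) (dp : measure_display) (T : measurableType dp).

Definition grid (n : nat) (x : R) : R := (Num.floor (x * n.+1%:R))%:~R / n.+1%:R.

Lemma grid_cvg (x : R) : grid n x @[n --> \oo] --> x.
Proof.
apply/cvgrPdist_le => e e0; near=> n.
have n0 : 0 < n.+1%:R :> R by rewrite ltr0n.
have /andP[l u] := floor_itv (x * n.+1%:R).
rewrite /grid ger0_norm; last by rewrite subr_ge0 ler_pdivrMr.
rewrite lerBlDr -lerBlDl ler_pdivlMr// mulrBl.
have : 1 <= e * n.+1%:R.
  rewrite -ler_pdivrMr// mul1r; near: n.
  by apply: filterS (near_infty_natSinv_lt (PosNum e0)) => m /ltW.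
move: u; rewrite intrD; lra.
Unshelve. all: by end_near. Qed.

Lemma measurable_floor_eq (n : nat) (k : int) :
  measurable [set x : R | Num.floor (x * n.+1%:R) = k].
Proof.
have n0 : 0 < n.+1%:R :> R by rewrite ltr0n.
rewrite (_ : [set x | _] = `[k%:~R / n.+1%:R, (k + 1)%:~R / n.+1%:R[%classic).
  exact: measurable_itv.
apply/seteqP; split => x /=; rewrite in_itv/= ler_pdivrMr// ltr_pdivlMr//.
  by move=> <-; exact: floor_itv.
exact: floor_def.
Qed.

(** Rounding x down to a multiple of 1/(n+1) gives functions that converge to [f] by continuity in
    x; the preimage of a set under each of them is a countable union of measurable rectangles. *)
Lemma measurable_caratheodory (f : (measurableTypeR R * T)%type -> R) :
  (forall x, measurable_fun setT (fun y => f (x, y))) ->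
  (forall y, continuous (fun x : R => f (x, y))) ->
  measurable_fun setT f.
Proof.
move=> mf cf.
apply: (measurable_fun_cvg (h := fun n z => f (grid n z.1, z.2))); last first.
  move=> [x y] _.
  exact (cvg_comp (fun n => grid n x) (fun x0 : R => f (x0, y)) (@grid_cvg x) (cf y x)).
move=> n _ B mB; rewrite setTI.
rewrite (_ : _ @^-1` B = \bigcup_(k : int)
  ([set x : measurableTypeR R | Num.floor (x * n.+1%:R) = k] `*`
   ((fun y => f (k%:~R / n.+1%:R, y)) @^-1` B))).
  apply: countable_bigcupT_measurable => // k; apply: measurableX.
    exact: measurable_floor_eq.
  by rewrite -[X in measurable X]setTI; exact: mf.
apply/seteqP; split=> [[x y] Bxy|[x y] [k _ [/= <-]]//].
by exists (Num.floor (x * n.+1%:R)).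
Qed.
End Caratheodory.

(** * Tonelli, translations and product integrands on R^d *)

Section LebesgueRd.
Variable R : realType.
Local Notation T n := (projT2 (RdT R n)).
Local Notation mu n := (lebRd R n).
Local Notation leb := (@lebesgue_measure R).

Lemma sigma_finite_lebRd n : sigma_finite setT (mu n).
Proof.
elim: n => [|n IH].
  exists (fun _ => setT) => [|i]; first by rewrite bigcup_const.
  by split => //; rewrite /= diracT ltry.
have /sigma_finiteP[F [TF ndF Foo]] := sigma_finiteT leb.
have /sigma_finiteP[G [TG ndG Goo]] := sigma_finiteT (sfmeas IH).
exists (fun k => F k `*` G k).
  rewrite -setXTT TF TG predeqE => -[x y]; split.
    move=> [/= [k _ Fkx] [l _ Gly]]; exists (maxn k l) => //; split.
    - by move: x Fkx; exact/subsetPset/ndF/leq_maxl.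
    - by move: y Gly; exact/subsetPset/ndG/leq_maxr.
  by move=> [k _ []] Fkx Gky; split; exists k.
move=> k; have [mF Fk] := Foo k; have [mG Gk] := Goo k.
split; first exact: measurableX.
rewrite /= product_measure2E//; apply: lte_mul_pinfty => //.
by rewrite ge0_fin_numE.
Qed.

Local Notation lebS n := (sfmeas (sigma_finite_lebRd n)).

(** [lebRd] is the second product construction, the Tonelli theorems speak of the first; they agree
    on rectangles, hence everywhere. Both orders of integration become available. *)
Lemma lebRdS_eq n (A : set (T n.+1)) : measurable A ->
  (leb \x lebS n)%E A = mu n.+1 A.
Proof.
apply: product_measure_unique => B D mB mD.
by rewrite /= product_measure2E.
Qed.

Section Tonelli.
Local Open Scope ereal_scope.
Variables (n : nat) (f : T n.+1 -> \bar R).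
Hypotheses (mf : measurable_fun setT f) (f0 : forall z, 0 <= f z).

Lemma measurable_tonelli : measurable_fun setT (fun y => \int[leb]_x f (x, y)).
Proof. exact: (measurable_fun_fubini_tonelli_G (m1 := leb)). Qed.

Lemma integral_lebRdS : \int[mu n.+1]_z f z = \int[mu n]_y \int[leb]_x f (x, y).
Proof.
transitivity (\int[leb \x lebS n]_z f z); last exact: fubini_tonelli2.
by apply: eq_measure_integral => A mA _; exact/esym/lebRdS_eq.
Qed.

Lemma integral_lebRdS_swap :
  \int[mu n.+1]_z f z = \int[leb]_x \int[mu n]_y f (x, y).
Proof.
transitivity (\int[leb \x lebS n]_z f z); last exact: fubini_tonelli1.
by apply: eq_measure_integral => A mA _; exact/esym/lebRdS_eq.
Qed.
End Tonelli.

(** The image of Lebesgue measure under a translation has the right value on half-open intervals,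
    and these values characterise it. *)
Lemma integral_leb_shift (f : R -> \bar R) (h : R) : measurable_fun setT f ->
  (forall x, 0 <= f x)%E -> (\int[leb]_x f (x + h)%R = \int[leb]_x f x)%E.
Proof.
move=> mf f0; pose S (x : measurableTypeR R) : measurableTypeR R := x + h.
have mS : measurable_fun setT S by exact: measurable_funD.
transitivity (\int[pushforward leb S]_x f x)%E.
  by rewrite ge0_integral_pushforward.
unshelve apply: (eq_measure_integral leb (m1 := measure_function_pushforward__canonical__measure_function_Measure leb mS)) => // A mA _; apply/esym.
apply: lebesgue_measure_unique => // X [[a b] /= _ <-].
rewrite /pushforward /=.
rewrite (_ : _ @^-1` _ = `]a - h, b - h]%classic).
  rewrite !lebesgue_measure_itv/= !lte_fin ltrD2r; case: ifP => // _.
  by rewrite -!EFinB; congr _%:E; ring.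
by apply/seteqP; split => x /=; rewrite !in_itv/= ltrBlDr lerBrDr.
Qed.

Lemma Rintegral_leb_shift (f : R -> R) (h : R) : measurable_fun setT f ->
  Rintegral leb setT (fun x => f (x + h)) = Rintegral leb setT f.
Proof.
move=> /measurable_EFinP mf; rewrite /Rintegral; congr fine.
rewrite integralE [RHS]integralE; congr (_ - _)%E.
  rewrite -[RHS](integral_leb_shift h)//; [|exact: measurable_funepos].
  by apply: eq_integral => y _; rewrite !funeposE.
rewrite -[RHS](integral_leb_shift h)//; [|exact: measurable_funeneg].
by apply: eq_integral => y _; rewrite !funenegE.
Qed.

(** Translation along a single axis: the finite differences move one coordinate at a time. *)
Fixpoint shiftRd (n : nat) : nat -> R -> T n -> T n :=
  match n return nat -> R -> T n -> T n with
  | 0 => fun _ _ y => y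
  | n'.+1 => fun i h y => if i is i'.+1 then (y.1, @shiftRd n' i' h y.2) else (y.1 + h, y.2)
  end.

Lemma measurable_shiftRd n i h : measurable_fun setT (@shiftRd n i h).
Proof.
elim: n i => [|n IH] [|i] /=; try exact: measurable_id.
  apply: measurable_fun_pair; last exact: measurable_snd.
  by apply: measurable_funD => //; exact: measurable_fst.
apply: measurable_fun_pair; first exact: measurable_fst.
by apply: measurableT_comp; [exact: IH|exact: measurable_snd].
Qed.

Lemma integral_shiftRd n i h (f : T n -> \bar R) : measurable_fun setT f ->
  (forall x, 0 <= f x)%E -> (\int[mu n]_y f (shiftRd i h y) = \int[mu n]_y f y)%E.
Proof.
elim: n i f => [//|n IH] i f mf f0.
rewrite !integral_lebRdS//; last first.
  by apply: measurableT_comp => //; exact: measurable_shiftRd.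
case: i => [|i] /=.
  apply: eq_integral => y _.
  rewrite -(@integral_leb_shift (fun x => f (x, y)) h)//.
  by apply: measurableT_comp => //; exact: measurable_fun_pair.
rewrite -[RHS](IH i)//; first exact: measurable_tonelli.
by move=> y; exact: integral_ge0.
Qed.

Lemma integrable_shiftRd n i h (f : T n -> R) : (mu n).-integrable setT (EFin \o f) ->
  (mu n).-integrable setT (EFin \o (f \o shiftRd i h)).
Proof.
move=> /integrableP[mf fi]; apply/integrableP; split.
  by apply: (measurableT_comp mf); exact: measurable_shiftRd.
by rewrite (@integral_shiftRd n i h (fun y => `|(f y)%:E|%E))//; exact: measurableT_comp.
Qed.

Lemma Rintegral_shiftRd n i h (f : T n -> R) : (mu n).-integrable setT (EFin \o f) ->
  Rintegral (mu n) setT (f \o shiftRd i h) = Rintegral (mu n) setT f.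
Proof.
move=> /integrableP[mf _]; rewrite /Rintegral; congr fine.
rewrite integralE [RHS]integralE; congr (_ - _)%E.
  by rewrite -[RHS](integral_shiftRd i h)//; [apply: eq_integral => y _; rewrite !funeposE|exact: measurable_funepos].
by rewrite -[RHS](integral_shiftRd i h)//; [apply: eq_integral => y _; rewrite !funenegE|exact: measurable_funeneg].
Qed.

Lemma measurable_coordRd n i : measurable_fun setT (fun y : T n => coordRd y i).
Proof.
elim: n i => [|n IH] [|i] /=; try exact: measurable_cst.
  exact: measurable_fst.
by apply: (measurableT_comp (IH i)); exact: measurable_snd.
Qed.

Lemma coordRd_shift n i j h (y : T n) : (i < n)%N ->
  coordRd (shiftRd i h y) j = coordRd y j + (if j == i then h else 0).
Proof.
elim: n i j y => [//|n IH] [|i] [|j] y //= ni; rewrite ?addr0//.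
by rewrite IH.
Qed.

(** Induction on the dimension: measurable in y at fixed x by induction, continuous in x at fixed y,
    then [measurable_caratheodory]. Continuity along the axes is what partial derivatives provide
    for Schwartz functions. *)
Lemma measurable_sepcontRd n (f : T n -> R) :
  (forall i y, (i < n)%N -> continuous (fun h => f (shiftRd i h y))) ->
  measurable_fun setT f.
Proof.
elim: n f => [|n IH] f cf.
  by rewrite (_ : f = cst (f tt)); [exact: measurable_cst|apply/funext=> -[]].
apply: measurable_caratheodory => [x|y].
  apply: IH => i y ni; exact: (cf i.+1 (x, y)).
suff -> : (fun x : R => f (x, y)) = (fun h => f (@shiftRd n.+1 0 h (0, y))).
  exact: cf.
by apply/funext => x; rewrite /= add0r.
Qed.

Lemma integral_prodRd n (w : nat -> R -> R) :
  (forall i, measurable_fun setT (w i)) -> (forall i x, 0 <= w i x) ->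
  (\int[mu n]_y (\prod_(i < n) w i (coordRd y i))%:E =
   \prod_(i < n) \int[leb]_x (w i x)%:E)%E.
Proof.
move=> mw w0; elim: n w mw w0 => [|n IH] w mw w0.
  under eq_integral do rewrite big_ord0.
  by rewrite big_ord0 integral_cst//= diracT mule1.
have mp : measurable_fun setT (fun y : T n => \prod_(i < n) w (bump 0 i) (coordRd y i)).
  by apply: measurable_prod => i _; apply: measurableT_comp => //; exact: measurable_coordRd.
rewrite integral_lebRdS; last 2 first.
- apply/measurable_EFinP; apply: measurable_prod => i _.
  by apply: measurableT_comp => //; exact: (@measurable_coordRd n.+1).
- by move=> z; rewrite lee_fin prodr_ge0.
rewrite big_ord_recl.
have IH' := IH (fun i => w i.+1) (fun i => mw i.+1) (fun i => w0 i.+1).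
transitivity (\int[mu n]_y (\int[leb]_x (w 0%N x)%:E * (\prod_(i < n) w i.+1 (coordRd y i))%:E))%E.
  apply: eq_integral => y _.
  rewrite -ge0_integralZr//; last 3 first.
  - by apply/measurable_EFinP; exact: mw.
  - by move=> x _; rewrite lee_fin.
  - by rewrite lee_fin prodr_ge0.
  by apply: eq_integral => x _; rewrite big_ord_recl EFinM.
rewrite ge0_integralZl//; last 3 first.
- exact/measurable_EFinP.
- by move=> y _; rewrite lee_fin prodr_ge0.
- by apply: integral_ge0 => x _; rewrite lee_fin.
by congr (_ * _)%E; exact: IH'.
Qed.

End LebesgueRd.

(** * One-dimensional Gaussian integrals *)

Section RealLine.
Variable R : realType.
Local Notation leb := (@lebesgue_measure R).

Lemma integral_leb_scale (G : R -> R) (r : R) : 0 < r -> continuous G ->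
  (forall x, 0 <= G x) ->
  (\int[leb]_x (G (r * x))%:E = (r^-1)%:E * \int[leb]_x (G x)%:E)%E.
Proof.
move=> r0 cG G0.
have dF (x : R) : is_derive x 1 (fun y => r * y) r.
  by apply: is_derive_eq; rewrite scaler1.
have dF1 : derive1 (fun y => r * y) = cst r.
  by apply/funext => x; rewrite derive1E; apply: derive_val.
have mG : measurable_fun setT (fun x => (G (r * x))%:E).
  apply/measurable_EFinP; apply: measurableT_comp; last exact: measurable_funM.
  exact: continuous_measurable_fun.
rewrite (@increasing_ge0_integration_by_substitutionT R (fun y => r * y) G) //.
- rewrite dF1; transitivity ((r^-1)%:E * \int[leb]_x (r%:E * (G (r * x))%:E))%E; last first.
    by congr (_ * _)%E; apply: eq_integral => x _; rewrite -EFinM mulrC.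
  rewrite ge0_integralZl//; last by rewrite lee_fin ltW.
    by rewrite muleA -EFinM mulVf ?gt_eqF// mul1e.
  by move=> x _; rewrite lee_fin.
- by move=> x y xy; rewrite ltr_pM2l.
- by rewrite dF1 => x; exact: cvg_cst.
- by rewrite dF1; exact: is_cvg_cst.
- by rewrite dF1; exact: is_cvg_cst.
- by apply: gt0_cvgMrNy => //; exact: cvg_id.
- by apply: gt0_cvgMry => //; exact: cvg_id.
Qed.

Lemma continuous_gauss (a : R) : continuous (fun x : R => expR (- (a * x ^+ 2))).
Proof.
move=> x; apply: (@continuous_comp _ _ _ (fun x : R => - (a * x ^+ 2)) expR); last exact: continuous_expR.
apply: (@continuousN _ R^o); apply: continuousM; first exact: cvg_cst.
exact: exprn_continuous.
Qed.

Lemma integral_gauss (a : R) : 0 < a ->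
  (\int[leb]_x (expR (- (a * x ^+ 2)))%:E = (Num.sqrt (pi / a))%:E)%E.
Proof.
move=> a0; have sa : 0 < Num.sqrt a by rewrite sqrtr_gt0.
have := @integral_leb_scale gauss_fun (Num.sqrt a) sa (@continuous_gauss_fun R) (@gauss_fun_ge0 R).
rewrite integralT_gauss -EFinM mulrC -sqrtrV ?ltW// -sqrtrM ?pi_ge0// => <-.
by apply: eq_integral => x _; rewrite /gauss_fun exprMn sqr_sqrtr ?ltW.
Qed.

Lemma integral_cauchy (r : R) : 0 < r ->
  (\int[leb]_x ((1 + (r * x) ^+ 2)^-1)%:E = (pi / r)%:E)%E.
Proof.
move=> r0; have pos (x : R) : 0 < 1 + x ^+ 2 by rewrite ltr_pwDl// sqr_ge0.
have cV : continuous (fun x : R => (1 + x ^+ 2)^-1) by exact: continuous_oneDsqrV.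
have V0 (x : R) : 0 <= (1 + x ^+ 2)^-1 by rewrite invr_ge0 ltW.
rewrite (@integral_leb_scale (fun x => (1 + x ^+ 2)^-1))//.
rewrite ge0_symfun_integralT//; last by move=> x /=; rewrite sqrrN.
rewrite -set_itvcy integral0y_oneDsqr -!EFinM; congr _%:E.
by field; rewrite gt_eqF.
Qed.

(** Half of the exponent is spent on the polynomial factor, through exp(u) >= 1 + u with u = a x^2 /
    2. *)
Lemma gauss_poly_bound (a : R) : 0 < a -> exists2 K : R, 0 < K &
  forall x, (1 + `|x|) * expR (- (a * x ^+ 2)) <= K * expR (- (a / 2 * x ^+ 2)).
Proof.
move=> a0; exists (2 * (1 + 2 / a)); first by rewrite mulr_gt0// addr_gt0// divr_gt0.
move=> x; have e0 := expR_gt0 (- (a / 2 * x ^+ 2)).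
have -> : - (a * x ^+ 2) = - (a / 2 * x ^+ 2) + - (a / 2 * x ^+ 2) by field.
rewrite expRD mulrA ler_pM2r// expRN ler_pdivrMr ?expR_gt0//.
have h1 := expR_ge1Dx (a / 2 * x ^+ 2).
have ia : 0 < 2 / a by rewrite divr_gt0.
have h2 : 1 + `|x| <= 2 * (1 + x ^+ 2).
  rewrite -(real_normK (num_real x)); have := sqr_ge0 (`|x| - 1); have := normr_ge0 x; nra.
apply: (le_trans h2); rewrite -[leRHS]mulrA ler_pM2l//.
apply: le_trans (ler_wpM2l (ltW _) h1); last by rewrite addr_gt0.
have -> : (1 + 2 / a) * (1 + a / 2 * x ^+ 2) = 1 + x ^+ 2 + (2 / a + a / 2 * x ^+ 2).
  by field; rewrite gt_eqF.
by rewrite lerDl addr_ge0 ?(ltW ia)// mulr_ge0 ?sqr_ge0// divr_ge0 ?ltW.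
Qed.

Lemma integrable_gauss (a : R) : 0 < a ->
  leb.-integrable setT (EFin \o (fun x : R => expR (- (a * x ^+ 2)))).
Proof.
move=> a0; apply/integrableP; split.
  by apply/measurable_EFinP; apply: continuous_measurable_fun; exact: continuous_gauss.
under eq_integral do rewrite /= ger0_norm ?expR_ge0//.
by rewrite integral_gauss// ltry.
Qed.

Lemma integrable_dominated (f G : R -> R) : continuous f ->
  (forall x, `|f x| <= G x) -> leb.-integrable setT (EFin \o G) ->
  leb.-integrable setT (EFin \o f).
Proof.
move=> cf fG iG; apply: le_integrable iG => //.
  by apply/measurable_EFinP; exact: continuous_measurable_fun.
by move=> x _ /=; rewrite lee_fin (le_trans (fG x))// ler_norm.
Qed.

Lemma is_derive_under_Rintegral (f f' : R -> R -> R) (G : R -> R) (z : R) :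
  (forall s, leb.-integrable setT (EFin \o f s)) ->
  (forall (s x : R), is_derive s 1 (f ^~ x) (f' s x)) ->
  leb.-integrable setT (EFin \o G) ->
  (forall s x, `|s - z| < 1 -> `|f' s x| <= G x) ->
  is_derive z 1 (fun s => Rintegral leb setT (f s)) (Rintegral leb setT (f' z)).
Proof.
move=> fi df iG fG.
have zI : `]z - 1, z + 1[%classic z by rewrite /= in_itv/= ltrBlDr !ltrDl ltr01.
have near1 s : `]z - 1, z + 1[%classic s -> `|s - z| < 1.
  by rewrite /= in_itv/= ltr_distl.
have G0 x : 0 <= G x by apply: le_trans (fG z x _); rewrite ?subrr ?normr0.
have d1 s x : partial1of2 f s x = f' s x.
  by rewrite partial1of2E; apply: derive_val.
have dv s x : `]z - 1, z + 1[%classic s -> setT x -> derivable (f ^~ x) s 1.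
  by move=> _ _; have [] := df s x.
have bd s x : `]z - 1, z + 1[%classic s -> setT x -> `|partial1of2 f s x| <= G x.
  by move=> /near1 + _; rewrite d1; exact: fG.
apply: DeriveDef.
  exact (@derivable_under_integral R _ (measurableTypeR R) leb f setT measurableT
    z (z - 1) (z + 1) zI (fun s _ => fi s) dv G G0 iG bd).
have := @differentiation_under_integral R _ (measurableTypeR R) leb f setT measurableT
    z (z - 1) (z + 1) zI (fun s _ => fi s) dv G G0 iG bd.
rewrite derive1E => ->.
by apply: eq_Rintegral => x _; rewrite d1.
Qed.

Section GaussFourier.
Variables (a theta : R).
Hypothesis a0 : 0 < a.
Let g (x : R) := expR (- (a * x ^+ 2)).

(** The free phase [theta] lets one real computation serve for cosine and sine. Integrating [h'],
    which is z times [c] minus 2a times [xs], links the two integrals and yields a differential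
    equation for [F]. *)
Let h z x := sin (z * x + theta) * g x.
Let h' z x := z * (cos (z * x + theta) * g x) - 2 * a * (x * sin (z * x + theta) * g x).

Let is_derive_h (z x : R) : is_derive x 1 (h z) (h' z x).
Proof. by apply: is_derive_eq; rewrite /h' /g /GRing.scale/=; ring. Qed.

Let continuous_h z : continuous (h z).
Proof. by move=> x; apply/differentiable_continuous/derivable1_diffP; have [] := is_derive_h z x. Qed.

Let g_le K (c x : R) : `|c| <= K -> `|c * g x| <= K * g x.
Proof. by move=> cK; rewrite normrM (ger0_norm (expR_ge0 _)) ler_wpM2r// expR_ge0. Qed.

Let integrable_h z : leb.-integrable setT (EFin \o h z).
Proof.
apply: (@integrable_dominated (h z) g (@continuous_h z)); last exact: integrable_gauss.
by move=> x; rewrite -[leRHS]mul1r; apply: g_le; rewrite sin_max.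
Qed.

Let c z x := cos (z * x + theta) * g x.
Let xs z x := x * sin (z * x + theta) * g x.

Let is_derive_c (x z : R) : is_derive z 1 (c ^~ x) (- xs z x).
Proof. by apply: is_derive_eq; rewrite /c /xs /g /GRing.scale/=; ring. Qed.

Let is_derive_cx (z x : R) : is_derive x 1 (c z) (- z * sin (z * x + theta) * g x - 2 * a * (x * cos (z * x + theta) * g x)).
Proof. by apply: is_derive_eq; rewrite /c /xs /g /GRing.scale/=; ring. Qed.

Let continuous_c z : continuous (c z).
Proof. by move=> x; apply/differentiable_continuous/derivable1_diffP; have [] := is_derive_cx z x. Qed.

Let integrable_c z : leb.-integrable setT (EFin \o c z).
Proof.
apply: (@integrable_dominated (c z) g (@continuous_c z)); last exact: integrable_gauss.
by move=> x; rewrite -[leRHS]mul1r; apply: g_le; rewrite cos_max.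
Qed.

Let continuous_xs z : continuous (xs z).
Proof.
move=> x; have -> : xs z = (fun x => x * h z x) by apply/funext => y; rewrite /xs /h mulrA.
by apply: cvgM; [exact: cvg_id|exact: continuous_h].
Qed.

(** A majorant uniform in the shift |s| < 1, from -a (x+s)^2 / 2 <= a / 2 - a x^2 / 4. *)
Let domination (u : R) : 0 < u -> exists2 K, 0 < K & forall x s, `|s| < 1 ->
  u * (1 + `|x + s|) * g (x + s) <= K * expR (- (a / 4 * x ^+ 2)).
Proof.
move=> u0; have [K K0 HK] := gauss_poly_bound a0.
exists (u * K * expR (a / 2)); first by rewrite !mulr_gt0// expR_gt0.
move=> x s s1; rewrite -!mulrA ler_pM2l//; apply: (le_trans (HK _)).
rewrite ler_pM2l// -expRD ler_expR.
have : s ^+ 2 <= 1 by move: s1; rewrite ltr_norml expr2 => /andP[]; nra.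
have : 0 <= (x + 2 * s) ^+ 2 by exact: sqr_ge0.
rewrite !expr2 => h1 h2.
rewrite -subr_ge0 (_ : _ - _ = a / 4 * ((x + 2 * s) * (x + 2 * s) + 2 * (1 - s * s))); last by field.
apply: mulr_ge0; first by rewrite divr_ge0 ?ltW.
by rewrite addr_ge0// mulr_ge0// subr_ge0.
Qed.

Let intG K : leb.-integrable setT (EFin \o (fun x => K * expR (- (a / 4 * x ^+ 2)))).
Proof.
by apply: integrable_scale; apply: integrable_gauss; rewrite divr_gt0.
Qed.

Let xs_le : exists2 K, 0 < K & forall z x, `|xs z x| <= K * expR (- (a / 4 * x ^+ 2)).
Proof.
have [K K0 HK] := domination ltr01; exists K => // z x.
have := HK x 0; rewrite normr0 addr0 mul1r => /(_ ltr01); apply: le_trans.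
by apply: g_le; rewrite normrM -[leRHS]mulr1; apply: ler_pM; rewrite ?sin_max// lerDr.
Qed.

Let integrable_xs z : leb.-integrable setT (EFin \o xs z).
Proof.
have [K K0 HK] := xs_le.
exact: (integrable_dominated (@continuous_xs z) (HK z) (@intG K)).
Qed.

Let F z := Rintegral leb setT (c z).

(** The integral of x -> h z (x + s) does not depend on s; differentiating it under the integral
    sign at s = 0 gives 0, with no boundary term at infinity to examine. *)
Let int_h'_eq0 z : Rintegral leb setT (h' z) = 0.
Proof.
have [K K0 HK] := @domination (`|z| + 2 * a) (ltr_wpDl (normr_ge0 _) (mulr_gt0 (ltr0Sn _ 1) a0)).
have D : is_derive (0 : R) 1 (fun s => Rintegral leb setT (fun x => h z (x + s)))
   (Rintegral leb setT (fun x => h' z (x + 0))).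
  apply: (@is_derive_under_Rintegral (fun s x => h z (x + s)) (fun s x => h' z (x + s))
      _ 0 _ _ (@intG K)).
  - move=> s; have /integrableP[mh hi] := integrable_h z.
    apply/integrableP; split.
      by apply: (measurableT_comp mh); exact: measurable_funD.
    by rewrite (integral_leb_shift s (f := fun x => `|(h z x)%:E|%E))//; exact: measurableT_comp.
  - move=> s x; have dh := is_derive_h z (x + s).
    have ds : is_derive s 1 (fun s : R => x + s) 1.
      have := is_deriveD (is_derive_cst x s 1) (is_derive_id s (1 : R)).
      by rewrite add0r.
    by have := is_derive1_comp dh ds; rewrite mulr1.
  - move=> s x; rewrite subr0 => s1; apply: le_trans (HK x s s1).
    rewrite /h' (_ : _ - _ = (z * cos (z * (x + s) + theta) - 2 * a * ((x + s) * sin (z * (x + s) + theta))) * g (x + s)); last by ring.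
    apply: g_le; apply: (le_trans (ler_normB _ _)).
    rewrite !normrM mulrDl lerD//.
      apply: ler_pM => //; apply: (le_trans (cos_max _)); by rewrite lerDl.
    rewrite (ger0_norm (ltW a0)) (ger0_norm (ler0n _ 2)) ler_pM2l ?mulr_gt0//.
    rewrite -[leRHS]mulr1 ler_pM ?sin_max// lerDr//.
have := @derive_val _ _ _ _ _ _ _ D.
rewrite (_ : (fun s => Rintegral leb setT _) = cst (Rintegral leb setT (h z))); last first.
  apply/funext => s; rewrite Rintegral_leb_shift//.
  by apply: continuous_measurable_fun; exact: continuous_h.
rewrite derive_cst => ->; apply: eq_Rintegral => x _; by rewrite addr0.
Qed.

Let int_xs z : Rintegral leb setT (xs z) = z / (2 * a) * F z.
Proof.
have E : z * F z = 2 * a * Rintegral leb setT (xs z).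
  apply/eqP; rewrite -subr_eq0 -(int_h'_eq0 z); apply/eqP/esym.
  have zc := integrable_scale z (integrable_c z).
  have ax := integrable_scale (2 * a) (integrable_xs z).
  apply: etrans (RintegralB measurableT zc ax) _; congr (_ - _).
    exact (RintegralZl z measurableT (integrable_c z)).
  exact (RintegralZl (2 * a) measurableT (integrable_xs z)).
apply: (mulfI (x := 2 * a)); first by rewrite gt_eqF// mulr_gt0.
by rewrite -E mulrA mulrCA divff ?mulr1// gt_eqF// mulr_gt0.
Qed.

Let is_derive_F (z : R) : is_derive z 1 F (- (z / (2 * a)) * F z).
Proof.
have [K K0 HK] := xs_le.
rewrite mulNr -int_xs.
have -> : - Rintegral leb setT (xs z) = Rintegral leb setT (fun x => - xs z x).
  rewrite -mulN1r; apply: etrans (esym (RintegralZl (-1) measurableT (integrable_xs z))) _.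
  by apply: eq_Rintegral => x _; rewrite mulN1r.
apply: (@is_derive_under_Rintegral c (fun z x => - xs z x) _ z _ _ (@intG K)) => // s x _.
by rewrite normrN.
Qed.

(** Since F' = - z / (2a) F, the function F(z) exp(z^2 / (4a)) is constant, equal to F(0). *)
Lemma Rintegral_cos_gauss z :
  Rintegral leb setT (fun x => cos (z * x + theta) * expR (- (a * x ^+ 2))) =
  cos theta * Num.sqrt (pi / a) * expR (- (z ^+ 2 / (4 * a))).
Proof.
have D (y : R) : is_derive y 1 (fun y => F y * expR (y ^+ 2 / (4 * a))) 0.
  have dF := is_derive_F y.
  by apply: is_derive_eq; rewrite /GRing.scale/=; field; rewrite gt_eqF.
have := is_derive_0_is_cst z 0 D; rewrite expr0n mul0r expR0 mulr1.
have -> : F 0 = cos theta * Num.sqrt (pi / a).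
  rewrite /F /c; under eq_Rintegral do rewrite mul0r add0r.
  apply: etrans (RintegralZl (cos theta) measurableT (integrable_gauss a0)) _.
  by rewrite /Rintegral integral_gauss.
move=> <-; rewrite -mulrA -expRD subrr expR0 mulr1 //.
Qed.

End GaussFourier.
End RealLine.

(** * Complex-valued integrals *)

Section ComplexNumbers.
Variable R : realType.
Local Notation C := R[i].
Implicit Types (x y : C) (s t : R).

Lemma cabsE x : cabs x = ComplexField.Normc.normc x.
Proof. by case: x. Qed.
Lemma cabsM x y : cabs (x * y) = cabs x * cabs y.
Proof. by rewrite !cabsE ComplexField.Normc.normcM. Qed.
Lemma cabsD x y : cabs (x + y) <= cabs x + cabs y.
Proof. by rewrite !cabsE le_normcD. Qed.
Lemma cabsN x : cabs (- x) = cabs x.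
Proof. by rewrite !cabsE normcN. Qed.
Lemma cabs0 : cabs (0 : C) = 0.
Proof. by rewrite cabsE ComplexField.Normc.normc0. Qed.
Lemma cabs_ge0 x : 0 <= cabs x. Proof. exact: sqrtr_ge0. Qed.
Lemma cabs_real s : cabs (Complex s 0) = `|s|.
Proof. by rewrite /cabs/= expr0n addr0 sqrtr_sqr. Qed.
Lemma cabs_cexp t : cabs (cexp t) = 1.
Proof. by rewrite /cabs/= cos2Dsin2 sqrtr1. Qed.
Lemma Re_le_cabs x : `|complex.Re x| <= cabs x.
Proof. by rewrite -sqrtr_sqr ler_wsqrtr// lerDl sqr_ge0. Qed.
Lemma Im_le_cabs x : `|complex.Im x| <= cabs x.
Proof. by rewrite -sqrtr_sqr ler_wsqrtr// lerDr sqr_ge0. Qed.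
Lemma cabs_le_ReIm x : cabs x <= `|complex.Re x| + `|complex.Im x|.
Proof.
case: x => a b; rewrite (_ : Complex a b = Complex a 0 + Complex 0 b).
  have E : cabs (Complex 0 b : C) = `|b| by rewrite /cabs/= expr0n/= add0r sqrtr_sqr.
  by apply: (le_trans (cabsD _ _)); rewrite E cabs_real /= addr0 add0r.
by apply/eqP; rewrite eq_complex/= addr0 add0r !eqxx.
Qed.
Lemma ReM x y : complex.Re (x * y) = complex.Re x * complex.Re y - complex.Im x * complex.Im y.
Proof. by case: x y => [a b] [c d]. Qed.
Lemma ImM x y : complex.Im (x * y) = complex.Re x * complex.Im y + complex.Im x * complex.Re y.
Proof. by case: x y => [a b] [c d]. Qed.
Lemma cReD x y : complex.Re (x + y) = complex.Re x + complex.Re y.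
Proof. by case: x y => [a b] [c d]. Qed.
Lemma cImD x y : complex.Im (x + y) = complex.Im x + complex.Im y.
Proof. by case: x y => [a b] [c d]. Qed.
Lemma complex_ext x y : complex.Re x = complex.Re y -> complex.Im x = complex.Im y -> x = y.
Proof. by case: x y => [a b] [c d] /= -> ->. Qed.
Lemma cexpD s t : cexp (s + t) = cexp s * cexp t.
Proof.
by apply: complex_ext; rewrite ?ReM ?ImM/= ?cosD ?sinD// addrC; congr (_ + _); rewrite mulrC.
Qed.
Lemma cexp0 : cexp (0 : R) = 1.
Proof. by rewrite /cexp cos0 sin0. Qed.
Lemma cexp_sum (I : Type) (r : seq I) (F : I -> R) :
  cexp (\sum_(i <- r) F i) = \prod_(i <- r) cexp (F i).
Proof. by elim/big_ind2: _ => [|? ? ? ? <- <-|//]; rewrite ?cexp0 ?cexpD. Qed.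
Lemma cabs_sum (I : Type) (r : seq I) (F : I -> C) :
  cabs (\sum_(i <- r) F i) <= \sum_(i <- r) cabs (F i).
Proof.
elim/big_ind2: _ => [|a b c e ab ce|//]; first by rewrite cabs0.
exact: (le_trans (cabsD _ _) (lerD ab ce)).
Qed.
Lemma Complex_real_prod (I : Type) (r : seq I) (F : I -> R) :
  Complex (\prod_(i <- r) F i) 0 = \prod_(i <- r) (Complex (F i) 0 : C).
Proof.
elim/big_ind2: _ => [//|a b c e <- <-|//].
by apply: complex_ext; rewrite ?ReM ?ImM/= ?mulr0 ?mul0r ?subr0 ?addr0.
Qed.
End ComplexNumbers.

Section ComplexIntegral.
Context (R : realType) (dp : measure_display) (T : measurableType dp).
Variable mu : {measure set T -> \bar R}.
Local Notation C := R[i].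
Implicit Types f g : T -> C.

Definition cint f : C :=
  Complex (Rintegral mu setT (fun x => complex.Re (f x)))
          (Rintegral mu setT (fun x => complex.Im (f x))).

Definition cintegrable f : Prop :=
  mu.-integrable setT (EFin \o (fun x => complex.Re (f x))) /\
  mu.-integrable setT (EFin \o (fun x => complex.Im (f x))).

Definition cmeasurable f : Prop :=
  measurable_fun setT (fun x => complex.Re (f x)) /\
  measurable_fun setT (fun x => complex.Im (f x)).

Lemma cmeasurableM f g : cmeasurable f -> cmeasurable g -> cmeasurable (fun x => f x * g x).
Proof.
move=> [f1 f2] [g1 g2]; split.
  under eq_fun do rewrite ReM.
  by apply: measurable_funB; exact: measurable_funM.
under eq_fun do rewrite ImM.
by apply: measurable_funD; exact: measurable_funM.
Qed.

Lemma cmeasurable_cexp (h : T -> R) : measurable_fun setT h -> cmeasurable (fun x => cexp (h x)).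
Proof.
move=> mh; split => /=; apply: measurableT_comp => //.
  by apply: continuous_measurable_fun; exact: continuous_cos.
by apply: continuous_measurable_fun; exact: continuous_sin.
Qed.

Lemma cmeasurable_real (h : T -> R) : measurable_fun setT h -> cmeasurable (fun x => Complex (h x) 0).
Proof. by move=> mh; split => //=; exact: measurable_cst. Qed.

Lemma cintegrable_measurable f : cintegrable f -> cmeasurable f.
Proof. by move=> [/integrableP[/measurable_EFinP ? _] /integrableP[/measurable_EFinP ? _]]. Qed.

Lemma cintegrable_dom f (g : T -> R) : cmeasurable f -> (forall x, cabs (f x) <= g x) ->
  mu.-integrable setT (EFin \o g) -> cintegrable f.
Proof.
move=> [m1 m2] fg ig; split; apply: le_integrable ig => //; try exact/measurable_EFinP;
  move=> x _ /=; rewrite lee_fin; apply: le_trans (ler_norm _); apply: le_trans (fg x).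
  exact: Re_le_cabs.
exact: Im_le_cabs.
Qed.

Lemma eq_cint f g : f =1 g -> cint f = cint g.
Proof. by move=> /funext ->. Qed.

Lemma cintegrableD f g : cintegrable f -> cintegrable g -> cintegrable (fun x => f x + g x).
Proof.
move=> [f1 f2] [g1 g2]; split.
  have := integrableD measurableT f1 g1; congr (_.-integrable _ _).
  by apply/funext => x /=; rewrite cReD EFinD.
have := integrableD measurableT f2 g2; congr (_.-integrable _ _).
by apply/funext => x /=; rewrite cImD EFinD.
Qed.

Lemma cintD f g : cintegrable f -> cintegrable g ->
  cint (fun x => f x + g x) = cint f + cint g.
Proof.
move=> [f1 f2] [g1 g2]; apply: complex_ext; rewrite ?cReD ?cImD/= -RintegralD//.
  by apply: eq_Rintegral => x _; rewrite cReD.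
by apply: eq_Rintegral => x _; rewrite cImD.
Qed.

Lemma cintegrableZ (c : C) f : cintegrable f -> cintegrable (fun x => c * f x).
Proof.
case: c => a b [f1 f2]; split.
  have := integrableB measurableT (integrable_scale a f1) (integrable_scale b f2).
  congr (_.-integrable _ _).
  by apply/funext => x /=; rewrite ReM EFinB.
have := integrableD measurableT (integrable_scale a f2) (integrable_scale b f1).
congr (_.-integrable _ _).
by apply/funext => x /=; rewrite ImM EFinD.
Qed.

Lemma cintZ (c : C) f : cintegrable f -> cint (fun x => c * f x) = c * cint f.
Proof.
case: c => a b [f1 f2]; apply: complex_ext; rewrite ?ReM ?ImM/=.
  rewrite -!RintegralZl// -RintegralB//; try exact: integrable_scale.
  by apply: eq_Rintegral => x _; rewrite ReM.
rewrite -!RintegralZl// -RintegralD//; try exact: integrable_scale.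
by apply: eq_Rintegral => x _; rewrite ImM.
Qed.

Lemma cint0 : cint (fun _ => 0) = 0.
Proof.
by apply: complex_ext => /=; rewrite /Rintegral integral0_eq.
Qed.

Lemma cintegrable0 : cintegrable (fun _ => 0).
Proof. by split => /=; exact: integrable0. Qed.

Lemma cintegrable_sum (I : eqType) (r : seq I) (F : I -> T -> C) :
  (forall i, i \in r -> cintegrable (F i)) -> cintegrable (fun x => \sum_(i <- r) F i x).
Proof.
elim: r => [|i r IH] H.
  by under eq_fun do rewrite big_nil; exact: cintegrable0.
under eq_fun do rewrite big_cons; apply: cintegrableD; first by apply: H; rewrite inE eqxx.
by apply: IH => j jr; apply: H; rewrite inE jr orbT.
Qed.

Lemma cint_sum (I : eqType) (r : seq I) (F : I -> T -> C) :
  (forall i, i \in r -> cintegrable (F i)) ->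
  cint (fun x => \sum_(i <- r) F i x) = \sum_(i <- r) cint (F i).
Proof.
elim: r => [|i r IH] H.
  by rewrite big_nil; apply: etrans cint0; apply: eq_cint => x; rewrite big_nil.
have Hr j : j \in r -> cintegrable (F j) by move=> jr; apply: H; rewrite inE jr orbT.
rewrite big_cons -IH// -cintD//.
- by apply: eq_cint => x; rewrite big_cons.
- by apply: H; rewrite inE eqxx.
- exact: cintegrable_sum.
Qed.

(** The factor 2 comes from bounding the real and imaginary parts separately. *)
Lemma cabs_cint_le f (g : T -> R) : cintegrable f -> (forall x, cabs (f x) <= g x) ->
  mu.-integrable setT (EFin \o g) -> cabs (cint f) <= 2 * Rintegral mu setT g.
Proof.
move=> [f1 f2] fg ig; apply: (le_trans (cabs_le_ReIm _)); rewrite mulr2n mulrDl !mul1r.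
have H (h : T -> R) : mu.-integrable setT (EFin \o h) -> (forall x, `|h x| <= g x) ->
    `|Rintegral mu setT h| <= Rintegral mu setT g.
  move=> ih hg; apply: (le_trans (le_normr_Rintegral _ ih)) => //.
  apply: le_Rintegral => //.
  by have := integrable_norm ih; congr (_.-integrable _ _).
by apply: lerD; apply: H => // x; apply: le_trans (fg x); [exact: Re_le_cabs|exact: Im_le_cabs].
Qed.

End ComplexIntegral.

(** * Integrals of products of one-variable functions *)

Section Tensor.
Variable R : realType.
Local Notation T n := (projT2 (RdT R n)).
Local Notation mu n := (lebRd R n).
Local Notation leb := (@lebesgue_measure R).
Local Notation lebS n := (sfmeas (@sigma_finite_lebRd R n)).

Lemma integrable_tensor n (f : R -> R) (g : T n -> R) :
  leb.-integrable setT (EFin \o f) -> (mu n).-integrable setT (EFin \o g) ->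
  (mu n.+1).-integrable setT (EFin \o (fun z => f z.1 * g z.2)).
Proof.
move=> fi gi; have /integrableP[/measurable_EFinP mf fy] := fi.
have /integrableP[/measurable_EFinP mg gy] := gi.
have mfg : measurable_fun setT (fun z : T n.+1 => f z.1 * g z.2).
  apply: measurable_funM.
    by apply: (measurableT_comp mf); exact: measurable_fst.
  by apply: (measurableT_comp mg); exact: measurable_snd.
apply/integrableP; split; first exact/measurable_EFinP.
rewrite (@integral_lebRdS R n (fun z => `|(f z.1 * g z.2)%:E|%E))//; last first.
  by apply: measurableT_comp => //; exact/measurable_EFinP.
rewrite (_ : (fun _ => _) = (fun y => (\int[leb]_x `|(f x)%:E|) * `|(g y)%:E|)%E).
  rewrite ge0_integralZl//.
  - by apply: lte_mul_pinfty => //; [exact: integral_ge0|rewrite ge0_fin_numE//; exact: integral_ge0].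
  - by apply: measurableT_comp => //; exact/measurable_EFinP.
  - exact: integral_ge0.
apply/funext => y; rewrite -ge0_integralZr//.
  by apply: eq_integral => x _; rewrite EFinM abseM.
by apply: measurableT_comp => //; apply/measurable_EFinP; exact: mf.
Qed.

Lemma Rintegral_tensor n (f : R -> R) (g : T n -> R) :
  leb.-integrable setT (EFin \o f) -> (mu n).-integrable setT (EFin \o g) ->
  Rintegral (mu n.+1) setT (fun z => f z.1 * g z.2) =
  Rintegral leb setT f * Rintegral (mu n) setT g.
Proof.
move=> fi gi; have fgi := integrable_tensor fi gi.
have fgi' : (leb \x lebS n)%E.-integrable setT (EFin \o (fun z => f z.1 * g z.2)).
  have /integrableP[m1 m2] := fgi; apply/integrableP; split => //.
  apply: le_lt_trans m2; rewrite le_eqVlt; apply/orP; left; apply/eqP.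
  by apply: eq_measure_integral => A mA _; exact: lebRdS_eq.
rewrite /Rintegral.
transitivity (fine (\int[leb]_x \int[lebS n]_y (f x * g y)%:E)).
  by congr fine; apply: esym; exact: (integral12_prod_meas2 fgi').
have gfin : (\int[mu n]_y (g y)%:E \is a fin_num)%E by exact: integrable_fin_num.
have ffin : (\int[leb]_x (f x)%:E \is a fin_num)%E by exact: integrable_fin_num.
rewrite -fineM//; congr fine.
transitivity (\int[leb]_x ((\int[mu n]_y (g y)%:E) * (f x)%:E))%E.
  apply: eq_integral => x _.
  transitivity (\int[mu n]_y ((f x)%:E * (g y)%:E))%E.
    by apply: eq_integral => y _; rewrite EFinM.
  by rewrite integralZl// muleC.
by rewrite -(fineK gfin) integralZl// muleC.
Qed.

Lemma cint_tensor n (F : R -> R[i]) (G : T n -> R[i]) :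
  cintegrable leb F -> cintegrable (mu n) G ->
  cintegrable (mu n.+1) (fun z => F z.1 * G z.2) /\
  cint (mu n.+1) (fun z => F z.1 * G z.2) = cint leb F * cint (mu n) G.
Proof.
move=> [F1 F2] [G1 G2]; split.
  split.
    have := integrableB measurableT (integrable_tensor F1 G1) (integrable_tensor F2 G2).
    congr (integrable _ _ _); by apply/funext => z /=; rewrite ReM EFinB.
  have := integrableD measurableT (integrable_tensor F1 G2) (integrable_tensor F2 G1).
  congr (integrable _ _ _); by apply/funext => z /=; rewrite ImM EFinD.
apply: complex_ext; rewrite ?ReM ?ImM/= -!Rintegral_tensor//.
  apply: etrans (RintegralB measurableT (integrable_tensor F1 G1) (integrable_tensor F2 G2)).
  by apply: eq_Rintegral => z _; rewrite ReM.
apply: etrans (RintegralD measurableT (integrable_tensor F1 G2) (integrable_tensor F2 G1)).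
by apply: eq_Rintegral => z _; rewrite ImM.
Qed.

Lemma cint_prodRd n (phi : nat -> R -> R[i]) : (forall i, cintegrable leb (phi i)) ->
  cintegrable (mu n) (fun y => \prod_(i < n) phi i (coordRd y i)) /\
  cint (mu n) (fun y => \prod_(i < n) phi i (coordRd y i)) =
  \prod_(i < n) cint leb (phi i).
Proof.
elim: n phi => [|n IH] phi H.
  have i1 r : (mu 0).-integrable setT (EFin \o (fun _ => r)).
    apply/integrableP; split; first exact: measurable_cst.
    by rewrite integral_cst//= diracT mule1 ltry.
  have E0 : (fun y : T 0 => \prod_(i < 0) phi i (coordRd y i)) = fun _ => 1.
    by apply/funext => y; rewrite big_ord0.
  rewrite E0 big_ord0; split; first by split; exact: i1.
  have m0 : mu 0 setT = 1%E by exact: diracT.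
  have c0 r : Rintegral (mu 0) setT (fun _ => r) = r.
    by rewrite /Rintegral (integral_cst (mu 0) measurableT r%:E) m0 mule1.
  by apply: complex_ext; rewrite /cint /= c0.
have [I1 E1] := IH (fun i => phi i.+1) (fun i => H i.+1).
have [I2 E2] := cint_tensor (H 0%N) I1.
rewrite big_ord_recl -E1 -E2; split; last first.
  by apply: eq_cint => z; rewrite big_ord_recl.
by move: I2; congr (cintegrable _ _); apply/funext => z; rewrite big_ord_recl.
Qed.

(** The products run over ['I_n], while the induction on the dimension shifts indices and uses
    families on [nat]; beyond n the value is the default [a]. *)
Definition ordfun (n : nat) (A : Type) (a : A) (w : 'I_n -> A) (i : nat) : A :=
  if insub i is Some j then w j else a.

Lemma ordfunE n A (a : A) (w : 'I_n -> A) (i : 'I_n) : ordfun a w i = w i.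
Proof. by rewrite /ordfun insubT//= => ?; congr w; exact: val_inj. Qed.

Lemma ordfunP n A (a : A) (w : 'I_n -> A) (P : A -> Prop) : P a ->
  (forall i, P (w i)) -> forall i, P (ordfun a w i).
Proof. by move=> Pa Pw i; rewrite /ordfun; case: insubP. Qed.
End Tensor.

Section Rd.
Variables (R : realType) (d : nat).
Local Notation T := (projT2 (RdT R d)).
Local Notation mu := (lebRd R d).
Local Notation leb := (@lebesgue_measure R).
Local Notation V := ('rV[R]_d).
Local Notation C := (R[i]).

Lemma vecRdE (y : T) (i : 'I_d) : vecRd y 0 i = coordRd y i.
Proof. by rewrite mxE. Qed.

Lemma vecRd_shift (y : T) (i : 'I_d) h : vecRd (shiftRd i h y) = vecRd y + h *: delta_mx 0 i.
Proof.
apply/rowP => j; rewrite !mxE coordRd_shift ?ltn_ord//; congr (_ + _).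
by rewrite eqxx/= -(inj_eq val_inj); case: eqP; rewrite ?mulr1 ?mulr0.
Qed.

Lemma integral_prodV (w : 'I_d -> R -> R) :
  (forall i, measurable_fun setT (w i)) -> (forall i x, 0 <= w i x) ->
  (\int[mu]_y (\prod_(i < d) w i (vecRd y 0 i))%:E = \prod_(i < d) \int[leb]_x (w i x)%:E)%E.
Proof.
move=> mw w0; pose w' := ordfun (fun _ : R => (0 : R)) w.
transitivity (\int[mu]_y (\prod_(i < d) w' i (coordRd y i))%:E)%E.
  apply: eq_integral => y _; congr _%:E; apply: eq_bigr => i _.
  by rewrite /w' ordfunE vecRdE.
rewrite integral_prodRd.
- by apply: eq_bigr => i _; rewrite /w' ordfunE.
- by apply: (ordfunP (P := fun f => measurable_fun setT f)) => //; exact: measurable_cst.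
- by apply: (ordfunP (P := fun f => forall x, 0 <= f x)).
Qed.

Lemma cint_prodV (phi : 'I_d -> R -> C) : (forall i, cintegrable leb (phi i)) ->
  cintegrable mu (fun y => \prod_(i < d) phi i (vecRd y 0 i)) /\
  cintRd (fun x => \prod_(i < d) phi i (x 0 i)) = \prod_(i < d) cint leb (phi i).
Proof.
move=> H; pose p' := ordfun (fun _ : R => (0 : C)) phi.
have [] := @cint_prodRd R d p'.
  by apply: (ordfunP (P := fun f => cintegrable leb f)) => //; exact: cintegrable0.
have E : (fun y : T => \prod_(i < d) p' i (coordRd y i)) = (fun y => \prod_(i < d) phi i (vecRd y 0 i)).
  by apply/funext => y; apply: eq_bigr => i _; rewrite /p' ordfunE vecRdE.
by rewrite E => ? E2; split => //; apply: etrans E2 _; apply: eq_bigr => i _; rewrite /p' ordfunE.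
Qed.

Lemma cintRd_shift (i : 'I_d) h (f : V -> C) : cintegrable mu (fun y => f (vecRd y)) ->
  cintRd (fun x => f (x + h *: delta_mx 0 i)) = cintRd f.
Proof.
move=> [f1 f2]; rewrite /cintRd /intRd; congr Complex.
  rewrite -[RHS](Rintegral_shiftRd i h f1); apply: eq_Rintegral => y _ /=.
  by rewrite vecRd_shift.
rewrite -[RHS](Rintegral_shiftRd i h f2); apply: eq_Rintegral => y _ /=.
by rewrite vecRd_shift.
Qed.

Lemma measurable_coordV i : measurable_fun setT (fun y : T => vecRd y 0 i).
Proof.
rewrite (_ : (fun y : T => _) = fun y => coordRd y i); first exact: measurable_coordRd.
by apply/funext => y; rewrite vecRdE.
Qed.

Lemma measurable_dotV (f g : V -> V) :
  (forall i, measurable_fun setT (fun y : T => f (vecRd y) 0 i)) ->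
  (forall i, measurable_fun setT (fun y : T => g (vecRd y) 0 i)) ->
  measurable_fun setT (fun y : T => dotR (f (vecRd y)) (g (vecRd y))).
Proof.
by move=> mf mg; apply: measurable_sum => i; exact: measurable_funM.
Qed.

Lemma measurable_subV (c : V) i : measurable_fun setT (fun y : T => (vecRd y - c) 0 i).
Proof.
rewrite (_ : (fun y : T => _) = fun y => vecRd y 0 i - c 0 i).
  by apply: measurable_funB => //; exact: measurable_coordV.
by apply/funext => y; rewrite !mxE.
Qed.

Lemma integral_gaussV (a : R) (c : V) : 0 < a ->
  (\int[mu]_y (expR (- (a * dotR (vecRd y - c) (vecRd y - c))))%:E =
   (Num.sqrt (pi / a) ^+ d)%:E)%E.
Proof.
move=> a0; pose w (i : 'I_d) (x : R) := expR (- (a * (x - c 0 i) ^+ 2)).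
have mw i : measurable_fun setT (w i).
  apply: measurableT_comp => //; apply: measurableT_comp => //.
  by apply: measurable_funM => //; apply: measurable_funX; exact: measurable_funB.
transitivity (\int[mu]_y (\prod_(i < d) w i (vecRd y 0 i))%:E)%E.
  apply: eq_integral => y _; congr _%:E; rewrite /w -expR_sum; congr expR.
  by rewrite mulr_sumr -sumrN; apply: eq_bigr => i _; rewrite !mxE.
rewrite integral_prodV//; last by move=> i x; exact: expR_ge0.
have E i : (\int[leb]_x (w i x)%:E = (Num.sqrt (pi / a))%:E)%E.
  rewrite -(integral_gauss a0).
  have mg : measurable_fun setT (fun x : R => (expR (- (a * x ^+ 2)))%:E).
    by apply/measurable_EFinP; apply: continuous_measurable_fun; exact: continuous_gauss.
  exact: (integral_leb_shift (- c 0 i) mg (fun x => expR_ge0 _)).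
under eq_bigr do rewrite E.
by rewrite prodEFin prodr_const card_ord.
Qed.

Lemma integrable_gaussV (a : R) (c : V) : 0 < a ->
  mu.-integrable setT (EFin \o (fun y => expR (- (a * dotR (vecRd y - c) (vecRd y - c))))).
Proof.
move=> a0; apply/integrableP; split.
  apply/measurable_EFinP; apply: measurableT_comp => //; apply: measurableT_comp => //.
  apply: measurable_funM => //.
  exact: (@measurable_dotV (fun x => x - c) (fun x => x - c) (measurable_subV c) (measurable_subV c)).
under eq_integral do rewrite /= ger0_norm ?expR_ge0//.
by rewrite integral_gaussV// ltry.
Qed.

(** A product of Cauchy profiles of width 1/r, of height 1 and integral (pi/r)^d. As 0 <= w <= 1
    gives w^p <= w, its integral alone controls all Lp norms. *)
Definition wdecay (r : R) (x : V) : R := \prod_(i < d) (1 + (r * x 0 i) ^+ 2)^-1.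

Lemma wdecay_ge0 r x : 0 <= wdecay r x.
Proof. by apply: prodr_ge0 => i _; rewrite invr_ge0 addr_ge0// sqr_ge0. Qed.

Lemma wdecay_le1 r x : wdecay r x <= 1.
Proof.
suff /andP[] : 0 <= wdecay r x <= 1 by [].
rewrite /wdecay; apply: (big_ind (fun z : R => 0 <= z <= 1)) => [|a b|i _].
- by rewrite ler01 lexx.
- by move=> /andP[a0 a1] /andP[b0 b1]; rewrite mulr_ge0// mulr_ile1.
- by rewrite invr_ge0 addr_ge0 ?sqr_ge0//= invf_le1 ?lerDl ?sqr_ge0// ltr_pwDl// sqr_ge0.
Qed.

Lemma measurable_wdecay r (c : V) : measurable_fun setT (fun y : T => wdecay r (vecRd y - c)).
Proof.
apply: measurable_prod => i _.
apply: (@measurableT_comp _ _ _ _ _ _ (fun x : R => (1 + (r * x) ^+ 2)^-1)); last exact: measurable_subV.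
apply: continuous_measurable_fun => x; apply: cvgV.
  by rewrite gt_eqF// ltr_pwDl// sqr_ge0.
apply: cvgD; first exact: cvg_cst.
apply: (@continuous_comp _ _ _ (fun x : R => r * x) (fun x : R => x ^+ 2)); last exact: exprn_continuous.
by apply: cvgM; [exact: cvg_cst|exact: cvg_id].
Qed.

Lemma integral_wdecay (r : R) (c : V) : 0 < r ->
  (\int[mu]_y (wdecay r (vecRd y - c))%:E = ((pi / r) ^+ d)%:E)%E.
Proof.
move=> r0; pose w (i : 'I_d) (x : R) := (1 + (r * (x - c 0 i)) ^+ 2)^-1.
have mg : measurable_fun setT (fun x : R => (1 + (r * x) ^+ 2)^-1).
  apply: continuous_measurable_fun => x; apply: cvgV.
    by rewrite gt_eqF// ltr_pwDl// sqr_ge0.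
  apply: cvgD; first exact: cvg_cst.
  apply: (@continuous_comp _ _ _ (fun x : R => r * x) (fun x : R => x ^+ 2)); last exact: exprn_continuous.
  by apply: cvgM; [exact: cvg_cst|exact: cvg_id].
have w0 i x : 0 <= w i x by rewrite invr_ge0 addr_ge0// sqr_ge0.
transitivity (\int[mu]_y (\prod_(i < d) w i (vecRd y 0 i))%:E)%E.
  by apply: eq_integral => y _; congr _%:E; apply: eq_bigr => i _; rewrite /w !mxE.
rewrite integral_prodV//; last first.
  by move=> i; apply: (measurableT_comp mg); exact: measurable_funB.
have E i : (\int[leb]_x (w i x)%:E = (pi / r)%:E)%E.
  rewrite -(integral_cauchy r0).
  have mg' : measurable_fun setT (fun x : R => ((1 + (r * x) ^+ 2)^-1)%:E) by exact/measurable_EFinP.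
  apply: (integral_leb_shift (- c 0 i) mg') => x.
  by rewrite lee_fin invr_ge0 addr_ge0// sqr_ge0.
under eq_bigr do rewrite E.
by rewrite prodEFin prodr_const card_ord.
Qed.

(** A wave packet of position [y], frequency [c] and spatial width 1/rho; the prefactor gives its
    Fourier transform [gbump] height 1. *)
Definition gatom (c y : V) (rho : R) (x : V) : C :=
  Complex ((rho / Num.sqrt (2 * pi)) ^+ d * expR (- (rho ^+ 2 / 2 * dotR (x - y) (x - y)))) 0
  * cexp (dotR c (x - y)).

Definition gatom1 (rho xi c y x : R) : C :=
  Complex (rho / Num.sqrt (2 * pi)) 0 *
  (cexp (- (x * xi) + c * (x - y)) * Complex (expR (- (rho ^+ 2 / 2 * (x - y) ^+ 2))) 0).

(** The sine is a cosine delayed by pi / 2, so the real formula with a free phase covers both the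
    real and the imaginary part. *)
Lemma gatom1_shift (rho xi c y x : R) :
  cexp (- (x * xi) + c * (x - y)) * Complex (expR (- (rho ^+ 2 / 2 * (x - y) ^+ 2))) 0 =
  Complex (cos ((c - xi) * (x - y) + - (y * xi)) * expR (- (rho ^+ 2 / 2 * (x - y) ^+ 2)))
          (cos ((c - xi) * (x - y) + (- (y * xi) - pi / 2)) * expR (- (rho ^+ 2 / 2 * (x - y) ^+ 2))).
Proof.
have E : - (x * xi) + c * (x - y) = (c - xi) * (x - y) + - (y * xi) by ring.
apply: complex_ext; rewrite ?ReM ?ImM/= ?mulr0 ?mul0r ?subr0 ?add0r E //.
by rewrite addrA cosB cos_pihalf sin_pihalf mulr0 mulr1 add0r.
Qed.

End Rd.

(** * Modulated Gaussians *)

Section GaussAtom.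
Variables (R : realType) (d : nat).
Local Notation T := (projT2 (RdT R d)).
Local Notation mu := (lebRd R d).
Local Notation leb := (@lebesgue_measure R).
Local Notation V := ('rV[R]_d).
Local Notation C := (R[i]).

Lemma cint_gatom1 (rho xi c y : R) : 0 < rho ->
  cintegrable leb (gatom1 rho xi c y) /\
  cint leb (gatom1 rho xi c y) =
    cexp (- (y * xi)) * Complex (expR (- ((xi - c) ^+ 2 / (2 * rho ^+ 2)))) 0.
Proof.
move=> rho0; have a0 : 0 < rho ^+ 2 / 2 by rewrite divr_gt0// exprn_gt0.
set a := rho ^+ 2 / 2 in a0.
pose k th (x : R) := cos ((c - xi) * x + th) * expR (- (a * x ^+ 2)).
have ck th : continuous (k th).
  move=> x; apply: cvgM; last exact: continuous_gauss.
  apply: (@continuous_comp _ _ _ (fun x : R => (c - xi) * x + th) cos); last exact: continuous_cos.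
  by apply: cvgD; [apply: cvgM; [exact: cvg_cst|exact: cvg_id]|exact: cvg_cst].
have mk th : measurable_fun setT (k th) by exact: continuous_measurable_fun.
have ik th : leb.-integrable setT (EFin \o k th).
  apply: (integrable_dominated (@ck th) _ (integrable_gauss a0)) => x.
  by rewrite normrM (ger0_norm (expR_ge0 _)) ler_piMl ?expR_ge0// cos_max.
have iks th : leb.-integrable setT (EFin \o (fun x => k th (x - y))).
  have /integrableP[_ ky] := ik th; apply/integrableP; split.
    apply/measurable_EFinP; apply: (measurableT_comp (mk th)).
    exact: measurable_funB.
  apply: le_lt_trans ky; rewrite le_eqVlt; apply/orP; left; apply/eqP.
  apply: (integral_leb_shift (- y) (f := fun x => `|(k th x)%:E|%E)) => //.
  by apply: measurableT_comp => //; exact/measurable_EFinP.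
have E : (fun x : R => cexp (- (x * xi) + c * (x - y)) * Complex (expR (- (rho ^+ 2 / 2 * (x - y) ^+ 2))) 0) =
  (fun x => Complex (k (- (y * xi)) (x - y)) (k (- (y * xi) - pi / 2) (x - y))).
  by apply/funext => x; exact: gatom1_shift.
have I1 : cintegrable leb (fun x => Complex (k (- (y * xi)) (x - y)) (k (- (y * xi) - pi / 2) (x - y))).
  by split; exact: iks.
rewrite /gatom1; split.
  by apply: cintegrableZ; rewrite E.
rewrite cintZ ?E// /cint /=.
have val th : Rintegral leb setT (fun x => k th (x - y)) =
    cos th * Num.sqrt (pi / a) * expR (- ((xi - c) ^+ 2 / (2 * rho ^+ 2))).
  rewrite (Rintegral_leb_shift (- y) (mk th)).
  rewrite /k Rintegral_cos_gauss//; congr (_ * expR (- _)).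
  by rewrite /a; field; rewrite gt_eqF.
rewrite !val.
have sE : rho / Num.sqrt (2 * pi) * Num.sqrt (pi / a) = 1.
  have -> : pi / a = 2 * pi / rho ^+ 2 by rewrite /a; field; rewrite gt_eqF.
  rewrite [Num.sqrt (_ / _)]sqrtrM ?mulr_ge0 ?pi_ge0// sqrtrV ?sqr_ge0// sqrtr_sqr gtr0_norm//.
  by field; rewrite gt_eqF//= gt_eqF// sqrtr_gt0 mulr_gt0// pi_gt0.
apply: complex_ext; rewrite !(ReM, ImM)/= !mul0r !mulr0 ?subr0 ?addr0 ?add0r.
  by rewrite !mulrA (mulrAC _ (cos _)) sE mul1r.
rewrite !mulrA (mulrAC _ (cos _)) sE mul1r; congr (_ * _).
by rewrite cosB cos_pihalf sin_pihalf mulr0 mulr1 add0r.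
Qed.

Lemma gatom_prod (c y xi x : V) rho :
  cexp (- dotR x xi) * gatom c y rho x =
  \prod_(i < d) gatom1 rho (xi 0 i) (c 0 i) (y 0 i) (x 0 i).
Proof.
rewrite /gatom1 !big_split/=.
rewrite -!Complex_real_prod -cexp_sum prodr_const card_ord -expR_sum.
rewrite (_ : \sum_(i < d) - (rho ^+ 2 / 2 * _) = - (rho ^+ 2 / 2 * dotR (x - y) (x - y))); last first.
  rewrite mulr_sumr -sumrN; apply: eq_bigr => i _; by rewrite !mxE.
rewrite big_split/= cexpD (_ : \sum_(i < d) - _ = - dotR x xi); last by rewrite sumrN.
rewrite (_ : \sum_(i < d) _ = dotR c (x - y)); last by apply: eq_bigr => i _; rewrite !mxE.
rewrite /gatom (_ : Complex (_ * _) 0 = Complex ((rho / Num.sqrt (2 * pi)) ^+ d) 0 *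
  Complex (expR (- (rho ^+ 2 / 2 * dotR (x - y) (x - y)))) 0); last first.
  by apply: complex_ext; rewrite ?ReM ?ImM/= ?mulr0 ?mul0r ?subr0 ?addr0.
by ring.
Qed.

Definition gbump (c y : V) (rho : R) (xi : V) : C :=
  cexp (- dotR y xi) * Complex (expR (- (dotR (xi - c) (xi - c) / (2 * rho ^+ 2)))) 0.

Lemma gatom_fourier (c y : V) (rho : R) xi : 0 < rho ->
  cintegrable mu (fun z => cexp (- dotR (vecRd z) xi) * gatom c y rho (vecRd z)) /\
  fourier (gatom c y rho) xi = gbump c y rho xi.
Proof.
move=> rho0.
have [H1 H2] := cint_prodV (fun i => (cint_gatom1 (xi 0 i) (c 0 i) (y 0 i) rho0).1).
split.
  by move: H1; congr (cintegrable _ _); apply/funext => z; rewrite gatom_prod.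
rewrite /fourier (_ : (fun x => _) = fun x : V => \prod_(i < d) gatom1 rho (xi 0 i) (c 0 i) (y 0 i) (x 0 i)); last first.
  by apply/funext => x; rewrite gatom_prod.
rewrite H2; under eq_bigr do rewrite (cint_gatom1 _ _ _ rho0).2.
rewrite big_split/= -cexp_sum -Complex_real_prod -expR_sum /gbump; congr (cexp _ * Complex (expR _) 0).
  by rewrite sumrN.
by rewrite sumrN mulr_suml; congr (- _); apply: eq_bigr => i _; rewrite !mxE.
Qed.

Lemma fourier_sum_gatom (I : eqType) (r : seq I) (c y : I -> V) (rho : R) xi : 0 < rho ->
  fourier (fun x => \sum_(k <- r) gatom (c k) (y k) rho x) xi =
  \sum_(k <- r) gbump (c k) (y k) rho xi.
Proof.
move=> rho0; rewrite /fourier.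
transitivity (cint mu (fun z => \sum_(k <- r) cexp (- dotR (vecRd z) xi) * gatom (c k) (y k) rho (vecRd z))).
  by apply: eq_cint => z; rewrite mulr_sumr.
rewrite cint_sum; last by move=> k _; have [] := gatom_fourier (c k) (y k) xi rho0.
by apply: eq_bigr => k _; have [] := gatom_fourier (c k) (y k) xi rho0.
Qed.

End GaussAtom.

(** * Elementary inequalities and Euclidean geometry *)

Section PolyExp.
Variable R : realType.
(** With q = (m+1) / kappa, 1 + w <= (1 + q) exp(kappa w / (m+1)); raise this to the power m+1. *)
Lemma poly_exp_bound (kappa : R) (m : nat) : 0 < kappa ->
  exists2 K : R, 0 < K & forall w, 0 <= w -> (1 + w) ^+ m * expR (- (kappa * w)) <= K.
Proof.
move=> k0; pose m1 : R := m.+1%:R; have m10 : 0 < m1 by rewrite ltr0n.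
pose q := m1 / kappa; have q0 : 0 < q by rewrite divr_gt0.
exists ((1 + q) ^+ m.+1); first by rewrite exprn_gt0// addr_gt0.
move=> w w0.
have h : 1 + w <= (1 + q) * expR (kappa / m1 * w).
  apply: le_trans (ler_wpM2l (addr_ge0 ler01 (ltW q0)) (expR_ge1Dx _)).
  have -> : (1 + q) * (1 + kappa / m1 * w) = 1 + w + (q + kappa / m1 * w).
    by rewrite /q; field; rewrite !gt_eqF.
  by rewrite lerDl addr_ge0 ?(ltW q0)// mulr_ge0// divr_ge0 ?ltW.
rewrite expRN ler_pdivrMr ?expR_gt0//.
have -> : expR (kappa * w) = expR (kappa / m1 * w) ^+ m.+1.
  by rewrite -expRM_natl; congr expR; rewrite -/m1; field; rewrite gt_eqF.
rewrite -exprMn; apply: (@le_trans _ _ ((1 + w) ^+ m.+1)).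
  by rewrite exprS ler_peMl ?exprn_ge0 ?addr_ge0// lerDl.
by rewrite lerXn2r// nnegrE ?addr_ge0// mulr_ge0 ?expR_ge0// addr_ge0// ltW.
Qed.
End PolyExp.

Section DotProduct.
Variables (R : realType) (d : nat).
Local Notation V := ('rV[R]_d).
Implicit Types x y z : V.

Lemma dotRC x y : dotR x y = dotR y x.
Proof. by apply: eq_bigr => i _; rewrite mulrC. Qed.
Lemma dotRDl x y z : dotR (x + y) z = dotR x z + dotR y z.
Proof. by rewrite /dotR -big_split; apply: eq_bigr => i _; rewrite !mxE mulrDl. Qed.
Lemma dotRDr x y z : dotR z (x + y) = dotR z x + dotR z y.
Proof. by rewrite dotRC dotRDl !(dotRC z). Qed.
Lemma dotRZl (a : R) x y : dotR (a *: x) y = a * dotR x y.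
Proof. by rewrite /dotR mulr_sumr; apply: eq_bigr => i _; rewrite !mxE mulrA. Qed.
Lemma dotRZr (a : R) x y : dotR y (a *: x) = a * dotR y x.
Proof. by rewrite dotRC dotRZl dotRC. Qed.
Lemma dotRNl x y : dotR (- x) y = - dotR x y.
Proof. by rewrite -scaleN1r dotRZl mulN1r. Qed.
Lemma dotRNr x y : dotR y (- x) = - dotR y x.
Proof. by rewrite dotRC dotRNl dotRC. Qed.
Lemma dotR_delta x j : dotR x (delta_mx 0 j) = x 0 j.
Proof.
rewrite /dotR (bigD1 j)//= mxE !eqxx mulr1 big1 ?addr0// => i ij.
by rewrite mxE (negbTE ij) andbF mulr0.
Qed.
Lemma dotR_sqrD x y : dotR (x + y) (x + y) = dotR x x + 2 * dotR x y + dotR y y.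
Proof. by rewrite dotRDl !dotRDr (dotRC y x); ring. Qed.
Lemma dotR_sqrB x y : dotR (x - y) (x - y) = dotR x x - 2 * dotR x y + dotR y y.
Proof. by rewrite dotR_sqrD !dotRNr !dotRNl opprK; ring. Qed.
Lemma dotR_ge0 x : 0 <= dotR x x.
Proof. by apply: sumr_ge0 => i _; rewrite -expr2 sqr_ge0. Qed.
Lemma sqr_coord_le x i : x 0 i ^+ 2 <= dotR x x.
Proof. by rewrite /dotR (bigD1 i)//= -expr2 lerDl sumr_ge0// => j _; rewrite -expr2 sqr_ge0. Qed.
Lemma enorm_ge0 x : 0 <= enorm x. Proof. exact: sqrtr_ge0. Qed.
Lemma sqr_enorm x : enorm x ^+ 2 = dotR x x.
Proof. by rewrite sqr_sqrtr// dotR_ge0. Qed.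
Lemma coord_le_enorm x i : `|x 0 i| <= enorm x.
Proof. by rewrite -sqrtr_sqr ler_wsqrtr// sqr_coord_le. Qed.
Lemma dotR_sqr_le x y : dotR x y ^+ 2 <= dotR x x * dotR y y.
Proof.
have [y0|y0] := eqVneq (dotR y y) 0.
  have yy i : y 0 i = 0.
    by apply/eqP; rewrite -sqrf_eq0 eq_le sqr_ge0 andbT -y0 sqr_coord_le.
  by rewrite y0 mulr0 /dotR big1 ?expr0n// => i _; rewrite yy mulr0.
have yp : 0 < dotR y y by rewrite lt_neqAle eq_sym y0 dotR_ge0.
have := dotR_ge0 (dotR y y *: x - dotR x y *: y).
rewrite dotRDl !dotRDr !dotRNl !dotRNr !dotRZl !dotRZr (dotRC y x).
rewrite (_ : _ + _ = dotR y y * (dotR x x * dotR y y - dotR x y ^+ 2)); last by ring.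
by rewrite pmulr_rge0// subr_ge0.
Qed.
Lemma cauchy_schwarz x y : `|dotR x y| <= enorm x * enorm y.
Proof.
rewrite -(@ler_pXn2r _ 2)// ?nnegrE ?mulr_ge0 ?enorm_ge0//.
by rewrite real_normK ?num_real// exprMn !sqr_enorm dotR_sqr_le.
Qed.
Lemma enormD x y : enorm (x + y) <= enorm x + enorm y.
Proof.
rewrite -(@ler_pXn2r _ 2)// ?nnegrE ?addr_ge0 ?enorm_ge0// sqr_enorm sqrrD.
rewrite !sqr_enorm dotRDl !dotRDr (dotRC y x).
have := le_trans (ler_norm _) (cauchy_schwarz x y); rewrite mulr2n; lra.
Qed.
Lemma enormN x : enorm (- x) = enorm x.
Proof. by rewrite /enorm dotRNl dotRNr opprK. Qed.
Lemma enormZ (a : R) x : enorm (a *: x) = `|a| * enorm x.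
Proof. by rewrite /enorm dotRZl dotRZr mulrA -expr2 sqrtrM ?sqr_ge0// sqrtr_sqr. Qed.
Lemma enorm_delta j : enorm (delta_mx 0 j : V) = 1.
Proof. by rewrite /enorm dotR_delta mxE !eqxx sqrtr1. Qed.
End DotProduct.

(** * Wave packets are Schwartz functions *)

Section Schwartz.
Variables (R : realType) (d : nat).
Local Notation V := ('rV[R]_d).

Lemma is_derive_line (g : V -> R) (x v : V) (l : R) :
  is_derive (0 : R) 1 (fun t : R => g (t *: v + x)) l -> is_derive x v g l.
Proof.
have E : (fun h : R => h^-1 *: (((fun t : R => g (t *: v + x)) \o shift 0) (h *: 1) -
      (fun t : R => g (t *: v + x)) 0)) =
   (fun h : R => h^-1 *: ((g \o shift x) (h *: v) - g x)).
  by apply/funext => h /=; rewrite addr0 scale0r add0r /GRing.scale/= mulr1.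
by case=> D1 D2; apply: DeriveDef; rewrite /derivable /derive -E.
Qed.

Lemma is_derive_along (g : V -> R) (x v : V) (t : R) :
  derivable g (t *: v + x) v ->
  is_derive t 1 (fun s : R => g (s *: v + x)) (derive g (t *: v + x) v).
Proof.
have E : (fun h : R => h^-1 *: (((fun t : R => g (t *: v + x)) \o shift t) (h *: 1) -
      (fun t : R => g (t *: v + x)) t)) =
   (fun h : R => h^-1 *: ((g \o shift (t *: v + x)) (h *: v) - g (t *: v + x))).
  by apply/funext => h /=; rewrite (mulr1 h : h *: (1 : R) = h) scalerDl addrA.
by move=> D; apply: DeriveDef; rewrite /derivable /derive E.
Qed.

Definition gbase (rho : R) (y c : V) (phi : R) (x : V) : R :=
  cos (dotR c (x - y) + phi) * expR (- (rho ^+ 2 / 2 * dotR (x - y) (x - y))).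

(** A class closed under partial derivatives: differentiating the cosine only adds pi / 2 to [phi],
    differentiating the Gaussian brings out a coordinate. Decay of the members then bounds all
    iterated derivatives at once. *)
Inductive gclass : (V -> R) -> Prop :=
| gclass_base rho y c phi : 0 < rho -> gclass (gbase rho y c phi)
| gclass_coord i g : gclass g -> gclass (fun x => x 0 i * g x)
| gclass_add g h : gclass g -> gclass h -> gclass (fun x => g x + h x)
| gclass_scale (a : R) g : gclass g -> gclass (fun x => a * g x).

Lemma is_derive_coord (x : V) i j :
  is_derive x (delta_mx 0 j : V) (fun x : V => x 0 i) ((i == j)%:R).
Proof.
apply: is_derive_line.
rewrite (_ : (fun t : R => _) = (fun t : R => t * (i == j)%:R + x 0 i)).
  by apply: is_derive_eq; rewrite /GRing.scale/=; ring.
by apply/funext => t; rewrite !mxE eqxx.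
Qed.

Lemma is_derive_gbase rho y c phi (x : V) j :
  is_derive x (delta_mx 0 j : V) (gbase rho y c phi)
    ((c 0 j * gbase rho y c (phi + pi / 2) x + - rho ^+ 2 * (x 0 j * gbase rho y c phi x))
     + rho ^+ 2 * y 0 j * gbase rho y c phi x).
Proof.
apply: is_derive_line.
pose A := dotR (x - y) (x - y); pose B := dotR c (x - y).
rewrite (_ : (fun t : R => _) = (fun t : R => cos (c 0 j * t + (B + phi)) *
    expR (- (rho ^+ 2 / 2 * (A + t * (2 * (x 0 j - y 0 j)) + t ^+ 2))))); last first.
  apply/funext => t; rewrite /gbase -addrA /A /B.
  have zE : (x - y) 0 j = x 0 j - y 0 j by rewrite !mxE.
  have eE : (delta_mx 0 j : V) 0 j = 1 by rewrite mxE !eqxx.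
  move: (x - y) zE => z zE; rewrite -zE.
  congr (cos _ * expR (- (_ * _))); first by rewrite dotRDr dotRZr dotR_delta; ring.
  rewrite dotRDl !dotRDr !dotRZl !dotRZr (dotRC (delta_mx 0 j) z) !dotR_delta eE; ring.
have cE (w : R) : cos (w + pi / 2) = - sin w.
  by rewrite cosD cos_pihalf sin_pihalf mulr0 mulr1 sub0r.
apply: is_derive_eq.
rewrite /gbase -/A -/B [in RHS]addrA cE /GRing.scale/=.
rewrite expr0n/= !mul0r !mulr0 !addr0 !add0r.
by field.
Qed.

Lemma gclass_derive g : gclass g -> forall j, exists2 g', gclass g' &
  forall x, is_derive x (delta_mx 0 j : V) g (g' x).
Proof.
elim=> {g} [rho y c phi r0|i g cg IH|g h cg IHg ch IHh|a g cg IH] j.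
- exists (fun x => (c 0 j * gbase rho y c (phi + pi / 2) x +
      - rho ^+ 2 * (x 0 j * gbase rho y c phi x)) + rho ^+ 2 * y 0 j * gbase rho y c phi x).
    have B := gclass_base y c _ r0.
    apply: (gclass_add (g := fun x => _ + _)); last exact: gclass_scale.
    apply: gclass_add; apply: gclass_scale => //.
    by apply: gclass_coord.
  by move=> x; exact: is_derive_gbase.
- have [g' cg' D] := IH j.
  exists (fun x => (i == j)%:R * g x + x 0 i * g' x).
    by apply: gclass_add; [exact: gclass_scale|exact: gclass_coord].
  move=> x; have D1 := is_derive_coord x i j; have D2 := D x.
  by have := is_deriveM D1 D2; congr (is_derive _ _ _ _); rewrite addrC /GRing.scale/= mulrC.
- have [g' cg' Dg] := IHg j; have [h' ch' Dh] := IHh j.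
  exists (fun x => g' x + h' x); first exact: gclass_add.
  by move=> x; exact: (is_deriveD (Dg x) (Dh x)).
- have [g' cg' D] := IH j; exists (fun x => a * g' x); first exact: gclass_scale.
  by move=> x; exact: (is_deriveZ a (D x)).
Qed.

Lemma gclass_decay g : gclass g -> forall m : nat, exists M : R,
  forall x, (1 + dotR x x) ^+ m * `|g x| <= M.
Proof.
have p1 (x : V) : 0 <= 1 + dotR x x by rewrite addr_ge0// dotR_ge0.
elim=> {g} [rho y c phi r0|i g cg IH|g h cg IHg ch IHh|a g cg IH] m.
- have k0 : 0 < rho ^+ 2 / 2 by rewrite divr_gt0// exprn_gt0.
  have [K K0 HK] := poly_exp_bound m k0.
  (* From 1 + |x|^2 <= 2 (1 + |y|^2) (1 + |x - y|^2). *)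
  pose Y := 2 * (1 + dotR y y).
  have Y0 : 0 < Y by rewrite mulr_gt0// ltr_pwDl// dotR_ge0.
  exists (Y ^+ m * K) => x.
  rewrite /gbase normrM (ger0_norm (expR_ge0 _)).
  apply: (@le_trans _ _ ((Y * (1 + dotR (x - y) (x - y))) ^+ m *
     expR (- (rho ^+ 2 / 2 * dotR (x - y) (x - y))))).
    apply: ler_pM; rewrite ?exprn_ge0 ?mulr_ge0 ?expR_ge0//; last first.
      by rewrite ler_piMl ?expR_ge0// cos_max.
    rewrite lerXn2r// ?nnegrE ?mulr_ge0 ?(ltW Y0)//.
    have xE : dotR x x = dotR (x - y + y) (x - y + y) by rewrite subrK.
    rewrite xE /Y; move: (x - y) => z; rewrite dotR_sqrD.
    have := dotR_ge0 (z - y); have := mulr_ge0 (dotR_ge0 z) (dotR_ge0 y).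
    rewrite dotR_sqrB; lra.
  by rewrite exprMn -[leLHS]mulrA ler_wpM2l ?exprn_ge0 ?(ltW Y0)// HK// dotR_ge0.
(* One more power of 1 + |x|^2 pays for the factor |x_i|. *)
- have [M HM] := IH m.+1; exists M => x; apply: le_trans (HM x).
  rewrite normrM exprSr -!mulrA ler_wpM2l ?exprn_ge0// ler_wpM2r//.
  have := sqr_coord_le x i; rewrite -(real_normK (num_real (x 0 i))).
  have := sqr_ge0 (`|x 0 i| - 1); nra.
- have [M HM] := IHg m; have [N HN] := IHh m; exists (M + N) => x.
  apply: le_trans (lerD (HM x) (HN x)); rewrite -mulrDr ler_wpM2l ?exprn_ge0//.
  exact: ler_normD.
- have [M HM] := IH m; exists (`|a| * M) => x.
  by rewrite normrM mulrCA ler_wpM2l.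
Qed.

Lemma gclass_schwartz g : gclass g -> rschwartz g.
Proof.
move=> cg js.
have cp : gclass (pderivs js g).
  elim: js => [//|j js IH] /=.
  have [g' cg' D] := gclass_derive IH j.
  suff -> : pderiv j (pderivs js g) = g' by [].
  by apply/funext => x; have := D x => Dx; apply: derive_val.
split; last exact: gclass_decay.
by move=> x j; have [g' _ D] := gclass_derive cp j; have [] := D x.
Qed.

Lemma gclass_sum (I : Type) (r : seq I) (F : I -> V -> R) : (exists rho : R, 0 < rho) ->
  (forall i, gclass (F i)) -> gclass (fun x => \sum_(i <- r) F i x).
Proof.
move=> [rho rho0] H; elim: r => [|i r IH].
  rewrite (_ : (fun x => _) = fun x => 0 * gbase rho 0 0 0 x).
    by apply: gclass_scale; exact: gclass_base.
  by apply/funext => x; rewrite big_nil mul0r.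
rewrite (_ : (fun x => _) = fun x => F i x + \sum_(i <- r) F i x).
  exact: gclass_add.
by apply/funext => x; rewrite big_cons.
Qed.

Lemma cschwartz_sum_gatom (I : Type) (r : seq I) (c y : I -> V) (rho : R) : 0 < rho ->
  cschwartz (fun x => \sum_(k <- r) gatom (c k) (y k) rho x).
Proof.
move=> rho0; set A := (rho / Num.sqrt (2 * pi)) ^+ d.
have Esum (f : I -> R[i]) : (complex.Re (\sum_(k <- r) f k) = \sum_(k <- r) complex.Re (f k)) *
    (complex.Im (\sum_(k <- r) f k) = \sum_(k <- r) complex.Im (f k)).
  by elim: r => [|k r IH]; rewrite ?big_nil// !big_cons cReD cImD !IH.
split; apply: gclass_schwartz.
  rewrite (_ : (fun x => _) = fun x => \sum_(k <- r) A * gbase rho (y k) (c k) 0 x).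
    by apply: gclass_sum; [exists rho|move=> i; apply: gclass_scale; exact: gclass_base].
  apply/funext => x; rewrite Esum; apply: eq_bigr => k _.
  by rewrite /gatom ReM/= mul0r subr0 /gbase addr0 -/A -mulrA; congr (_ * _); rewrite mulrC.
rewrite (_ : (fun x => _) = fun x => \sum_(k <- r) A * gbase rho (y k) (c k) (- (pi / 2)) x).
  by apply: gclass_sum; [exists rho|move=> i; apply: gclass_scale; exact: gclass_base].
apply/funext => x; rewrite Esum; apply: eq_bigr => k _.
rewrite /gatom ImM/= mul0r addr0 /gbase cosB cos_pihalf sin_pihalf mulr0 mulr1 add0r -/A -mulrA.
by congr (_ * _); rewrite mulrC.
Qed.

End Schwartz.

(** * Finite differences and oscillatory integrals *)

Section Differences1.
Variable R : realType.

Definition dif1 (h : R) (f : R -> R) (t : R) : R := f (t + h) - f t.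

Lemma lipschitz_bound (f f' : R -> R) (t h B : R) :
  (forall s : R, is_derive s 1 f (f' s)) ->
  (forall s, `|s - t| <= `|h| -> `|f' s| <= B) -> `|f (t + h) - f t| <= `|h| * B.
Proof.
move=> D HB.
have cf (a b : R) : {within `[a, b], continuous f}.
  apply: continuous_subspaceT => s.
  by apply/differentiable_continuous/derivable1_diffP; have [] := D s.
have [h0|h0|->] := ltgtP h 0.
- have th : t + h < t by rewrite gtrDl.
  have [c] := MVT th (fun x _ => D x) (cf _ _).
  rewrite in_itv/= => /andP[c1 c2] E; rewrite distrC E normrM.
  rewrite (_ : t - (t + h) = - h); last by ring.
  by rewrite normrN mulrC ler_wpM2l// HB// (ltr0_norm h0) ler0_norm ?subr_le0 ?ltW//; lra.
- have th : t < t + h by rewrite ltrDl.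
  have [c] := MVT th (fun x _ => D x) (cf _ _).
  rewrite in_itv/= => /andP[c1 c2] E; rewrite E normrM.
  rewrite (_ : t + h - t = h); last by ring.
  by rewrite mulrC ler_wpM2l// HB// (gtr0_norm h0) ger0_norm ?subr_ge0 ?ltW//; lra.
- by rewrite addr0 subrr !normr0 mul0r.
Qed.

(** A whole sequence of successive derivatives is carried along because the [dif1 h (F l)] form such
    a sequence again. Each mean value step trades one difference for one derivative and widens the
    window by |h|. *)
Lemma iter_dif1_bound m (F : nat -> R -> R) (t h B : R) :
  (forall l (s : R), is_derive s 1 (F l) (F l.+1 s)) ->
  (forall s, `|s - t| <= m%:R * `|h| -> `|F m s| <= B) ->
  `|iter m (dif1 h) (F 0%N) t| <= B * `|h| ^+ m.
Proof.
elim: m F t B => [|m IH] F t B D HB.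
  by rewrite expr0 mulr1 HB// subrr normr0 mul0r.
rewrite iterSr exprS mulrA [B * _]mulrC.
apply: (IH (fun l => dif1 h (F l))).
  move=> l s; have Ds := D l s; have Dh := D l (s + h).
  have ds : is_derive s 1 (fun s : R => s + h) 1.
    by have := is_deriveD (is_derive_id s (1 : R)) (is_derive_cst h s 1); rewrite addr0.
  have Dc := @is_derive1_comp R (F l) (fun s : R => s + h) s _ _ Dh ds; rewrite mulr1 in Dc.
  exact: (is_deriveB Dc Ds).
move=> s st; apply: (lipschitz_bound (D m)) => w ws; apply: HB.
rewrite -natr1 mulrDl mul1r (_ : w - t = (s - t) + (w - s)); last by ring.
by rewrite (le_trans (ler_normD _ _))// lerD.
Qed.
End Differences1.

Section Differences.
Variables (R : realType) (d : nat).
Local Notation V := ('rV[R]_d).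
Local Notation C := (R[i]).
Local Notation e_ i := (delta_mx 0 i : V).

Definition dif (W : zmodType) (i : 'I_d) (h : R) (f : V -> W) (x : V) : W :=
  f (x + h *: e_ i) - f x.

Lemma iter_dif_line m i h (f : V -> R) (x : V) (t : R) :
  iter m (dif i h) f (x + t *: e_ i) = iter m (dif1 h) (fun s => f (x + s *: e_ i)) t.
Proof.
elim: m f t => [//|m IH] f t; rewrite !iterS /dif /dif1.
by rewrite -addrA -scalerDl !IH.
Qed.

Lemma iter_dif_bound m i (f : V -> R) (h B : R) (x : V) : rschwartz f ->
  (forall s, `|s| <= m%:R * `|h| -> `|pderivs (nseq m i) f (x + s *: e_ i)| <= B) ->
  `|iter m (dif i h) f x| <= B * `|h| ^+ m.
Proof.
move=> sf HB.
rewrite -[x]addr0 -[X in x + X](scale0r (e_ i)) iter_dif_line.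
pose F l s := pderivs (nseq l i) f (x + s *: e_ i).
apply: (@iter_dif1_bound R m F) => [l s|s]; last by rewrite subr0; exact: HB.
have [df _] := sf (nseq l i).
have := is_derive_along (df (s *: e_ i + x) i); rewrite addrC.
congr (is_derive _ _ _ _); by apply/funext => w; rewrite /F addrC.
Qed.

Lemma iter_dif_Re m i h (f : V -> C) x :
  complex.Re (iter m (dif i h) f x) = iter m (dif i h) (fun x => complex.Re (f x)) x.
Proof.
elim: m x => [//|m IH] x; rewrite !iterS /dif -!IH.
by case: (iter m _ f (x + _)) => a b; case: (iter m _ f x).
Qed.
Lemma iter_dif_Im m i h (f : V -> C) x :
  complex.Im (iter m (dif i h) f x) = iter m (dif i h) (fun x => complex.Im (f x)) x.
Proof.
elim: m x => [//|m IH] x; rewrite !iterS /dif -!IH.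
by case: (iter m _ f (x + _)) => a b; case: (iter m _ f x).
Qed.

Lemma iter_difD m i h (f g : V -> C) x :
  iter m (dif i h) (fun x => f x + g x) x = iter m (dif i h) f x + iter m (dif i h) g x.
Proof. by elim: m x => [//|m IH] x; rewrite !iterS /dif !IH opprD addrACA. Qed.

Lemma iter_dif_scale m i h (f : V -> R) (rho : R) (c x : V) : rho != 0 ->
  iter m (dif i h) (fun x => f (rho^-1 *: (x - c))) x =
  iter m (dif i (h / rho)) f (rho^-1 *: (x - c)).
Proof.
move=> r0; elim: m x => [//|m IH] x; rewrite !iterS /dif !IH.
rewrite (_ : rho^-1 *: (x + h *: e_ i - c) = rho^-1 *: (x - c) + (h / rho) *: e_ i)//.
by rewrite addrAC scalerDr scalerA mulrC.
Qed.

Lemma iter_dif_eq0 m i h (f : V -> C) x :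
  (forall k, (k <= m)%N -> f (x + (k%:R * h) *: e_ i) = 0) -> iter m (dif i h) f x = 0.
Proof.
elim: m x => [|m IH] x H; first by have := H 0%N isT; rewrite mul0r scale0r addr0.
have e1 : iter m (dif i h) f (x + h *: e_ i) = 0.
  apply: IH => k km; have := H k.+1 km; rewrite -natr1 mulrDl mul1r scalerDl.
  by rewrite addrA addrAC.
have e2 : iter m (dif i h) f x = 0 by apply: IH => k km; apply: H; exact: leqW.
by rewrite iterS /dif e1 e2 subr0.
Qed.

Section Product.
Variables (i : 'I_d) (h q A B : R) (m : nat) (x : V) (f g : V -> C).
(** The bounds are asked only at shifts with a + k <= m, those reached by m differences at [x]. The
    Gaussian factor can thus be estimated by its size near [x]. *)
Hypothesis Hf : forall a k, (a + k <= m)%N ->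
  cabs (iter a (dif i h) f (x + (k%:R * h) *: e_ i)) <= A * q ^+ a.
Hypothesis Hg : forall a k, (a + k <= m)%N ->
  cabs (iter a (dif i h) g (x + (k%:R * h) *: e_ i)) <= B * q ^+ a.

Let shiftS k y : y + h *: e_ i + (k%:R * h) *: e_ i = y + (k.+1%:R * h) *: e_ i.
Proof. by rewrite -natr1 mulrDl mul1r scalerDl -!addrA; congr (_ + _); rewrite addrC. Qed.

(* Leibniz rule for differences, kept in unexpanded form: one difference turns a
   product of (iterated, shifted) factors into two products of the same shape. *)
Lemma iter_dif_mul l a b k k' : (l + a + k <= m)%N -> (l + b + k' <= m)%N ->
  cabs (iter l (dif i h) (fun y => iter a (dif i h) f (y + (k%:R * h) *: e_ i) *
     iter b (dif i h) g (y + (k'%:R * h) *: e_ i)) x) <= 2 ^+ l * (A * B) * q ^+ (l + a + b).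
Proof.
elim: l a b k k' => [|l IH] a b k k' Ha Hb.
  rewrite /= expr0 mul1r cabsM add0n exprD mulrACA.
  by apply: ler_pM; rewrite ?cabs_ge0//; [exact: Hf|exact: Hg].
rewrite iterSr.
rewrite (_ : dif i h _ = fun y =>
   iter a.+1 (dif i h) f (y + (k%:R * h) *: e_ i) * iter b (dif i h) g (y + (k'.+1%:R * h) *: e_ i)
   + iter a (dif i h) f (y + (k%:R * h) *: e_ i) * iter b.+1 (dif i h) g (y + (k'%:R * h) *: e_ i)).
  rewrite iter_difD (le_trans (cabsD _ _))//.
  have H1 : (l + a.+1 + k <= m)%N by rewrite addnS -addSn.
  have H2 : (l + b + k'.+1 <= m)%N by rewrite addnS -!addSn.
  have H3 : (l + a + k <= m)%N by exact: leq_trans Ha.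
  have H4 : (l + b.+1 + k' <= m)%N by rewrite addnS -addSn.
  apply: (le_trans (lerD (IH _ _ _ _ H1 H2) (IH _ _ _ _ H3 H4))).
  rewrite !addnS !addSn !exprS le_eqVlt; apply/orP; left; apply/eqP; ring.
have difS (w : V -> C) n y :
    dif i h w (y + (n%:R * h) *: e_ i) = w (y + (n.+1%:R * h) *: e_ i) - w (y + (n%:R * h) *: e_ i).
  by rewrite /dif addrAC shiftS.
by apply/funext => y; rewrite !iterS !difS [LHS]/dif !shiftS; ring.
Qed.

Lemma iter_dif_prod : cabs (iter m (dif i h) (fun y => f y * g y) x) <= 2 ^+ m * (A * B) * q ^+ m.
Proof.
have := @iter_dif_mul m 0 0 0 0; rewrite !addn0 => /(_ (leqnn m) (leqnn m)).
rewrite (_ : (fun y => _ * _) = fun y => f y * g y)//.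
by apply/funext => y; rewrite /= !mul0r !scale0r !addr0.
Qed.
End Product.
End Differences.

(** * Decay of oscillatory integrals by differences *)

Section Oscillatory.
Variables (R : realType) (d : nat).
Local Notation T := (projT2 (RdT R d)).
Local Notation mu := (lebRd R d).
Local Notation V := ('rV[R]_d).
Local Notation C := (R[i]).
Local Notation e_ i := (delta_mx 0 i : V).

Definition osc (z : V) (f : V -> C) : C := cintRd (fun xi => cexp (dotR z xi) * f xi).

Lemma measurable_dotz (z : V) : measurable_fun setT (fun y : T => dotR z (vecRd y)).
Proof.
by apply: (@measurable_dotV R d (fun=> z) id) => i; [exact: measurable_cst|exact: measurable_coordV].
Qed.

Lemma cintegrable_cexpM (h : T -> R) (f : T -> C) : measurable_fun setT h ->
  cintegrable mu f -> cintegrable mu (fun y => cexp (h y) * f y).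
Proof.
move=> mh [f1 f2].
have m1 : cmeasurable (fun y => cexp (h y) * f y).
  by apply: cmeasurableM; [exact: cmeasurable_cexp|exact: (cintegrable_measurable (conj f1 f2))].
apply: (cintegrable_dom m1 (g := fun y => `|complex.Re (f y)| + `|complex.Im (f y)|)).
  by move=> y; rewrite cabsM cabs_cexp mul1r cabs_le_ReIm.
have := integrableD measurableT (integrable_norm f1) (integrable_norm f2).
by congr (integrable _ _ _); apply/funext => y.
Qed.

Lemma osc_integrable z (f : V -> C) : cintegrable mu (fun y => f (vecRd y)) ->
  cintegrable mu (fun y => cexp (dotR z (vecRd y)) * f (vecRd y)).
Proof. by apply: cintegrable_cexpM; exact: measurable_dotz. Qed.

Lemma cintegrable_shiftV (i : 'I_d) h (f : V -> C) : cintegrable mu (fun y => f (vecRd y)) ->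
  cintegrable mu (fun y => f (vecRd y + h *: e_ i)).
Proof.
move=> [f1 f2]; split.
  have := integrable_shiftRd i h f1; congr (integrable _ _ _).
  by apply/funext => y /=; rewrite vecRd_shift.
have := integrable_shiftRd i h f2; congr (integrable _ _ _).
by apply/funext => y /=; rewrite vecRd_shift.
Qed.

Lemma cintegrable_dif (i : 'I_d) h (f : V -> C) : cintegrable mu (fun y => f (vecRd y)) ->
  cintegrable mu (fun y => dif i h f (vecRd y)).
Proof.
move=> fi; have := cintegrableD (cintegrable_shiftV i h fi) (cintegrableZ (-1) fi).
by congr (cintegrable _ _); apply/funext => y; rewrite mulN1r.
Qed.

(** Translating by h e_i multiplies the exponential by exp(i pi) = -1, so the translated and the
    subtracted term add up instead of cancelling. *)
Lemma osc_dif (z : V) (i : 'I_d) h (f : V -> C) : z 0 i * h = pi ->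
  cintegrable mu (fun y => f (vecRd y)) -> osc z (dif i h f) = - 2 * osc z f.
Proof.
move=> zh fi; have oi := osc_integrable z fi.
have si := @osc_integrable z (fun x => f (x + h *: e_ i)) (@cintegrable_shiftV i h f fi).
have cpi : cexp (pi : R) = -1 by rewrite /cexp cospi sinpi; apply: complex_ext; rewrite /= ?oppr0.
rewrite /osc.
transitivity (cint mu (fun y => cexp (dotR z (vecRd y)) * f (vecRd y + h *: e_ i) +
   (-1) * (cexp (dotR z (vecRd y)) * f (vecRd y)))).
  by apply: eq_cint => y; rewrite /dif; ring.
rewrite cintD//; last exact: cintegrableZ.
rewrite cintZ//.
have -> : cint mu (fun y => cexp (dotR z (vecRd y)) * f (vecRd y + h *: e_ i)) =
    - 1 * cint mu (fun y => cexp (dotR z (vecRd y)) * f (vecRd y)).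
  have shE : cint mu (fun y => cexp (dotR z (vecRd y)) * f (vecRd y)) =
      cint mu (fun y => cexp (dotR z (vecRd y + h *: e_ i)) * f (vecRd y + h *: e_ i)).
    exact: (esym (@cintRd_shift R d i h (fun x => cexp (dotR z x) * f x) oi)).
  rewrite shE -cintZ.
    apply: eq_cint => y; rewrite dotRDr dotRZr dotR_delta (mulrC h) zh cexpD cpi.
    by ring.
  exact: (@cintegrable_shiftV i h (fun x => cexp (dotR z x) * f x)).
rewrite -[cintRd _]/(cint mu (fun y => cexp (dotR z (vecRd y)) * f (vecRd y))).
by ring.
Qed.

(** The alternative m = 0 gives the trivial bound, for use where z_i is too small for a step of
    admissible size. *)
Lemma osc_iter_dif m (z : V) (i : 'I_d) h (f : V -> C) : m = 0%N \/ z 0 i * h = pi ->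
  cintegrable mu (fun y => f (vecRd y)) ->
  cintegrable mu (fun y => iter m (dif i h) f (vecRd y)) /\
  osc z (iter m (dif i h) f) = (- 2) ^+ m * osc z f.
Proof.
move=> [->|zh] fi; first by rewrite expr0 mul1r.
elim: m => [|m [I1 E1]]; first by rewrite expr0 mul1r.
rewrite iterS; split; first exact: cintegrable_dif.
by rewrite osc_dif// E1 exprS mulrA.
Qed.

Lemma osc_bound m (z : V) (i : 'I_d) h (f : V -> C) (A kappa : R) (c : V) :
  m = 0%N \/ z 0 i * h = pi -> 0 < kappa ->
  cintegrable mu (fun y => f (vecRd y)) ->
  (forall xi, cabs (iter m (dif i h) f xi) <= A * expR (- (kappa * dotR (xi - c) (xi - c)))) ->
  2 ^+ m * cabs (osc z f) <= 2 * (A * Num.sqrt (pi / kappa) ^+ d).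
Proof.
move=> zh k0 fi HA; have [I1 E1] := osc_iter_dif zh fi.
have -> : 2 ^+ m * cabs (osc z f) = cabs (osc z (iter m (dif i h) f)).
  rewrite E1 cabsM; congr (_ * _); elim: m {zh HA I1 E1} => [|m IH].
    by rewrite !expr0 -cexp0 cabs_cexp.
  rewrite !exprS cabsM IH; congr (_ * _).
  by rewrite cabsN (_ : 2 = Complex 2 0) ?cabs_real ?ger0_norm//; apply: complex_ext; rewrite /= ?addr0.
have Hg := integrable_gaussV c k0.
have -> : A * Num.sqrt (pi / kappa) ^+ d =
   Rintegral mu setT (fun y => A * expR (- (kappa * dotR (vecRd y - c) (vecRd y - c)))).
  rewrite RintegralZl//; congr (_ * _); by rewrite /Rintegral integral_gaussV.
apply: (cabs_cint_le (osc_integrable z I1)); last exact: integrable_scale.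
by move=> y; rewrite cabsM cabs_cexp mul1r.
Qed.

End Oscillatory.

Section GaussDiff.
Variables (R : realType) (d : nat).
Local Notation V := ('rV[R]_d).
Local Notation e_ i := (delta_mx 0 i : V).

Definition gbell (c : V) (rho : R) (xi : V) : R := expR (- (dotR (xi - c) (xi - c) / (2 * rho ^+ 2))).

Lemma gbellE c rho xi : rho != 0 -> gbell c rho xi = gbase 1 0 0 0 (rho^-1 *: (xi - c)).
Proof.
move=> r0; rewrite /gbell /gbase dotRC (_ : dotR _ 0 = 0).
  rewrite addr0 cos0 mul1r subr0 dotRZl dotRZr; congr (expR (- _)); by field.
by rewrite /dotR big1// => i _; rewrite [X in _ * X]mxE mulr0.
Qed.

(** Rescaling reduces all centres and widths to one Gaussian, so [K] is uniform. [D] is a lower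
    bound for the squared distance to the centre in units of rho along the segment met by the
    differences; [L] is the order of decay in it. *)
Lemma gbell_dif_bound (m L : nat) : exists2 K : R, 0 < K &
  forall (c : V) (rho : R) i h x D a, 0 < rho -> 0 <= D -> (a <= m)%N ->
  (forall s, `|s| <= m%:R * `|h| ->
     D * rho ^+ 2 <= dotR (x + s *: e_ i - c) (x + s *: e_ i - c)) ->
  `|iter a (dif i h) (gbell c rho) x| <= K * (`|h| / rho) ^+ a / (1 + D) ^+ L.
Proof.
have sg : rschwartz (gbase 1 0 0 0 : V -> R) by apply: gclass_schwartz; exact: gclass_base.
have /choice[F HF] : forall js : seq 'I_d, exists M : R, forall x : V,
    (1 + dotR x x) ^+ L * `|pderivs js (gbase 1 0 0 0) x| <= M.
  by move=> js; have [_ /(_ L)] := sg js.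
pose K := 1 + \sum_(a < m.+1) \sum_(i < d) `|F (nseq a i)|.
have K0 : 0 < K by rewrite ltr_pwDl// sumr_ge0// => a _; rewrite sumr_ge0.
exists K => // c rho i h x D a rho0 D0 am HD.
have r0 : rho != 0 by rewrite gt_eqF.
have FK : F (nseq a i) <= K.
  apply: (le_trans (ler_norm _)); apply: (@le_trans _ _ (\sum_(j < d) `|F (nseq a j)|)).
    by rewrite (bigD1 i)//= lerDl sumr_ge0.
  apply: (@le_trans _ _ (\sum_(b < m.+1) \sum_(j < d) `|F (nseq b j)|)).
    by rewrite (bigD1 (Ordinal (am : (a < m.+1)%N)))//= lerDl sumr_ge0// => b _; rewrite sumr_ge0.
  by rewrite /K lerDr.
rewrite (_ : gbell c rho = fun x => gbase 1 0 0 0 (rho^-1 *: (x - c))); last first.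
  by apply/funext => y; rewrite gbellE.
rewrite iter_dif_scale// mulrAC.
have -> : (`|h| / rho) ^+ a = `|h / rho| ^+ a by rewrite normrM (gtr0_norm (_ : 0 < rho^-1)) ?invr_gt0.
apply: iter_dif_bound => // s sh.
have D1 : 0 < (1 + D) ^+ L by rewrite exprn_gt0// ltr_pwDl.
rewrite ler_pdivlMr// mulrC; apply: le_trans (le_trans (HF (nseq a i) (rho^-1 *: (x - c) + s *: e_ i)) FK).
rewrite ler_wpM2r// lerXn2r ?nnegrE ?addr_ge0 ?dotR_ge0// lerD2l.
have -> : rho^-1 *: (x - c) + s *: e_ i = rho^-1 *: (x + (rho * s) *: e_ i - c).
  by rewrite [in RHS]addrAC [in RHS](scalerDr _ (x - c)) scalerA mulKf.
rewrite dotRZl dotRZr mulrA -invfM mulrC ler_pdivlMr ?mulr_gt0// -expr2.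
apply: HD; rewrite normrM (gtr0_norm rho0).
apply: (@le_trans _ _ (rho * (a%:R * `|h / rho|))); first by rewrite ler_pM2l.
rewrite normrM (gtr0_norm (_ : 0 < rho^-1)) ?invr_gt0//.
rewrite (_ : rho * _ = a%:R * `|h|); last by field.
by rewrite ler_wpM2r// ler_nat.
Qed.
End GaussDiff.

(** * Frequency-localised pieces *)

Section EtaBounds.
Variables (R : realType) (d : nat) (alpha : R) (eta : 'rV[int]_d -> 'rV[R]_d -> R[i]).
Local Notation T := (projT2 (RdT R d)).
Local Notation mu := (lebRd R d).
Local Notation V := ('rV[R]_d).
Local Notation C := (R[i]).
Local Notation e_ i := (delta_mx 0 i : V).
Hypothesis adm : admissible alpha eta.

Definition rad (j : 'rV[int]_d) : R := jb R j `^ (alpha / (1 - alpha)).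

Lemma jb_gt0 (j : 'rV[int]_d) : 0 < jb R j.
Proof. by rewrite sqrtr_gt0 ltr_pwDl// dotR_ge0. Qed.

Lemma rad_gt0 j : 0 < rad j. Proof. exact/powR_gt0/jb_gt0. Qed.

Lemma eta_support : exists2 C1 : R, 0 < C1 &
  forall j xi, C1 * rad j <= enorm (xi - kcenter alpha j) -> eta j xi = 0.
Proof.
have [_ _ [Cs HCs] _ _] := adm; exists (`|Cs| + 1); first by rewrite ltr_wpDl.
move=> j xi H; apply: HCs; apply: le_trans H; rewrite ler_wpM2r ?powR_ge0//.
by rewrite (le_trans (ler_norm _))// lerDl.
Qed.

Lemma eta_bounded : exists2 A : R, 0 < A & forall j xi, cabs (eta j xi) <= A.
Proof.
have [_ _ _ _ /(_ [::])[Cg HC]] := adm; exists (`|Cg| + 1); first by rewrite ltr_wpDl.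
move=> j xi; have := HC j xi; rewrite mulr0 mul0r oppr0 powRr0 mulr1.
rewrite (_ : cpderivs _ _ _ = eta j xi); last by apply: complex_ext.
by move=> /le_trans; apply; rewrite (le_trans (ler_norm _))// lerDl.
Qed.

(** A derivative of [eta j] gains a factor 1 / rad j, hence a difference gains |h| / rad j. [A]
    gathers the constants of all orders up to m in all directions, so it does not depend on j. *)
Lemma eta_dif_bound (m : nat) : exists2 A : R, 0 < A &
  forall j i h x a, (a <= m)%N -> cabs (iter a (dif i h) (eta j) x) <= A * (`|h| / rad j) ^+ a.
Proof.
have [sch _ _ _ /choice[F HF]] := adm.
pose K := 1 + \sum_(a < m.+1) \sum_(i < d) `|F (nseq a i)|.
have K0 : 0 < K by rewrite ltr_pwDl// sumr_ge0// => a _; rewrite sumr_ge0.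
exists (2 * K); first by rewrite mulr_gt0.
move=> j i h x a am.
have FK : F (nseq a i) <= K.
  apply: (le_trans (ler_norm _)); apply: (@le_trans _ _ (\sum_(j < d) `|F (nseq a j)|)).
    by rewrite (bigD1 i)//= lerDl sumr_ge0.
  apply: (@le_trans _ _ (\sum_(b < m.+1) \sum_(j < d) `|F (nseq b j)|)).
    by rewrite (bigD1 (Ordinal (am : (a < m.+1)%N)))//= lerDl sumr_ge0// => b _; rewrite sumr_ge0.
  by rewrite /K lerDr.
have HB xi : cabs (cpderivs (nseq a i) (eta j) xi) <= K / rad j ^+ a.
  have := HF (nseq a i) j xi; rewrite size_nseq powRN.
  have -> : alpha * a%:R / (1 - alpha) = alpha / (1 - alpha) * a%:R by rewrite mulrAC.
  rewrite powRrM powR_mulrn ?powR_ge0// -/(rad j) => /le_trans; apply.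
  by rewrite ler_wpM2r// invr_ge0 exprn_ge0// ltW// rad_gt0.
have [s1 s2] := sch j.
apply: (le_trans (cabs_le_ReIm _)).
rewrite (_ : 2 * K * _ = K / rad j ^+ a * `|h| ^+ a + K / rad j ^+ a * `|h| ^+ a); last first.
  rewrite expr_div_n; field; by rewrite expf_neq0// gt_eqF// rad_gt0.
apply: lerD.
  rewrite iter_dif_Re; apply: iter_dif_bound => // s _.
  exact: (le_trans (Re_le_cabs (cpderivs (nseq a i) (eta j) (x + s *: e_ i))) (HB _)).
rewrite iter_dif_Im; apply: iter_dif_bound => // s _.
exact: (le_trans (Im_le_cabs (cpderivs (nseq a i) (eta j) (x + s *: e_ i))) (HB _)).
Qed.

Lemma measurable_rschwartz (f : V -> R) : rschwartz f ->
  measurable_fun setT (fun y : T => f (vecRd y)).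
Proof.
move=> sf; have [df _] := sf [::]; apply: measurable_sepcontRd => i y id.
have -> : (fun h => f (vecRd (shiftRd i h y))) = (fun h => f (h *: e_ (Ordinal id) + vecRd y)).
  by apply/funext => h; rewrite (@vecRd_shift R d y (Ordinal id) h) addrC.
move=> h; have := is_derive_along (df (h *: e_ (Ordinal id) + vecRd y) (Ordinal id)) => -[D _].
exact/differentiable_continuous/derivable1_diffP.
Qed.

Lemma cmeasurable_eta j : cmeasurable (fun y : T => eta j (vecRd y)).
Proof.
by have [sch _ _ _ _] := adm; have [s1 s2] := sch j; split; [exact: (measurable_rschwartz s1)|exact: (measurable_rschwartz s2)].
Qed.

Lemma measurable_gbell (c : V) rho : measurable_fun setT (fun y : T => gbell c rho (vecRd y)).
Proof.
apply: measurableT_comp => //; apply: measurableT_comp => //; apply: measurable_funM => //.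
exact: (@measurable_dotV R d (fun x => x - c) (fun x => x - c) (measurable_subV c) (measurable_subV c)).
Qed.

Lemma gbell_ge0 (c : V) rho xi : 0 <= gbell c rho xi. Proof. exact: expR_ge0. Qed.
Lemma gbell_le1 (c : V) rho xi : gbell c rho xi <= 1.
Proof.
by rewrite -[leRHS]expR0 ler_expR oppr_le0 divr_ge0 ?dotR_ge0// mulr_ge0// sqr_ge0.
Qed.

(* A function vanishing off a ball is dominated by a Gaussian, whose integral is explicit. *)
Lemma ball_le_gauss (f : V -> R) (B S : R) (c : V) : 0 < S -> 0 <= B ->
  (forall xi, enorm (xi - c) < S -> f xi <= B) -> (forall xi, S <= enorm (xi - c) -> f xi = 0) ->
  forall xi, f xi <= B * expR 1 * expR (- ((S ^+ 2)^-1 * dotR (xi - c) (xi - c))).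
Proof.
move=> S0 B0 H1 H2 xi; have [h|h] := ltP (enorm (xi - c)) S; last first.
  by rewrite H2// !mulr_ge0 ?expR_ge0.
apply: (le_trans (H1 _ h)); rewrite -mulrA ler_peMr// -expRD -[leLHS]expR0 ler_expR.
rewrite subr_ge0 mulrC ler_pdivrMr ?exprn_gt0// mul1r -sqr_enorm.
by rewrite lerXn2r// ?nnegrE ?enorm_ge0 ?ltW.
Qed.

Definition ebell j c rho xi : C := eta j xi * Complex (gbell c rho xi) 0.

Lemma ebell_integrable j c rho : cintegrable mu (fun y => ebell j c rho (vecRd y)).
Proof.
have [C1 C10 HC] := eta_support; have [A A0 HA] := eta_bounded.
pose S := C1 * rad j; have S0 : 0 < S by rewrite mulr_gt0// rad_gt0.
have cm : cmeasurable (fun y : T => ebell j c rho (vecRd y)).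
  by apply: cmeasurableM; [exact: cmeasurable_eta|apply: cmeasurable_real; exact: measurable_gbell].
have k0 : 0 < (S ^+ 2)^-1 by rewrite invr_gt0 exprn_gt0.
have HB := @ball_le_gauss (fun xi => cabs (ebell j c rho xi)) A S (kcenter alpha j) S0 (ltW A0).
have ig := integrable_scale (A * expR 1) (integrable_gaussV (kcenter alpha j) k0).
refine (cintegrable_dom cm _ ig) => y; apply: HB => xi H.
  rewrite cabsM cabs_real (ger0_norm (gbell_ge0 _ _ _)) -[leRHS]mulr1.
  by apply: ler_pM; rewrite ?cabs_ge0 ?gbell_ge0 ?gbell_le1.
by rewrite /ebell HC// mul0r cabs0.
Qed.

Section BoxBound.
Variables (L M : nat).

(** Each difference falls on [eta j], gaining |h| / rad j, or on the Gaussian, gaining |h| / rho;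
    both are at most (|h| / rad j) (1 + rad j / rho). [D] records how far the Gaussian centre is
    from the enlarged support of [eta j]. *)
Lemma osc_ebell : exists2 C2 : R, 0 < C2 & exists2 K : R, 0 < K &
  forall j (c : V) (rho D : R), 0 < rho -> 0 <= D ->
  (forall xi, enorm (xi - kcenter alpha j) <= C2 * rad j -> D * rho ^+ 2 <= dotR (xi - c) (xi - c)) ->
  forall (m : nat) (z : V) i h, (m <= M)%N -> m = 0%N \/ z 0 i * h = pi -> `|h| <= pi * rad j ->
  cabs (osc z (ebell j c rho)) <= K * rad j ^+ d * ((`|h| / rad j) * (1 + rad j / rho)) ^+ m / (1 + D) ^+ L.
Proof.
have [C1 C10 HC] := eta_support; have [A A0 HA] := eta_dif_bound M.
have [G G0 HG] := @gbell_dif_bound R d M L.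
pose Mp := M%:R * pi : R.
have Mp0 : 0 <= Mp by rewrite mulr_ge0// pi_ge0.
pose S := C1 + Mp; have S0 : 0 < S by rewrite ltr_wpDr.
(* In units of rad j: the differences live on a ball of radius S, the shift by k h adds at most Mp,
   and the mean value segment at most another Mp. *)
exists (S + 2 * Mp); first by rewrite ltr_wpDr// mulr_ge0.
exists (2 * (A * G * expR 1 * (Num.sqrt pi * S) ^+ d)).
  by rewrite !mulr_gt0 ?expR_gt0// exprn_gt0// mulr_gt0// sqrtr_gt0 pi_gt0.
move=> j c rho D rho0 D0 HD m z i h mM zh hr.
have r0 := rad_gt0 j; set r := rad j in r0 HD hr HC HA *.
set q := `|h| / r * (1 + r / rho).
have hr0 : 0 <= `|h| / r by rewrite divr_ge0// ltW.
have rr0 : 0 <= r / rho by rewrite divr_ge0// ltW.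
have q0 : 0 <= q by rewrite mulr_ge0// addr_ge0.
have q1 : `|h| / r <= q.
  by rewrite ler_peMr// lerDl.
have q2 : `|h| / rho <= q.
  rewrite (_ : `|h| / rho = `|h| / r * (r / rho)); last by field; rewrite !gt_eqF.
  by rewrite ler_wpM2l// lerDr.
have D1 : 0 < (1 + D) ^+ L by rewrite exprn_gt0// ltr_pwDl.
set B := 2 ^+ m * (A * (G / (1 + D) ^+ L)) * q ^+ m.
have B0 : 0 <= B by rewrite !mulr_ge0 ?exprn_ge0 ?invr_ge0 ?(ltW A0) ?(ltW G0) ?(ltW D1).
have moved (s : R) (k : nat) : (k <= m)%N -> `|s| <= k%:R * `|h| -> `|s| <= Mp * r.
  move=> km sk; apply: (le_trans sk); rewrite /Mp -mulrA.
  by apply: ler_pM => //; rewrite ler_nat (leq_trans km).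
have near xi s : enorm (xi + s *: e_ i - kcenter alpha j) <= enorm (xi - kcenter alpha j) + `|s|.
  by rewrite addrAC (le_trans (enormD _ _))// enormZ enorm_delta mulr1.
have near' xi s : enorm (xi - kcenter alpha j) - `|s| <= enorm (xi + s *: e_ i - kcenter alpha j).
  rewrite lerBlDr; have := near (xi + s *: e_ i) (- s).
  by rewrite -(addrA xi) -scalerDl subrr scale0r addr0 normrN.
have Sr0 : 0 < S * r by rewrite mulr_gt0.
have k0 : 0 < ((S * r) ^+ 2)^-1 by rewrite invr_gt0 exprn_gt0.
have bnd := @ball_le_gauss (fun xi => cabs (iter m (dif i h) (ebell j c rho) xi)) B (S * r)
  (kcenter alpha j) Sr0 B0.
have {}bnd : forall xi, cabs (iter m (dif i h) (ebell j c rho) xi) <=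
    B * expR 1 * expR (- (((S * r) ^+ 2)^-1 * dotR (xi - kcenter alpha j) (xi - kcenter alpha j))).
  apply: bnd => xi Hxi.
    apply: iter_dif_prod => //.
    - move=> a k ak; have am : (a <= m)%N by exact: leq_trans (leq_addr _ _) ak.
      apply: (le_trans (HA j i h _ a (leq_trans am mM))); rewrite ler_pM2l//.
      by rewrite lerXn2r// nnegrE divr_ge0// ltW.
    - move=> a k ak; have am : (a <= m)%N by exact: leq_trans (leq_addr _ _) ak.
      have km : (k <= m)%N by exact: leq_trans (leq_addl _ _) ak.
      have RE : complex.Re (iter a (dif i h) (fun y => Complex (gbell c rho y) 0) (xi + (k%:R * h) *: e_ i))
         = iter a (dif i h) (gbell c rho) (xi + (k%:R * h) *: e_ i) by rewrite iter_dif_Re.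
      have IE : complex.Im (iter a (dif i h) (fun y => Complex (gbell c rho y) 0) (xi + (k%:R * h) *: e_ i)) = 0.
        rewrite iter_dif_Im /=; elim: (a) (xi + _) => [//|b IHb] w.
        by rewrite iterS /dif !IHb subrr.
      apply: (le_trans (cabs_le_ReIm _)); rewrite RE IE normr0 addr0.
      apply: (@le_trans _ _ (G * (`|h| / rho) ^+ a / (1 + D) ^+ L)).
        apply: HG => //; first exact: leq_trans mM.
        move=> s sM; apply: HD; rewrite -(addrA xi) -scalerDl.
        apply: (le_trans (near _ _)); rewrite mulrDl.
        apply: lerD; first exact: ltW.
        apply: (le_trans (ler_normD _ _)); rewrite mulr2n !mulrDl mul1r.
        apply: lerD; last by rewrite (le_trans sM)// /Mp -mulrA ler_wpM2l.
        by apply: (moved _ k) => //; rewrite normrM ger0_norm.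
      rewrite mulrAC ler_pM2l ?divr_gt0//.
      by rewrite lerXn2r// nnegrE divr_ge0// ltW.
  rewrite iter_dif_eq0 ?cabs0// => k km; rewrite /ebell HC ?mul0r//.
  apply: le_trans (near' _ _); rewrite lerBrDr; apply: le_trans Hxi.
  rewrite /S mulrDl lerD2l; apply: (moved _ k) => //; by rewrite normrM ger0_norm.
have := osc_bound zh k0 (ebell_integrable j c rho) bnd.
rewrite -ler_pdivlMl ?exprn_gt0// => /le_trans; apply.
rewrite le_eqVlt; apply/orP; left; apply/eqP.
have -> : Num.sqrt (pi / ((S * r) ^+ 2)^-1) = Num.sqrt pi * S * r.
  by rewrite invrK sqrtrM ?pi_ge0// sqrtr_sqr gtr0_norm// mulrA.
rewrite /B [(_ * r) ^+ d]exprMn.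
have t0 : (2 ^+ m : R) != 0 by rewrite expf_neq0.
have D1' : (1 + D) ^+ L != 0 by rewrite gt_eqF.
move: (2 ^+ m) (q ^+ m) (r ^+ d) ((Num.sqrt pi * S) ^+ d) ((1 + D) ^+ L) (expR 1) t0 D1'.
by move=> a b e f g k a0 g0; field; rewrite a0 g0.
Qed.

End BoxBound.
End EtaBounds.

(** * The kernel of one frequency block *)

Section BoxKernel.
Variables (R : realType) (d : nat) (alpha : R) (eta : 'rV[int]_d -> 'rV[R]_d -> R[i]).
Local Notation T := (projT2 (RdT R d)).
Local Notation mu := (lebRd R d).
Local Notation V := ('rV[R]_d).
Local Notation C := (R[i]).
Local Notation e_ i := (delta_mx 0 i : V).
Local Notation rad := (rad alpha).
Hypotheses (d_gt0 : (0 < d)%N) (adm : admissible alpha eta).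

(** Take the coordinate i with the largest |z_i|. If r |z_i| <= 1, the bound with m = 0 is enough;
    otherwise 2d differences with h = pi / z_i give (pi / (r |z_i|))^(2d), two powers for each of
    the d factors of [wdecay]. *)
Lemma osc_decay_wdecay (r K : R) (z : V) (F : R) : 0 < r -> 0 <= K ->
  (forall (m : nat) i h, (m <= 2 * d)%N -> m = 0%N \/ z 0 i * h = pi -> `|h| <= pi * r ->
     F <= K * (`|h| / r) ^+ m) ->
  F <= (2 * pi ^+ 2) ^+ d * K * wdecay r z.
Proof.
move=> r0 K0 H; have pi1 : 1 <= pi :> R by rewrite (le_trans _ (pi_ge2 R))// ler1n.
have i0 : 'I_d := Ordinal d_gt0.
pose i := [arg max_(i > i0) `|r * z 0 i|]%O.
have Hi k : `|r * z 0 k| <= `|r * z 0 i|.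
  by rewrite /i; case: arg_maxP => // l _ /(_ k isT).
pose t := (r * z 0 i) ^+ 2.
have Ht k : (r * z 0 k) ^+ 2 <= t.
  by rewrite /t -(real_normK (num_real (r * z 0 k))) -(real_normK (num_real (r * z 0 i))) lerXn2r// nnegrE.
have t0 : 0 <= t by exact: sqr_ge0.
have wlow : ((1 + t) ^+ d)^-1 <= wdecay r z.
  rewrite -exprVn -[d in _ ^+ d]card_ord -prodr_const /wdecay.
  apply: ler_prod => k _; rewrite invr_ge0 addr_ge0//= lef_pV2 ?posrE ?ltr_pwDl ?sqr_ge0//.
  by rewrite lerD2l.
have [t1|t1] := leP t 1.
  have H0 := H 0%N i0 0 isT (or_introl erefl).
  have {}H0 : F <= K by apply: (le_trans (H0 _)); rewrite ?normr0 ?mulr_ge0 ?pi_ge0 ?(ltW r0)// expr0 mulr1.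
  apply: (le_trans H0); rewrite mulrAC ler_peMl//.
  apply: (@le_trans _ _ ((2 * pi ^+ 2) ^+ d * ((1 + t) ^+ d)^-1)); last first.
    by rewrite ler_wpM2l// exprn_ge0// mulr_ge0// sqr_ge0.
  have h : 1 + t <= 2 * pi ^+ 2 by rewrite expr2; nra.
  rewrite ler_pdivlMr ?exprn_gt0 ?ltr_pwDl// mul1r.
  by apply: lerXn2r; rewrite // nnegrE ?addr_ge0// mulr_ge0// sqr_ge0.
have zi0 : z 0 i != 0.
  by apply: contraTneq t1 => zi; rewrite /t zi mulr0 expr0n/= -leNgt.
have rz1 : 1 <= `|r * z 0 i|.
  by rewrite -(@ler_pXn2r _ 2)// ?nnegrE// expr1n real_normK ?num_real// ltW.
have hE : `|pi / z 0 i| = pi / `|z 0 i| by rewrite normrM normfV ger0_norm ?pi_ge0.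
have zn0 : 0 < `|z 0 i| by rewrite normr_gt0.
have H1 : F <= K * (`|pi / z 0 i| / r) ^+ (2 * d).
  apply: (H (2 * d)%N i) => //.
    by right; rewrite mulrC divfK.
  by rewrite hE ler_pdivrMr// -mulrA ler_peMr ?pi_ge0//; move: rz1; rewrite normrM gtr0_norm.
apply: (le_trans H1); rewrite [_ * K]mulrC -mulrA ler_wpM2l//.
apply: (@le_trans _ _ ((2 * pi ^+ 2) ^+ d * ((1 + t) ^+ d)^-1)); last first.
  by rewrite ler_wpM2l// exprn_ge0// mulr_ge0// sqr_ge0.
rewrite exprM -exprVn -exprMn; apply: lerXn2r; rewrite ?nnegrE ?sqr_ge0//.
  by rewrite mulr_ge0 ?invr_ge0 ?addr_ge0// mulr_ge0// sqr_ge0.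
have -> : (`|pi / z 0 i| / r) ^+ 2 = pi ^+ 2 / t.
  rewrite hE /t -(real_normK (num_real (r * z 0 i))) normrM (gtr0_norm r0).
  by field; rewrite !gt_eqF.
have tp : 0 < t by exact: lt_trans t1.
rewrite ler_pdivrMr// mulrAC ler_pdivlMr ?ltr_pwDl//.
have := sqr_ge0 (pi : R); nra.
Qed.

(** If the block is far from [c] compared with its radius, the Gaussian is small on the whole block,
    and this smallness also absorbs the powers of rad j / rho. If it is close, the hypothesis rad j
    <= C3 rho bounds every factor by a constant. *)
Lemma osc_box (N : nat) : exists2 C2 : R, 0 < C2 & forall C3, 0 < C3 -> exists2 K : R, 0 < K &
  forall j (c : V) (rho : R), 0 < rho ->
  (enorm (kcenter alpha j - c) < 2 * C2 * rad j -> rad j <= C3 * rho) ->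
  forall z, cabs (osc z (ebell eta j c rho)) <=
    K * rad j ^+ d / (1 + enorm (kcenter alpha j - c) / rho) ^+ N * wdecay (rad j) z.
Proof.
(* Far away (1 + D)^L is of order (1 + E/rho)^(2N + 2d): 2d powers absorb (1 + rad j / rho)^(2d),
   and at least N remain. *)
pose L := (N + d)%N.
have [C2 C20 [K K0 HK]] := osc_ebell adm L (2 * d).
exists C2 => // C3 C30.
have P0 : 0 < (2 * pi ^+ 2) ^+ d :> R by rewrite exprn_gt0// mulr_gt0// exprn_gt0// pi_gt0.
pose K1 := (1 + C3) ^+ (2 * d) * (1 + 2 * C2 * C3) ^+ N.
pose K2 := (1 + (2 * C2)^-1) ^+ (2 * d) * 8 ^+ L.
have K10 : 0 < K1 by rewrite mulr_gt0// exprn_gt0// addr_gt0// !mulr_gt0.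
have K20 : 0 < K2 by rewrite mulr_gt0// exprn_gt0// addr_gt0// invr_gt0 mulr_gt0.
exists ((2 * pi ^+ 2) ^+ d * K * (K1 + K2)); first by rewrite !mulr_gt0// addr_gt0.
move=> j c rho rho0 Hr z.
have r0 := rad_gt0 alpha j; set r := rad j in r0 Hr *.
set E := enorm (kcenter alpha j - c) in Hr *.
have E0 : 0 <= E by exact: enorm_ge0.
have Er0 : 0 <= E / rho by rewrite divr_ge0// ltW.
have rr0 : 0 <= r / rho by rewrite divr_ge0// ltW.
have w0 := wdecay_ge0 r z.
have main D : 0 <= D -> (forall xi, enorm (xi - kcenter alpha j) <= C2 * r ->
     D * rho ^+ 2 <= dotR (xi - c) (xi - c)) ->
   cabs (osc z (ebell eta j c rho)) <=
     (2 * pi ^+ 2) ^+ d * (K * r ^+ d * (1 + r / rho) ^+ (2 * d) / (1 + D) ^+ L) * wdecay r z.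
  move=> D0 HD; have D1 : 0 < (1 + D) ^+ L by rewrite exprn_gt0// ltr_pwDl.
  apply: osc_decay_wdecay => //.
    by rewrite !mulr_ge0 ?invr_ge0 ?exprn_ge0 ?addr_ge0 ?(ltW K0) ?(ltW r0)// ltW.
  move=> m i h mM zh hr; apply: (le_trans (HK j c rho D rho0 D0 HD m z i h mM zh hr)).
  rewrite exprMn mulrA [leRHS]mulrAC ler_pM2r ?invr_gt0// [leRHS]mulrAC ler_wpM2l//.
    by rewrite !mulr_ge0 ?exprn_ge0 ?(ltW K0) ?(ltW r0)// divr_ge0// ltW.
  by rewrite ler_weXn2l// lerDl.
have step D X : (1 + r / rho) ^+ (2 * d) / (1 + D) ^+ L <= X / (1 + E / rho) ^+ N -> X <= K1 + K2 ->
    (2 * pi ^+ 2) ^+ d * (K * r ^+ d * (1 + r / rho) ^+ (2 * d) / (1 + D) ^+ L) * wdecay r z <=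
    (2 * pi ^+ 2) ^+ d * K * (K1 + K2) * r ^+ d / (1 + E / rho) ^+ N * wdecay r z.
  move=> H1 H2; rewrite ler_wpM2r// -!mulrA ler_pM2l// ler_pM2l// [leRHS]mulrCA.
  rewrite ler_pM2l ?exprn_gt0//; apply: (le_trans H1).
  by rewrite ler_wpM2r// invr_ge0 exprn_ge0// addr_ge0.
have [far|close] := leP (2 * C2 * r) E.
  (* The enlarged block has radius C2 r <= E / 2, so each of its points keeps distance at least E /
     2 from [c]. *)
  have D0 : 0 <= (E / (2 * rho)) ^+ 2 by exact: sqr_ge0.
  apply: (le_trans (main _ D0 _)) => [xi Hxi|].
    rewrite -exprMn -sqr_enorm (_ : E / (2 * rho) * rho = E / 2); last by field; rewrite gt_eqF.
    apply: lerXn2r; rewrite ?nnegrE ?enorm_ge0 ?divr_ge0//.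
    have := enormD (xi - c) (kcenter alpha j - xi); rewrite addrC subrKA -/E.
    by rewrite -(opprB xi) enormN; lra.
  apply: (step _ K2); last by rewrite lerDr ltW.
  set w := E / (2 * rho).
  have wE : E / rho = 2 * w by rewrite /w; field; rewrite gt_eqF.
  have ww : 0 <= w by rewrite divr_ge0// mulr_ge0// ltW.
  have h1 : 1 + r / rho <= (1 + (2 * C2)^-1) * (1 + E / rho).
    have : r / rho <= (2 * C2)^-1 * (E / rho).
      rewrite mulrA ler_pM2r ?invr_gt0// mulrC ler_pdivlMr ?mulr_gt0// mulrC; exact: far.
    have : 0 < (2 * C2)^-1 by rewrite invr_gt0 mulr_gt0.
    nra.
  have h2 : (1 + E / rho) ^+ 2 <= 8 * (1 + w ^+ 2) by rewrite wE !expr2; have := sqr_ge0 (w - 1); nra.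
  have p1 : 0 < 1 + E / rho by rewrite ltr_pwDl.
  have p2 : 0 < 1 + w ^+ 2 by rewrite ltr_pwDl// sqr_ge0.
  rewrite ler_pdivrMr ?exprn_gt0// mulrAC ler_pdivlMr ?exprn_gt0//.
  apply: (@le_trans _ _ ((1 + (2 * C2)^-1) ^+ (2 * d) * (1 + E / rho) ^+ (2 * d) * (1 + E / rho) ^+ N)).
    rewrite ler_wpM2r ?exprn_ge0 ?(ltW p1)// -exprMn lerXn2r// nnegrE ?addr_ge0//.
    by rewrite mulr_ge0 ?(ltW p1)// addr_ge0// invr_ge0 mulr_ge0// ltW.
  rewrite /K2 -!mulrA ler_pM2l; last by rewrite exprn_gt0// addr_gt0// invr_gt0 mulr_gt0.
  rewrite -exprMn -exprD.
  apply: (@le_trans _ _ ((1 + E / rho) ^+ (2 * L))).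
    by rewrite ler_weXn2l ?lerDl// /L mulnDr addnC leq_add2r mul2n -addnn leq_addr.
  by rewrite exprM lerXn2r// ?nnegrE ?sqr_ge0// mulr_ge0// ltW.
have rC := Hr close.
apply: (le_trans (main 0 (lexx 0) _)) => [xi _|]; first by rewrite mul0r dotR_ge0.
apply: (step _ K1); last by rewrite lerDl ltW.
rewrite addr0 expr1n divr1 ler_pdivlMr ?exprn_gt0 ?ltr_pwDl//.
have rC' : r / rho <= C3 by rewrite ler_pdivrMr.
apply: ler_pM; rewrite ?exprn_ge0 ?addr_ge0//.
  by rewrite lerXn2r// ?nnegrE ?addr_ge0// ?(ltW C30)// lerD2l.
rewrite lerXn2r// ?nnegrE ?addr_ge0// ?mulr_ge0 ?(ltW C20) ?(ltW C30)// lerD2l.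
rewrite ler_pdivrMr//; apply: (le_trans (ltW close)).
by rewrite -[leRHS]mulrA ler_pM2l// mulr_gt0.
Qed.

Lemma boxop_sum_gatom (I : eqType) (s : seq I) (c y : I -> V) (rho : R) j x : 0 < rho ->
  boxop eta j (fun x => \sum_(k <- s) gatom (c k) (y k) rho x) x =
  Complex ((2 * pi) ^- d) 0 * \sum_(k <- s) osc (x - y k) (ebell eta j (c k) rho).
Proof.
move=> rho0; rewrite /boxop /ifourier; congr (_ * _).
rewrite -[RHS]cint_sum => [|k _]; last first.
  by apply: osc_integrable; exact: (ebell_integrable adm).
apply: eq_cint => z; rewrite fourier_sum_gatom// !mulr_sumr; apply: eq_bigr => k _.
rewrite /gbump /ebell (dotRDl x) dotRNl cexpD -/(gbell (c k) rho (vecRd z)); ring.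
Qed.
End BoxKernel.

(** * Lebesgue and modulation norms *)

Section LnormBounds.
Context (R : realType) (dp : measure_display) (T : measurableType dp).
Variable mu : {measure set T -> \bar R}.

Lemma powR_le_lin (D w r : R) : 0 <= D -> 0 <= w <= 1 -> 1 <= r -> (D * w) `^ r <= D `^ r * w.
Proof.
move=> D0 /andP[w0 w1] r1; rewrite powRM// ler_wpM2l ?powR_ge0//.
have [->|wn] := eqVneq w 0; first by rewrite powR0// gt_eqF// (lt_le_trans ltr01).
rewrite -[leRHS]powRr1//; have wp : 0 < w by rewrite lt_neqAle eq_sym wn.
by rewrite ger_powR// wp w1.
Qed.

(** Since (D w)^p <= D^p w for 0 <= w <= 1, one integral of the measurable majorant serves every p.
    For p = oo, [einv] is 0 and the power of S becomes 1. *)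
Lemma Lnorm_le (p : \bar R) (f w : T -> R) (D S : R) : (1 <= p)%E -> 0 <= D -> 0 < S ->
  (forall x, 0 <= f x <= D * w x) -> (forall x, 0 <= w x <= 1) ->
  measurable_fun setT w -> (\int[mu]_x (w x)%:E <= S%:E)%E ->
  (Lnorm mu p (fun x => (f x)%:E) <= (D * S `^ einv p)%:E)%E.
Proof.
move=> p1 D0 S0 fD w01 mw wS; rewrite unlock; case: p p1 => [r|_|//] /=.
  rewrite lee_fin => r1; have r0 : 0 < r by exact: lt_le_trans ltr01 r1.
  have rn : r != 0 by rewrite gt_eqF.
  have I1 : (\int[mu]_x `|(f x)%:E| `^ r <= (D `^ r * S)%:E)%E.
    apply: (@le_trans _ _ (\int[mu]_x ((D `^ r)%:E * (w x)%:E))%E).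
      apply: le_integral_nonmeas => x; first exact: poweR_ge0.
      have /andP[f0 fx] := fD x; have /andP[w0 w1] := w01 x.
      rewrite /= ger0_norm// -EFinM lee_fin.
      apply: (@le_trans _ _ ((D * w x) `^ r)); last exact: powR_le_lin.
      by apply: ge0_ler_powR => //; rewrite ?nnegrE ?mulr_ge0// ltW.
    rewrite ge0_integralZl//; last 3 first.
    - exact/measurable_EFinP.
    - by move=> x _; rewrite lee_fin; have /andP[] := w01 x.
    - by rewrite lee_fin powR_ge0.
    by rewrite EFinM lee_wpmul2l// lee_fin powR_ge0.
  have I0 : (0 <= \int[mu]_x `|(f x)%:E| `^ r)%E by apply: integral_ge0 => x _; exact: poweR_ge0.
  have -> : (D * S `^ r^-1)%:E = ((D `^ r * S)%:E `^ r^-1)%E.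
    rewrite poweR_EFin powRM ?powR_ge0 ?(ltW S0)// -powRrM divff// powRr1//.
  apply: gt0_ler_poweR => //; first by rewrite invr_ge0 ltW.
  - by rewrite in_itv/= I0 leey.
  - by rewrite in_itv/= leey lee_fin mulr_ge0 ?powR_ge0// ltW.
rewrite powRr0 mulr1; case: ifP => // _.
apply/ess_supP; apply: aeW => x /=; have /andP[f0 fx] := fD x; have /andP[w0 w1] := w01 x.
by rewrite lee_fin ger0_norm// (le_trans fx)// ler_piMr.
Qed.

(** For finite p, a multiple of the indicator of B is a minorant of |f|^p. For p = oo, an essential
    supremum below c would put B inside a null set. *)
Lemma Lnorm_ge (p : \bar R) (f : T -> R) (B : set T) (c m : R) : (1 <= p)%E -> 0 < c -> 0 < m ->
  measurable B -> (forall x, B x -> c <= `|f x|) -> (m%:E <= mu B)%E ->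
  ((c * m `^ einv p)%:E <= Lnorm mu p (fun x => (f x)%:E))%E.
Proof.
move=> p1 c0 m0 mB Bc mBm; rewrite unlock; case: p p1 => [r|_|//] /=.
  rewrite lee_fin => r1; have r0 : 0 < r by exact: lt_le_trans ltr01 r1.
  have rn : r != 0 by rewrite gt_eqF.
  have I1 : ((c `^ r * m)%:E <= \int[mu]_x `|(f x)%:E| `^ r)%E.
    apply: (@le_trans _ _ (\int[mu]_x ((c `^ r)%:E * (\1_B x)%:E))%E); last first.
      apply: le_integral_nonmeas => x; first by rewrite mule_ge0// lee_fin ?powR_ge0.
      rewrite indicE; have [xB|xB] := boolP (x \in B); last by rewrite mule0 poweR_ge0.
      rewrite mule1 lee_fin; apply: ge0_ler_powR; rewrite ?nnegrE ?(ltW c0)// ?(ltW r0)//.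
      by apply: Bc; rewrite inE in xB.
    rewrite ge0_integralZl//; last 2 first.
    - by apply/measurable_EFinP; exact: measurable_indic.
    - by rewrite lee_fin powR_ge0.
    by rewrite integral_indic// setIT EFinM lee_wpmul2l// lee_fin powR_ge0.
  have -> : (c * m `^ r^-1)%:E = ((c `^ r * m)%:E `^ r^-1)%E.
    rewrite poweR_EFin powRM ?powR_ge0 ?(ltW m0)// -powRrM divff// powRr1// ltW//.
  apply: gt0_ler_poweR => //; first by rewrite invr_ge0 ltW.
  - by rewrite in_itv/= leey lee_fin mulr_ge0 ?powR_ge0// ltW.
  - by rewrite in_itv/= leey andbT integral_ge0// => x _; exact: poweR_ge0.
have BT : (0 < mu B)%E by exact: lt_le_trans mBm.
rewrite powRr0 mulr1 ifT; last by apply: (lt_le_trans BT); apply: le_measure; rewrite ?inE.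
rewrite leNgt; apply/negP => H.
have [A [mA A0 HA]] := ess_sup_ge mu (abse \o (fun x => (f x)%:E)).
have BA : B `<=` A.
  move=> x Bx; apply: HA => /= h; have := le_lt_trans h H.
  by rewrite lte_fin ltNge Bc.
have : (mu B <= mu A)%E by apply: le_measure; rewrite ?inE.
by rewrite A0 leNgt BT.
Qed.
End LnormBounds.

Section MnormBound.
Variables (R : realType) (d : nat) (alpha s : R) (eta : 'rV[int]_d -> 'rV[R]_d -> R[i]).

(** The counterpart of [Lnorm_le] for the sequence norm, with [w] a weight on the blocks whose
    finite sums are at most S. *)
Lemma Mnorm_le (p q : \bar R) (u : 'rV[R]_d -> R[i]) (D S : R) (w : 'rV[int]_d -> R) :
  (1 <= q)%E -> 0 <= D -> 0 < S -> (forall j, 0 <= w j <= 1) ->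
  (forall F : seq 'rV[int]_d, uniq F -> \sum_(j <- F) w j <= S) ->
  (forall j, ((jb R j `^ (s / (1 - alpha)))%:E * LpRd p (boxop eta j u) <= (D * w j)%:E)%E) ->
  (Mnorm alpha s eta p q u <= (D * S `^ einv q)%:E)%E.
Proof.
move=> q1 D0 S0 w01 wS H; case: q q1 => [r|_|//] /=; last first.
  rewrite powRr0 mulr1; apply: ge_ereal_sup => _ [j _ <-].
  apply: (le_trans (H j)); rewrite lee_fin ler_piMr//; by have /andP[] := w01 j.
rewrite lee_fin => r1; have r0 : 0 < r by exact: lt_le_trans ltr01 r1.
have rn : r != 0 by rewrite gt_eqF.
have L0 j : (0 <= LpRd p (boxop eta j u))%E by exact: Lnorm_ge0.
have T1 j : ((jb R j `^ (s * r / (1 - alpha)))%:E * LpRd p (boxop eta j u) `^ r <= (D `^ r * w j)%:E)%E.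
  have -> : (jb R j `^ (s * r / (1 - alpha)))%:E = ((jb R j `^ (s / (1 - alpha)))%:E `^ r)%E.
    by rewrite poweR_EFin -powRrM mulrAC.
  rewrite -poweRM ?lee_fin ?powR_ge0//.
  apply: (@le_trans _ _ ((D * w j) `^ r)%:E); last by rewrite lee_fin powR_le_lin.
  rewrite -(poweR_EFin (D * w j) r); apply: gt0_ler_poweR => //; first exact: ltW.
  - by rewrite in_itv/= leey andbT mule_ge0// lee_fin powR_ge0.
  - by rewrite in_itv/= leey andbT lee_fin mulr_ge0//; have /andP[] := w01 j.
have T0 j : (0 <= (jb R j `^ (s * r / (1 - alpha)))%:E * LpRd p (boxop eta j u) `^ r)%E.
  by rewrite mule_ge0 ?poweR_ge0// lee_fin powR_ge0.
have I1 : (\esum_(k in [set: 'rV[int]_d])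
     ((jb R k `^ (s * r / (1 - alpha)))%:E * LpRd p (boxop eta k u) `^ r) <= (D `^ r * S)%:E)%E.
  apply: ge_ereal_sup => _ [A [fA _] <-].
  rewrite fsbig_finite//=; set F := finmap.enum_fset _.
  apply: (@le_trans _ _ (D `^ r * \sum_(j <- F) w j)%:E); last first.
    by rewrite lee_fin ler_wpM2l ?powR_ge0// wS// finmap.fset_uniq.
  elim: F => [|j F IH]; first by rewrite !big_nil mulr0.
  by rewrite !big_cons mulrDr EFinD; apply: leeD.
have -> : (D * S `^ r^-1)%:E = ((D `^ r * S)%:E `^ r^-1)%E.
  by rewrite poweR_EFin powRM ?powR_ge0 ?(ltW S0)// -powRrM divff// powRr1.
apply: gt0_ler_poweR => //; first by rewrite invr_ge0 ltW.
- by rewrite in_itv/= leey andbT esum_ge0.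
- by rewrite in_itv/= leey lee_fin mulr_ge0 ?powR_ge0// ltW.
Qed.
End MnormBound.

(** * The propagator on modulated Gaussians *)

Section Propagator.
Variables (R : realType) (d : nat) (beta : R).
Local Notation T := (projT2 (RdT R d)).
Local Notation mu := (lebRd R d).
Local Notation V := ('rV[R]_d).
Local Notation C := (R[i]).

Definition pbell (t : R) (c : V) (rho : R) (xi : V) : C :=
  cexp (t * enorm xi `^ beta) * Complex (gbell c rho xi) 0.

Lemma measurable_enorm_powR : measurable_fun setT (fun y : T => enorm (vecRd y) `^ beta).
Proof.
apply: (@measurableT_comp _ _ _ _ _ _ (fun x : R => x `^ beta)).
  exact: measurable_powR.
apply: (@measurableT_comp _ _ _ _ _ _ (fun x : R => Num.sqrt x)).
  by apply: continuous_measurable_fun; exact: sqrt_continuous.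
by apply: (@measurable_dotV R d id id) => i; exact: measurable_coordV.
Qed.

Lemma gbell_gaussE (c : V) rho xi :
  gbell c rho xi = expR (- ((2 * rho ^+ 2)^-1 * dotR (xi - c) (xi - c))).
Proof. by rewrite /gbell mulrC. Qed.

Lemma integrable_gbell c rho : 0 < rho ->
  mu.-integrable setT (EFin \o (fun y => gbell c rho (vecRd y))).
Proof.
move=> r0; rewrite (_ : (fun y => _) = (fun y : T => expR (- ((2 * rho ^+ 2)^-1 * dotR (vecRd y - c) (vecRd y - c))))).
  by apply: integrable_gaussV; rewrite invr_gt0 mulr_gt0// exprn_gt0.
by apply/funext => y; rewrite gbell_gaussE.
Qed.

Lemma pbell_integrable t c rho : 0 < rho -> cintegrable mu (fun y => pbell t c rho (vecRd y)).
Proof.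
move=> r0; apply: (@cintegrable_cexpM R d (fun y => t * enorm (vecRd y) `^ beta)).
  by apply: measurable_funM => //; exact: measurable_enorm_powR.
split; first exact: integrable_gbell.
exact: integrable0.
Qed.

Lemma Sbeta_sum_gatom (I : eqType) (s : seq I) (c y : I -> V) (rho t : R) x : 0 < rho ->
  Sbeta beta t (fun x => \sum_(k <- s) gatom (c k) (y k) rho x) x =
  Complex ((2 * pi) ^- d) 0 * \sum_(k <- s) osc (x - y k) (pbell t (c k) rho).
Proof.
move=> rho0; rewrite /Sbeta /ifourier; congr (_ * _).
rewrite -[RHS]cint_sum => [|k _]; last first.
  by apply: osc_integrable; exact: pbell_integrable.
apply: eq_cint => z; rewrite fourier_sum_gatom// !mulr_sumr; apply: eq_bigr => k _.
rewrite /gbump /pbell (dotRDl x) dotRNl cexpD -/(gbell (c k) rho (vecRd z)); ring.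
Qed.
End Propagator.

(** * Height of a propagated Gaussian near its centre *)

Section LowerBound.
Variables (R : realType) (d : nat) (beta : R).
Local Notation T := (projT2 (RdT R d)).
Local Notation mu := (lebRd R d).
Local Notation V := ('rV[R]_d).

Lemma cos_ge_quad (x : R) : 1 - x ^+ 2 / 2 <= cos x.
Proof.
have sle (y : R) : `|sin y| <= `|y|.
  have := @lipschitz_bound R sin cos 0 y 1 (@is_derive_sin R) (fun w _ => cos_max w).
  by rewrite add0r sin0 subr0 mulr1.
have cE : cos x = 1 - 2 * sin (x / 2) ^+ 2.
  have {1}-> : x = x / 2 + x / 2 by field.
  by rewrite cosD -!expr2 cos2sin2; ring.
have h : sin (x / 2) ^+ 2 <= (x / 2) ^+ 2.
  rewrite -[leLHS]real_normK ?num_real// -[leRHS]real_normK ?num_real//.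
  by apply: lerXn2r; rewrite ?nnegrE.
move: h; rewrite cE !expr2; lra.
Qed.

Lemma Rintegral_gbell (c : V) rho : 0 < rho ->
  Rintegral mu setT (fun y => gbell c rho (vecRd y)) = Num.sqrt (2 * pi) ^+ d * rho ^+ d.
Proof.
move=> r0; have k0 : 0 < (2 * rho ^+ 2)^-1 by rewrite invr_gt0 mulr_gt0// exprn_gt0.
transitivity (Num.sqrt (pi / (2 * rho ^+ 2)^-1) ^+ d).
  rewrite /Rintegral -[RHS](_ : fine (Num.sqrt (pi / (2 * rho ^+ 2)^-1) ^+ d)%:E = _)//.
  rewrite -(integral_gaussV c k0); congr fine; apply: eq_integral => y _.
  by rewrite gbell_gaussE.
rewrite invrK mulrA (mulrC pi) sqrtrM ?mulr_ge0 ?pi_ge0// sqrtr_sqr gtr0_norm//.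
by rewrite exprMn.
Qed.

(** After removal of the constant phase phi, the real part is at least the integral of (1 - th^2 /
    2) times the Gaussian. The phase error may grow quadratically in |xi - c|^2 / rho^2, since half
    of the Gaussian exponent absorbs its square. *)
Lemma osc_lower : exists2 eps : R, 0 < eps & forall (rho t phi : R) (c z : V), 0 < rho ->
  (forall xi, `|dotR z xi + t * enorm xi `^ beta - phi| <=
      eps * (1 + dotR (xi - c) (xi - c) / rho ^+ 2) ^+ 2) ->
  Num.sqrt (2 * pi) ^+ d / 2 * rho ^+ d <= cabs (osc z (pbell beta t c rho)).
Proof.
have k4 : 0 < (4^-1 : R) by rewrite invr_gt0.
have [K K0 HK] := poly_exp_bound 4 k4.
pose s2 : R := Num.sqrt (2 * pi) ^+ d; pose s4 : R := Num.sqrt (4 * pi) ^+ d.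
have s20 : 0 < s2 by rewrite exprn_gt0// sqrtr_gt0 mulr_gt0// pi_gt0.
have s40 : 0 < s4 by rewrite exprn_gt0// sqrtr_gt0 mulr_gt0// pi_gt0.
(* Chosen so that the quadratic loss, at most e2 / 2 * K * s4 * rho^d, is half of the Gaussian
   integral s2 * rho^d. *)
pose e2 := s2 / (K * s4); have e20 : 0 < e2 by rewrite divr_gt0// mulr_gt0.
exists (Num.sqrt e2); first by rewrite sqrtr_gt0.
move=> rho t phi c z rho0 H.
have r2 : 0 < rho ^+ 2 by rewrite exprn_gt0.
have k0 : 0 < (4 * rho ^+ 2)^-1 by rewrite invr_gt0 mulr_gt0.
pose th (y : T) := dotR z (vecRd y) + t * enorm (vecRd y) `^ beta - phi.
have mth : measurable_fun setT th.
  apply: measurable_funB => //; apply: measurable_funD; first exact: measurable_dotz.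
  by apply: measurable_funM => //; exact: measurable_enorm_powR.
have ig := integrable_gbell c rho0.
have ip : cintegrable mu (fun y => Complex (gbell c rho (vecRd y)) 0).
  by split => //; exact: integrable0.
have oi := osc_integrable z (@pbell_integrable R d beta t c rho rho0).
have -> : cabs (osc z (pbell beta t c rho)) = cabs (cexp (- phi) * osc z (pbell beta t c rho)).
  by rewrite cabsM cabs_cexp mul1r.
rewrite -[osc _ _]/(cint mu (fun y => cexp (dotR z (vecRd y)) * pbell beta t c rho (vecRd y))).
rewrite -cintZ//.
have -> : cint mu (fun y => cexp (- phi) * (cexp (dotR z (vecRd y)) * pbell beta t c rho (vecRd y))) =
   cint mu (fun y => cexp (th y) * Complex (gbell c rho (vecRd y)) 0).
  by apply: eq_cint => y; rewrite /pbell /th !cexpD; ring.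
have [ic _] := cintegrable_cexpM mth ip.
apply: le_trans (Re_le_cabs _); apply: le_trans (ler_norm _).
pose G4 (y : T) := expR (- ((4 * rho ^+ 2)^-1 * dotR (vecRd y - c) (vecRd y - c))).
have i4 : mu.-integrable setT (EFin \o (fun y => e2 / 2 * K * G4 y)).
  by apply: integrable_scale; exact: integrable_gaussV.
have I4 : Rintegral mu setT G4 = s4 * rho ^+ d.
  rewrite /Rintegral integral_gaussV//= invrK mulrA (mulrC pi) sqrtrM ?mulr_ge0 ?pi_ge0//.
  by rewrite sqrtr_sqr gtr0_norm// exprMn.
apply: (@le_trans _ _ (Rintegral mu setT (fun y => gbell c rho (vecRd y) - e2 / 2 * K * G4 y))).
  rewrite RintegralB// Rintegral_gbell// RintegralZl//; last exact: integrable_gaussV.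
  rewrite I4 -/s2 le_eqVlt; apply/orP; left; apply/eqP.
  by rewrite /e2; field; rewrite !gt_eqF.
apply: le_Rintegral => //.
  have := integrableB measurableT ig i4; congr (integrable _ _ _).
move=> y _; rewrite ReM /= mulr0 subr0.
have g0 : 0 <= gbell c rho (vecRd y) by exact: expR_ge0.
apply: (@le_trans _ _ ((1 - th y ^+ 2 / 2) * gbell c rho (vecRd y))); last first.
  by rewrite ler_wpM2r// cos_ge_quad.
rewrite mulrBl mul1r lerD2l lerN2.
pose w := dotR (vecRd y - c) (vecRd y - c) / rho ^+ 2.
have w0 : 0 <= w by rewrite divr_ge0 ?dotR_ge0// ltW.
have t2 : th y ^+ 2 <= e2 * (1 + w) ^+ 4.
  have := H (vecRd y); rewrite -/(th y) -/w => h.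
  rewrite -real_normK ?num_real//.
  have -> : e2 * (1 + w) ^+ 4 = (Num.sqrt e2 * (1 + w) ^+ 2) ^+ 2.
    by rewrite exprMn sqr_sqrtr ?(ltW e20)// -exprM.
  apply: lerXn2r; [by rewrite nnegrE| |exact: h].
  by rewrite nnegrE mulr_ge0 ?sqrtr_ge0 ?sqr_ge0.
have gE : gbell c rho (vecRd y) = expR (- (4^-1 * w)) * expR (- (4^-1 * w)).
  rewrite /gbell -expRD /w; congr expR; field; by rewrite gt_eqF.
have GE : G4 y = expR (- (4^-1 * w)).
  rewrite /G4 /w; congr (expR (- _)); field; by rewrite gt_eqF.
rewrite gE GE mulrA ler_wpM2r ?expR_ge0//.
apply: (@le_trans _ _ (e2 / 2 * ((1 + w) ^+ 4 * expR (- (4^-1 * w))))).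
  rewrite mulrA ler_wpM2r ?expR_ge0//; move: t2; lra.
by apply: ler_wpM2l; [rewrite divr_ge0// ltW|exact: (HK _ w0)].
Qed.
End LowerBound.

(** * Smallness of a propagated Gaussian far away *)

Section Tail.
Variables (R : realType) (d : nat) (beta : R).
Hypothesis beta02 : 0 < beta <= 2.
Local Notation T := (projT2 (RdT R d)).
Local Notation mu := (lebRd R d).
Local Notation V := ('rV[R]_d).
Local Notation e_ i := (delta_mx 0 i : V).

Lemma cexp_lip (x y : R) : cabs (cexp x - cexp y) <= 2 * `|x - y|.
Proof.
have L (f f' : R -> R) : (forall w : R, is_derive w 1 f (f' w)) -> (forall w, `|f' w| <= 1) ->
    `|f x - f y| <= `|x - y|.
  move=> D B; have := @lipschitz_bound R f f' y (x - y) 1 D; rewrite subrKC mulr1; apply=> w _; exact: B.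
apply: (le_trans (cabs_le_ReIm _)); rewrite mulr2n mulrDl mul1r; apply: lerD => /=.
  by apply: (L cos (fun w => - sin w)) => w; rewrite normrN sin_max.
by apply: (L sin cos) => w; exact: cos_max.
Qed.

(** Add up u <= u^b for the two fractions u = x / (x+y) and u = y / (x+y). *)
Lemma powR_subadd (b x y : R) : 0 <= b <= 1 -> 0 <= x -> 0 <= y -> (x + y) `^ b <= x `^ b + y `^ b.
Proof.
move=> /andP[b0 b1] x0 y0; have [xy|xy] := eqVneq (x + y) 0.
  have -> : x = 0 by apply/eqP; rewrite eq_le x0 andbT -xy lerDl.
  by rewrite add0r lerDr powR_ge0.
have p : 0 < x + y by rewrite lt_neqAle eq_sym xy addr_ge0.
have frac z : 0 <= z -> z <= x + y -> z / (x + y) * (x + y) `^ b <= z `^ b.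
  move=> z0 zp; have [->|zn] := eqVneq z 0; first by rewrite !mul0r powR_ge0.
  have zp0 : 0 < z by rewrite lt_neqAle eq_sym zn.
  have {2}-> : z = z / (x + y) * (x + y) by rewrite divfK.
  have q0 : 0 < z / (x + y) by rewrite divr_gt0.
  rewrite [leRHS]powRM ?(ltW q0) ?(ltW p)// ler_wpM2r ?powR_ge0// -[leLHS]powRr1 ?(ltW q0)//.
  by rewrite ger_powR// q0 ler_pdivrMr// mul1r.
have := lerD (frac x x0 _) (frac y y0 _); rewrite -mulrDl -mulrDl divff// mul1r; apply.
  by rewrite lerDl.
by rewrite lerDr.
Qed.

Lemma powR_holder (b x y : R) : 0 <= b <= 1 -> 0 <= x -> 0 <= y -> `|x `^ b - y `^ b| <= `|x - y| `^ b.
Proof.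
move=> b01; wlog xy : x y / y <= x => [H x0 y0|x0 y0].
  have [yx|/ltW yx] := leP y x; first exact: H.
  by rewrite distrC (distrC x y); exact: H.
have b0 : 0 <= b by case/andP: b01.
rewrite ger0_norm ?subr_ge0 ?ge0_ler_powR ?nnegrE// ger0_norm ?subr_ge0// lerBlDr.
by rewrite -{1}(subrK y x) powR_subadd// subr_ge0.
Qed.

Lemma expR_lip (x y : R) : `|expR (- x) - expR (- y)| <= `|x - y| * (expR (- x) + expR (- y)).
Proof.
wlog xy : x y / y <= x => [H|].
  have [yx|/ltW yx] := leP y x; first exact: H.
  by rewrite distrC (distrC x y) (addrC (expR (- x))); exact: H.
rewrite distrC ger0_norm ?subr_ge0 ?ler_expR ?lerN2// ger0_norm ?subr_ge0//.
have -> : expR (- x) = expR (- y) * expR (- (x - y)) by rewrite -expRD; congr expR; ring.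
have := expR_ge1Dx (- (x - y)); have := expR_gt0 (- y); have := expR_gt0 (- (x - y)).
move: (expR (- y)) (expR (- (x - y))) => a b.
have : 0 <= x - y by rewrite subr_ge0.
move: (x - y) => w w0 b0 a0 h.
have : 0 <= a * (b - (1 - w)) by rewrite mulr_ge0 ?(ltW a0)//; lra.
have : 0 <= w * (a * b) by rewrite !mulr_ge0 ?(ltW a0) ?(ltW b0).
lra.
Qed.

(** A Riemann-Lebesgue argument, uniform in t: one difference of step h = pi / z_i. As |xi|^beta =
    (|xi|^2)^(beta/2) with beta / 2 <= 1, the amplitude changes by O(|h|^(beta/2)) times a quadratic
    factor that the Gaussian absorbs. *)
Lemma osc_tail (c : V) (rho delta : R) : 0 < rho -> 0 < delta ->
  exists2 Z : R, 0 < Z & forall (t : R) (z : V), 0 <= t <= 1 -> (exists i, Z <= `|z 0 i|) ->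
    cabs (osc z (pbell beta t c rho)) <= delta.
Proof.
move=> rho0 de0; have /andP[be0 be2] := beta02.
pose b := beta / 2; have b01 : 0 <= b <= 1 by rewrite /b; lra.
have bp : 0 < b by rewrite /b; lra.
have r2 : 0 < rho ^+ 2 by rewrite exprn_gt0.
have k4 : 0 < (4 * rho ^+ 2)^-1 by rewrite invr_gt0 mulr_gt0.
have [K K0 HK] := poly_exp_bound 1 k4.
(* The first summand serves the difference of the phase factors, the second that of the
   Gaussians. *)
pose Q := 8 * (2 + dotR c c) + (2 * rho ^+ 2)^-1 * 2.
have Q0 : 0 < Q.
  by rewrite ltr_wpDr ?mulr_gt0 ?ltr_pwDl ?dotR_ge0// mulr_ge0// invr_ge0 ltW// mulr_gt0.
pose S := Num.sqrt (pi / (4 * rho ^+ 2)^-1) ^+ d.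
have S0 : 0 < S by rewrite exprn_gt0// sqrtr_gt0 divr_gt0 ?pi_gt0.
pose D := 2 * (Q * K * S); have D0 : 0 < D by rewrite !mulr_gt0.
(* Small enough that D h0^(beta/2) <= delta; the condition |z_i| >= pi / h0 then keeps |h| below
   it. *)
pose h0 := Num.min 1 ((delta / D) `^ b^-1).
have h00 : 0 < h0 by rewrite lt_min ltr01 powR_gt0// divr_gt0.
exists (pi / h0); first by rewrite divr_gt0// pi_gt0.
move=> t z /andP[t0 t1] [i Hi].
have zn0 : 0 < `|z 0 i| by apply: lt_le_trans Hi; rewrite divr_gt0// pi_gt0.
have zi : z 0 i != 0 by rewrite -normr_gt0.
pose h := pi / z 0 i.
have hn : `|h| = pi / `|z 0 i| by rewrite normrM normfV ger0_norm ?pi_ge0.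
have hh0 : `|h| <= h0 by rewrite hn ler_pdivrMr// mulrC -ler_pdivrMr.
have h1 : `|h| <= 1 by rewrite (le_trans hh0)// ge_min lexx.
have hb : D * `|h| `^ b <= delta.
  rewrite mulrC -ler_pdivlMr//.
  have : `|h| `^ b <= ((delta / D) `^ b^-1) `^ b.
    apply: ge0_ler_powR; rewrite ?nnegrE ?powR_ge0 ?(ltW bp)// (le_trans hh0)// ge_min lexx orbT//.
  by rewrite -powRrM mulVf ?gt_eqF// powRr1// divr_ge0// ltW.
have hb1 : `|h| <= `|h| `^ b.
  have [->|hn0] := eqVneq `|h| 0; first exact: powR_ge0.
  by rewrite -[leLHS]powRr1// ger_powR ?h1 ?andbT ?lt_neqAle 1?eq_sym ?hn0 ?normr_ge0//; case/andP: b01.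
have zh : z 0 i * h = pi by rewrite /h mulrC divfK.
have oi := @pbell_integrable R d beta t c rho rho0.
pose G (x y : V) := expR (- ((4 * rho ^+ 2)^-1 * dotR (x - y) (x - y))).
(* Two Gaussians, since the difference evaluates the amplitude at x and at x + h e_i. *)
pose B (y : T) := Q * K * `|h| `^ b * (G (vecRd y) c + G (vecRd y) (c - h *: e_ i)).
have iG u : mu.-integrable setT (EFin \o (fun y => G (vecRd y) u)) by exact: integrable_gaussV.
have iGG : mu.-integrable setT (EFin \o (fun y => G (vecRd y) c + G (vecRd y) (c - h *: e_ i))).
  by have := integrableD measurableT (iG c) (iG (c - h *: e_ i)); congr (integrable _ _ _).
have iB : mu.-integrable setT (EFin \o B) by exact: integrable_scale.
have IB : Rintegral mu setT B = Q * K * `|h| `^ b * (2 * S).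
  rewrite /B RintegralZl// RintegralD//; congr (_ * _).
  by rewrite /Rintegral /G !integral_gaussV//= -/S; ring.
have [id E] := @osc_iter_dif R d 1 z i h _ (or_intror zh) oi.
have bnd y : cabs (cexp (dotR z (vecRd y)) * iter 1 (dif i h) (pbell beta t c rho) (vecRd y)) <= B y.
  rewrite cabsM cabs_cexp mul1r /= /dif /pbell /B; move: (vecRd y) => x.
  set x' := x + h *: e_ i; set A := cexp _; set A' := cexp _.
  have xc : x - (c - h *: e_ i) = x' - c by rewrite /x' opprB addrA addrAC.
  have -> : A * Complex (gbell c rho x') 0 - A' * Complex (gbell c rho x) 0 =
     (A - A') * Complex (gbell c rho x) 0 + A * Complex (gbell c rho x' - gbell c rho x) 0.
    have -> : Complex (gbell c rho x' - gbell c rho x) 0 = Complex (gbell c rho x') 0 - Complex (gbell c rho x) 0 :> R[i].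
      by apply: complex_ext; rewrite /= ?subr0 ?oppr0 ?addr0.
    by ring.
  pose w u := dotR (u - c) (u - c).
  have w0 u : 0 <= w u by exact: dotR_ge0.
  have gG u : (1 + w u) * gbell c rho u <= K * G u c.
    rewrite gbell_gaussE -/(w u) /G -/(w u).
    have -> : - ((2 * rho ^+ 2)^-1 * w u) = - ((4 * rho ^+ 2)^-1 * w u) + - ((4 * rho ^+ 2)^-1 * w u).
      by field; rewrite gt_eqF.
    by rewrite expRD mulrA ler_wpM2r ?expR_ge0//; have := HK (w u) (w0 u); rewrite expr1.
  have eE : e_ i 0 i = 1 by rewrite mxE !eqxx.
  have x'E : dotR x' x' - dotR x x = h * (2 * x 0 i + h).
    by rewrite /x' dotR_sqrD dotRZr dotR_delta dotRZl dotRZr dotR_delta eE; ring.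
  have w'E : w x' - w x = h * (2 * (x - c) 0 i + h).
    by rewrite /w /x' addrAC dotR_sqrD dotRZr dotR_delta dotRZl dotRZr dotR_delta eE; ring.
  have xle : 1 + `|x 0 i| <= 2 * (2 + dotR c c) * (1 + w x).
    have := sqr_coord_le (x - c) i; rewrite -/(w x).
    have := sqr_coord_le c i.
    have : `|x 0 i| <= `|(x - c) 0 i| + `|c 0 i| by rewrite -{1}(subrK c x) mxE ler_normD.
    rewrite -(real_normK (num_real (c 0 i))) -(real_normK (num_real ((x - c) 0 i))).
    have := sqr_ge0 (`|c 0 i| - 1); have := sqr_ge0 (`|(x - c) 0 i| - 1); have := w0 x; have := dotR_ge0 c.
    have := mulr_ge0 (w0 x) (dotR_ge0 c).
    rewrite !expr2; lra.
  have AA : cabs (A - A') <= 8 * (2 + dotR c c) * (1 + w x) * `|h| `^ b.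
    apply: (le_trans (cexp_lip _ _)); rewrite -mulrBr normrM (ger0_norm t0).
    apply: (@le_trans _ _ (2 * `|enorm x' `^ beta - enorm x `^ beta|)).
      by rewrite ler_pM2l// ler_piMl.
    rewrite -!sqr_enorm in x'E.
    have pw u : enorm u `^ beta = (enorm u ^+ 2) `^ b.
      by rewrite -powR_mulrn ?enorm_ge0// -powRrM /b mulrC divfK.
    rewrite !pw; apply: (@le_trans _ _ (2 * (`|enorm x' ^+ 2 - enorm x ^+ 2| `^ b))).
      by rewrite ler_pM2l// powR_holder// sqr_ge0.
    rewrite x'E normrM powRM// mulrCA [leRHS]mulrC ler_wpM2l ?powR_ge0//.
    have n1 : `|2 * x 0 i + h| <= 2 * (1 + `|x 0 i|).
      by apply: (le_trans (ler_normD _ _)); rewrite normrM (ger0_norm (ler0n _ 2)); lra.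
    have : `|2 * x 0 i + h| `^ b <= 2 * (1 + `|x 0 i|).
      apply: (@le_trans _ _ ((2 * (1 + `|x 0 i|)) `^ b)).
        by apply: ge0_ler_powR; rewrite ?nnegrE ?(ltW bp)// mulr_ge0// addr_ge0.
      have g1 : 1 <= 2 * (1 + `|x 0 i|) by have := normr_ge0 (x 0 i); lra.
      rewrite -[leRHS]powRr1 ?(le_trans ler01)// ler_powR//; by case/andP: b01.
    move: xle; lra.
  have GG : `|gbell c rho x' - gbell c rho x| <=
      (2 * rho ^+ 2)^-1 * 2 * `|h| `^ b * ((1 + w x') * gbell c rho x' + (1 + w x) * gbell c rho x).
    rewrite {1 2}/gbell; apply: (le_trans (expR_lip _ _)).
    rewrite -!/(gbell c rho _) -/(w x') -/(w x) -mulrBl w'E normrM (gtr0_norm (_ : 0 < (2 * rho ^+ 2)^-1)) ?invr_gt0 ?mulr_gt0//.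
    rewrite normrM.
    have n1 : `|2 * (x - c) 0 i + h| <= 2 * (1 + w x).
      apply: (le_trans (ler_normD _ _)); rewrite normrM (ger0_norm (ler0n _ 2)).
      have := sqr_coord_le (x - c) i; rewrite -/(w x) -(real_normK (num_real ((x - c) 0 i))).
      have := w0 x; have := sqr_ge0 (`|(x - c) 0 i| - 1); rewrite !expr2; lra.
    have n2 : `|2 * (x - c) 0 i + h| <= 2 * (1 + w x').
      have hE : (h *: e_ i) 0 i = h by rewrite mxE eE mulr1.
      have xE : (x' - c) 0 i = (x - c) 0 i + h by rewrite /x' addrAC mxE hE.
      have -> : 2 * (x - c) 0 i + h = 2 * (x' - c) 0 i - h by rewrite xE; ring.
      apply: (le_trans (ler_normB _ _)); rewrite normrM (ger0_norm (ler0n _ 2)).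
      have := sqr_coord_le (x' - c) i; rewrite -/(w x') -(real_normK (num_real ((x' - c) 0 i))).
      have := w0 x'; have := sqr_ge0 (`|(x' - c) 0 i| - 1); rewrite !expr2; lra.
    rewrite [leLHS]mulrDr [leRHS]mulrDr; apply: lerD.
      have -> : (2 * rho ^+ 2)^-1 * 2 * `|h| `^ b * ((1 + w x') * gbell c rho x') =
        `|h| `^ b * (2 * (1 + w x')) * (2 * rho ^+ 2)^-1 * gbell c rho x' by ring.
      rewrite ler_wpM2r ?expR_ge0// ler_wpM2r ?invr_ge0 ?mulr_ge0 ?(ltW r2) ?(ltW rho0)//.
      by apply: ler_pM.
    have -> : (2 * rho ^+ 2)^-1 * 2 * `|h| `^ b * ((1 + w x) * gbell c rho x) =
      `|h| `^ b * (2 * (1 + w x)) * (2 * rho ^+ 2)^-1 * gbell c rho x by ring.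
    rewrite ler_wpM2r ?expR_ge0// ler_wpM2r ?invr_ge0 ?mulr_ge0 ?(ltW r2) ?(ltW rho0)//.
    by apply: ler_pM.
  apply: (le_trans (cabsD _ _)); rewrite !cabsM cabs_cexp mul1r !cabs_real.
  have g0 : 0 <= gbell c rho x by exact: expR_ge0.
  rewrite (ger0_norm g0).
  have GE : G x (c - h *: e_ i) = G x' c by rewrite /G xc.
  have H1 : cabs (A - A') * gbell c rho x <= 8 * (2 + dotR c c) * `|h| `^ b * (K * G x c).
    apply: (@le_trans _ _ (8 * (2 + dotR c c) * `|h| `^ b * ((1 + w x) * gbell c rho x))).
      rewrite mulrA ler_wpM2r// (le_trans AA)// le_eqVlt; apply/orP; left; apply/eqP; ring.
    by rewrite ler_wpM2l// !mulr_ge0 ?powR_ge0// addr_ge0// dotR_ge0.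
  have H2 : `|gbell c rho x' - gbell c rho x| <= (2 * rho ^+ 2)^-1 * 2 * `|h| `^ b * (K * G x' c + K * G x c).
    apply: (le_trans GG); rewrite ler_wpM2l ?lerD//.
    by rewrite !mulr_ge0 ?powR_ge0// invr_ge0 mulr_ge0// ltW.
  apply: (le_trans (lerD H1 H2)).
  have c1 : 0 <= 8 * (2 + dotR c c) by rewrite mulr_ge0// addr_ge0// dotR_ge0.
  have p1 : 0 <= 8 * (2 + dotR c c) * `|h| `^ b * K * G x' c.
    by rewrite !mulr_ge0 ?powR_ge0 ?expR_ge0 ?(ltW K0)// addr_ge0// dotR_ge0.
  rewrite GE /Q; move: p1; lra.
have := cabs_cint_le (osc_integrable z id) bnd iB.
rewrite -[cint _ _]/(osc z (iter 1 (dif i h) (pbell beta t c rho))) E expr1 cabsM IB cabsN.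
have -> : cabs (2 : R[i]) = 2.
  by rewrite (_ : 2 = Complex 2 0) ?cabs_real ?ger0_norm//; apply: complex_ext; rewrite /= ?addr0.
move: hb; rewrite /D; lra.
Qed.
End Tail.

(** * Taylor expansion of the phase *)

Section Phase.
Variables (R : realType) (d : nat).
Local Notation V := ('rV[R]_d).

(* Concavity of ln: b ln(1+h) = b ln(1+h) + (1-b) ln 1 <= ln(1 + b h). *)
Lemma powR_bernoulli (b h : R) : 0 <= b <= 1 -> -1 < h -> (1 + h) `^ b <= 1 + b * h.
Proof.
move=> /andP[b0 b1] h1; have hp : 0 < 1 + h by move: h1; lra.
have bh : 0 < 1 + b * h by have [hh|hh] := leP 0 h; nra.
set m := 1 + b * h in bh *.
have e1 : ln ((1 + h) / m) <= (1 + h) / m - 1.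
  by have := le_ln1Dx (x := (1 + h) / m - 1); rewrite subrKC; apply; rewrite ltrBrDr addNr divr_gt0.
have e2 : ln (1 / m) <= 1 / m - 1.
  by have := le_ln1Dx (x := 1 / m - 1); rewrite subrKC; apply; rewrite ltrBrDr addNr divr_gt0.
rewrite /powR gt_eqF// -[leRHS]lnK ?posrE// ler_expR.
move: e1 e2; rewrite !ln_div ?posrE// ln1 sub0r => e1 e2.
have : b * ((1 + h) / m - 1) + (1 - b) * (1 / m - 1) = 0.
  by rewrite /m; field; rewrite -/m gt_eqF.
nra.
Qed.

(** For h > -1/2 the upper bound is Bernoulli's inequality and the lower bound is the same
    inequality for 1 / (1+h). For h <= -1/2, 4 h^2 >= 1 dominates the left side. *)
Lemma powR_taylor (b h : R) : 0 <= b <= 1 -> -1 <= h ->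
  `|(1 + h) `^ b - 1 - b * h| <= 4 * h ^+ 2.
Proof.
move=> /andP[b0 b1] h1.
have [h2|h2] := leP h (- 2^-1).
  have p0 := powR_ge0 (1 + h) b.
  have p1 : (1 + h) `^ b <= 1.
    have := @ge0_ler_powR R b b0 (1 + h) 1; rewrite powR1; apply; rewrite ?nnegrE//; lra.
  rewrite ler_norml expr2; apply/andP; split; nra.
have hp : 0 < 1 + h by lra.
have hm : -1 < h by lra.
have up := powR_bernoulli (introT andP (conj b0 b1)) hm.
have k1 : -1 < (1 + h)^-1 - 1 by rewrite ltrBrDr addNr invr_gt0.
have := powR_bernoulli (introT andP (conj b0 b1)) k1.
have iE : (1 + h)^-1 `^ b = ((1 + h) `^ b)^-1.
  by rewrite -powR_inv1 ?(ltW hp)// -powRrM mulN1r powRN.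
rewrite subrKC iE => low.
have P0 : 0 < (1 + h) `^ b by rewrite powR_gt0.
have bb : 0 <= (1 - b) * (h + 2^-1) by apply: mulr_ge0; lra.
have b2 : b * (1 - b) <= 1 by nra.
have q0 : 0 < 1 + (1 - b) * h by nra.
have : 1 <= (1 + h) `^ b * (1 + b * ((1 + h)^-1 - 1)) by rewrite mulrC -ler_pdivrMr// div1r.
have -> : 1 + b * ((1 + h)^-1 - 1) = (1 + (1 - b) * h) / (1 + h) by field; rewrite gt_eqF.
rewrite mulrA ler_pdivlMr// mul1r => low2.
rewrite ler_norml; apply/andP; split; last by have := sqr_ge0 h; lra.
suff : 1 + b * h - 4 * h ^+ 2 <= (1 + h) `^ b by lra.
rewrite -(ler_pM2r q0); apply: le_trans low2.
rewrite -subr_ge0 (_ : _ - _ = h ^+ 2 * (4 * (1 + (1 - b) * h) - b * (1 - b))); last by ring.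
by rewrite mulr_ge0 ?sqr_ge0//; lra.
Qed.

Lemma enorm_powR (beta : R) (x : V) : enorm x `^ beta = dotR x x `^ (beta / 2).
Proof. by rewrite -sqr_enorm -powR_mulrn ?enorm_ge0// -powRrM mulrC divfK. Qed.

Lemma sum_coord_le (z u : V) (e : R) : 0 <= e -> (forall i, `|z 0 i| <= e) ->
  `|dotR z u| <= e * d%:R * (1 + dotR u u).
Proof.
move=> e0 H; rewrite /dotR; apply: (le_trans (ler_norm_sum _ _ _)).
rewrite -mulrA mulrCA -[d in d%:R]card_ord -sum1_card natr_sum mulr_suml.
apply: ler_sum => i _; rewrite normrM mul1r; apply: ler_pM => //.
have := sqr_coord_le u i; rewrite /dotR -(real_normK (num_real (u 0 i))).
have := sqr_ge0 (`|u 0 i| - 1); nra.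
Qed.

(** With z = xi - c, write |xi|^2 = |c|^2 (1 + h), h = (2 c.z + |z|^2) / |c|^2, and expand (1 +
    h)^(beta/2). The vector before [c] is the group velocity. The constant 33 is 4 * 8 + 1: 4 h^2
    with h^2 <= 8 (rho/|c|)^2 (...)^2, plus the term in |z|^2 left over from the linear part of
    h. *)
Lemma phase_taylor (beta rho Q : R) (c xi : V) : 0 < beta <= 2 -> 0 < rho -> rho <= enorm c ->
  enorm c `^ beta * (rho / enorm c) ^+ 2 <= Q ->
  `|enorm xi `^ beta - enorm c `^ beta -
     dotR ((beta * enorm c `^ beta / enorm c ^+ 2) *: c) (xi - c)| <=
    33 * Q * (1 + dotR (xi - c) (xi - c) / rho ^+ 2) ^+ 2.
Proof.
move=> /andP[be0 be2] rho0 rM HQ; set M := enorm c in rM HQ *.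
have M0 : 0 < M by exact: lt_le_trans rM.
have M2 : 0 < M ^+ 2 by rewrite exprn_gt0.
have dc : dotR c c = M ^+ 2 by rewrite sqr_enorm.
set z := xi - c; pose h := (2 * dotR c z + dotR z z) / M ^+ 2.
have xE : dotR xi xi = M ^+ 2 * (1 + h).
  rewrite -(subrKC c xi) -/z dotR_sqrD dc /h; field; by rewrite gt_eqF.
have h1 : -1 <= h.
  have : 0 <= 1 + h by rewrite -(pmulr_rge0 _ M2) -xE dotR_ge0.
  lra.
have b01 : 0 <= beta / 2 <= 1 by lra.
have Mb : M `^ beta = (M ^+ 2) `^ (beta / 2) by rewrite -powR_mulrn ?(ltW M0)// -powRrM mulrC divfK.
rewrite enorm_powR xE powRM ?(ltW M2)//; last by lra.
rewrite -Mb dotRZl; set Y := M `^ beta in HQ *.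
have Y0 : 0 < Y by rewrite powR_gt0.
have := powR_taylor b01 h1; set P := (1 + h) `^ (beta / 2) => HP.
have w0 := dotR_ge0 z; set w := dotR z z in w0 h xE h1 P HP *.
have -> : Y * P - Y - beta * Y / M ^+ 2 * dotR c z = Y * (P - 1 - beta / 2 * h) + Y * (beta / 2 * w / M ^+ 2).
  rewrite /h -/w; field; by rewrite gt_eqF.
have h2 : h ^+ 2 <= 8 * (rho / M) ^+ 2 * (1 + w / rho ^+ 2) ^+ 2.
  have cs : dotR c z ^+ 2 <= M ^+ 2 * w by rewrite -dc; exact: dotR_sqr_le.
  have a1 : h ^+ 2 <= (8 * dotR c z ^+ 2 + 2 * w ^+ 2) / M ^+ 4.
    rewrite /h -/w expr_div_n -exprM ler_pM2r ?invr_gt0 ?exprn_gt0//.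
    have := sqr_ge0 (2 * dotR c z - w); rewrite !expr2; nra.
  apply: (le_trans a1); rewrite ler_pdivrMr ?exprn_gt0//.
  have -> : 8 * (rho / M) ^+ 2 * (1 + w / rho ^+ 2) ^+ 2 * M ^+ 4 =
     8 * M ^+ 2 * (rho ^+ 2 + 2 * w + w ^+ 2 / rho ^+ 2).
    by field; rewrite !gt_eqF.
  have r2 : rho ^+ 2 <= M ^+ 2 by apply: lerXn2r => //; rewrite nnegrE ltW.
  have : w ^+ 2 <= M ^+ 2 * (w ^+ 2 / rho ^+ 2).
    by rewrite mulrCA ler_peMr ?sqr_ge0// ler_pdivlMr ?exprn_gt0// mul1r.
  have : 0 <= M ^+ 2 * rho ^+ 2 by rewrite mulr_ge0 ?sqr_ge0.
  have : 0 <= M ^+ 2 * w by rewrite mulr_ge0// ltW.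
  have := sqr_ge0 w; rewrite !mulrDr; move: cs; lra.
have t2 : w / M ^+ 2 <= (rho / M) ^+ 2 * (1 + w / rho ^+ 2) ^+ 2.
  have : w / M ^+ 2 = (rho / M) ^+ 2 * (w / rho ^+ 2) by field; rewrite !gt_eqF.
  move=> ->; rewrite ler_wpM2l ?sqr_ge0//.
  have : 0 <= w / rho ^+ 2 by rewrite divr_ge0// sqr_ge0.
  rewrite expr2; nra.
have W0 : 0 <= (1 + w / rho ^+ 2) ^+ 2 by exact: sqr_ge0.
apply: (@le_trans _ _ (33 * (Y * (rho / M) ^+ 2) * (1 + w / rho ^+ 2) ^+ 2)); last first.
  by rewrite ler_wpM2r// ler_pM2l.
apply: (le_trans (ler_normD _ _)).
rewrite (normrM Y (P - 1 - _)) (normrM Y (beta / 2 * w / M ^+ 2)) (gtr0_norm Y0).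
have n2 : `|beta / 2 * w / M ^+ 2| <= w / M ^+ 2.
  have b2 : 0 <= beta / 2 by lra.
  rewrite ger0_norm; last by apply: divr_ge0; [exact: mulr_ge0|exact: ltW].
  by rewrite ler_wpM2r ?invr_ge0 ?(ltW M2)// ler_piMl//; lra.
move: n2 HP h2 t2; set n := `|beta / 2 * w / M ^+ 2|; set p := `|P - _ - _|.
set V1 := (rho / M) ^+ 2; set V2 := (1 + _) ^+ 2; move=> n2 HP h2 t2.
rewrite -mulrDr (_ : 33 * (Y * V1) * V2 = Y * (33 * V1 * V2)); last by ring.
by rewrite ler_pM2l//; lra.
Qed.
End Phase.

(** * Space-time tubes *)

Section MovingBox.
Variables (R : realType) (d : nat).
Local Notation T := (projT2 (RdT R d)).
Local Notation mu := (lebRd R d).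
Local Notation leb := (@lebesgue_measure R).
Local Notation V := ('rV[R]_d).

(** The tube swept out by a cube of half-width delta whose centre y - t v moves with t. A cube makes
    the indicator at fixed t a product over the coordinates. *)
Definition mbox (tau delta : R) (y v : V) : set (projT2 (RdT R d.+1)) :=
  [set z | 0 <= z.1 <= tau /\ forall i, `|(vecRd z.2 - y) 0 i + z.1 * v 0 i| <= delta].

Definition itvind (a b x : R) : R := \1_(`[a, b]%classic : set R) x.

Lemma integral_itvind (a b : R) : a <= b -> (\int[leb]_x (itvind a b x)%:E = (b - a)%:E)%E.
Proof.
move=> ab; rewrite integral_indic//= setIT lebesgue_measure_itv/= lte_fin.
by move: ab; rewrite le_eqVlt => /predU1P[->|->]//; rewrite ltxx subrr.
Qed.

Lemma measurable_itvind a b : measurable_fun setT (itvind a b).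
Proof. exact: measurable_indic. Qed.

Lemma itvindE a b x : itvind a b x = ((a <= x <= b)%R : bool)%:R.
Proof. by rewrite /itvind indicE mem_setE in_itv. Qed.

Lemma mbox_indic tau delta y v (z : projT2 (RdT R d.+1)) : \1_(mbox tau delta y v) z =
  itvind 0 tau z.1 * \prod_(i < d) itvind (y 0 i - z.1 * v 0 i - delta) (y 0 i - z.1 * v 0 i + delta) (vecRd z.2 0 i).
Proof.
have cE i : (y 0 i - z.1 * v 0 i - delta <= vecRd z.2 0 i <= y 0 i - z.1 * v 0 i + delta) =
    (`|(vecRd z.2 - y) 0 i + z.1 * v 0 i| <= delta).
  by rewrite !mxE ler_norml; apply/andP/andP => -[]; split; lra.
rewrite indicE itvindE; have [zB|zB] := boolP (z \in mbox tau delta y v).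
  move: zB; rewrite inE => -[-> H]; rewrite mul1r big1// => i _.
  by rewrite itvindE cE H.
have [h0|_] := boolP (0 <= z.1 <= tau); last by rewrite mul0r.
rewrite mul1r; have [i Hi] : exists i, ~~ (`|(vecRd z.2 - y) 0 i + z.1 * v 0 i| <= delta).
  apply/existsP; rewrite -negb_forall; apply: contra zB => /forallP H.
  by rewrite inE; split.
by rewrite (bigD1 i)//= itvindE cE (negbTE Hi) mul0r.
Qed.

Lemma measurable_mbox tau delta y v : measurable (mbox tau delta y v).
Proof.
have m1 : measurable_fun setT (fun z : projT2 (RdT R d.+1) => z.1 : R) by exact: measurable_fst.
have mi i : measurable_fun setT (fun z : projT2 (RdT R d.+1) => `|(vecRd z.2 - y) 0 i + z.1 * v 0 i|).
  apply: measurableT_comp => //; apply: measurable_funD.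
    by apply: (measurableT_comp (@measurable_subV R d y i)); exact: measurable_snd.
  exact: measurable_funM.
rewrite (_ : mbox _ _ _ _ = (fun z : projT2 (RdT R d.+1) => z.1 : R) @^-1` `[0, tau]%classic `&`
   \bigcap_(i in [set: 'I_d]) ((fun z : projT2 (RdT R d.+1) => `|(vecRd z.2 - y) 0 i + z.1 * v 0 i|) @^-1` `]-oo, delta]%classic)).
  apply: measurableI; first by rewrite -[X in measurable X]setTI; exact: m1.
  apply: fin_bigcap_measurable; first exact: finite_finset.
  by move=> i _; rewrite -[X in measurable X]setTI; exact: mi.
apply/seteqP; split => z /=.
  by move=> [h H]; split; [rewrite in_itv|move=> i _ /=; rewrite in_itv/=].
by move=> [h H]; split; [move: h; rewrite in_itv|move=> i; have := H i Logic.I; rewrite /= in_itv].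
Qed.

(** Integrating first in space, each time slice is a cube of volume (2 delta)^d, whatever the
    velocity. *)
Lemma measure_mbox tau delta y v : 0 <= tau -> 0 <= delta ->
  lebRd R d.+1 (mbox tau delta y v) = (tau * (2 * delta) ^+ d)%:E.
Proof.
move=> tau0 de0; have mB := measurable_mbox tau delta y v.
transitivity (\int[lebRd R d.+1]_z (\1_(mbox tau delta y v) z)%:E)%E.
  by rewrite integral_indic// setIT.
rewrite integral_lebRdS_swap//; last by apply/measurable_EFinP; exact: measurable_indic.
transitivity (\int[leb]_x (((2 * delta) ^+ d)%:E * (itvind 0 tau x)%:E))%E.
  apply: eq_integral => x _.
  transitivity (\int[mu]_u ((itvind 0 tau x)%:E * (\prod_(i < d)
     itvind (y 0 i - x * v 0 i - delta) (y 0 i - x * v 0 i + delta) (vecRd u 0 i))%:E))%E.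
    by apply: eq_integral => u _; rewrite mbox_indic EFinM.
  have p0 (u : T) : 0 <= \prod_(i < d)
     itvind (y 0 i - x * v 0 i - delta) (y 0 i - x * v 0 i + delta) (vecRd u 0 i).
    by apply: prodr_ge0 => i _; rewrite itvindE.
  rewrite ge0_integralZl//; last 3 first.
  - apply/measurable_EFinP; apply: measurable_prod => i _.
    apply: measurableT_comp; first exact: measurable_itvind.
    exact: measurable_coordV.
  - by move=> u _; rewrite lee_fin.
  - by rewrite lee_fin itvindE.
  rewrite muleC; congr (_ * _)%E.
  rewrite (@integral_prodV R d (fun i => itvind (y 0 i - x * v 0 i - delta) (y 0 i - x * v 0 i + delta))); last 2 first.
  - by move=> i; exact: measurable_itvind.
  - by move=> i w; rewrite itvindE.
  transitivity (\prod_(i < d) (2 * delta)%:E)%E; last by rewrite prodEFin prodr_const card_ord.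
  by apply: eq_bigr => i _; rewrite integral_itvind; [congr _%:E; ring|lra].
rewrite ge0_integralZl//; last 3 first.
- by apply/measurable_EFinP; exact: measurable_itvind.
- by move=> u _; rewrite lee_fin itvindE.
- by rewrite lee_fin exprn_ge0// mulr_ge0.
by rewrite integral_itvind// -EFinM subr0 mulrC.
Qed.
End MovingBox.

(** * Upper bounds for the modulation norm *)

Section LatticeSums.
Variables (R : realType) (d : nat).
Local Notation Z := ('rV[int]_d).

(** Telescoping: with w_m = 1 + m / x, 1 / w_(m+1)^2 <= 1 / (w_m w_(m+1)) = x / w_m - x /
    w_(m+1). *)
Lemma sum_sqr_inv (x : R) (n : nat) : 1 <= x ->
  \sum_(m < n.+1) (1 + m%:R / x) ^- 2 <= 1 + x - x / (1 + n%:R / x).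
Proof.
move=> x1; have x0 : 0 < x by exact: lt_le_trans x1.
have p (k : nat) : 0 < 1 + k%:R / x by rewrite ltr_pwDl// divr_ge0// ltW.
elim: n => [|n IH].
  by rewrite big_ord1 mul0r addr0 expr1n invr1 mulr1 addrK.
rewrite big_ord_recr/= (le_trans (lerD IH (lexx _)))//.
have p1 := p n; have p2 := p n.+1.
have E : 1 + n.+1%:R / x = 1 + n%:R / x + x^-1 by rewrite -natr1 mulrDl div1r addrA.
have ix : 0 < x^-1 by rewrite invr_gt0.
suff : (1 + n.+1%:R / x) ^- 2 <= x / (1 + n%:R / x) - x / (1 + n.+1%:R / x) by lra.
have -> : x / (1 + n%:R / x) - x / (1 + n.+1%:R / x) = ((1 + n%:R / x) * (1 + n.+1%:R / x))^-1.
  rewrite E in p2 *; move: (1 + n%:R / x) p1 p2 => w w0 w1.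
  have : w + x^-1 = (w * x + 1) / x by field; rewrite gt_eqF.
  move=> ->; field; rewrite !gt_eqF//=; by rewrite ltr_wpDl// mulr_ge0 ?ltW.
rewrite lef_pV2 ?posrE ?mulr_gt0 ?exprn_gt0// expr2 ler_wpM2r ?(ltW p2)// E lerDl ltW//.
Qed.

(** A product weight of total mass at most (4x)^d on Z^d: with x = 1 it concentrates at one lattice
    point, with x = N it counts the points of size about N. Decay of order 2d in |j| / x is enough
    to lie below it. *)
Definition lat (x : R) (j : Z) : R := \prod_(i < d) (1 + (absz (j 0 i))%:R / x) ^- 2.

Lemma lat_ge0 x j : 0 <= lat x j.
Proof. by apply: prodr_ge0 => i _; rewrite invr_ge0 sqr_ge0. Qed.

Lemma lat_le1 x j : 0 < x -> lat x j <= 1.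
Proof.
move=> x0; suff /andP[] : 0 <= lat x j <= 1 by [].
apply: (big_ind (fun z : R => 0 <= z <= 1)) => [|a b|i _].
- by rewrite ler01 lexx.
- by move=> /andP[a0 a1] /andP[b0 b1]; rewrite mulr_ge0// mulr_ile1.
- have h : 1 <= 1 + (absz (j 0 i))%:R / x by rewrite lerDl divr_ge0// ltW.
  rewrite invr_ge0 sqr_ge0/= invf_le1; first by rewrite exprn_ege1.
  by rewrite exprn_gt0// (lt_le_trans ltr01).
Qed.

Lemma absz_kR (j : Z) i : (absz (j 0 i))%:R = `|kR R j 0 i|.
Proof. by rewrite mxE -intr_norm -abszE. Qed.

Lemma lat_enorm x (j : Z) : 0 < x -> ((1 + enorm (kR R j) / x) ^+ (2 * d))^-1 <= lat x j.
Proof.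
move=> x0; rewrite exprM -exprVn -[d in _ ^+ d]card_ord -prodr_const.
apply: ler_prod => i _; rewrite invr_ge0 sqr_ge0/=.
have h : 0 < 1 + (absz (j 0 i))%:R / x by rewrite ltr_pwDl// divr_ge0// ltW.
have e0 : 0 <= enorm (kR R j) / x by rewrite divr_ge0 ?enorm_ge0// ltW.
rewrite lef_pV2 ?posrE ?exprn_gt0// ?ltr_pwDl//.
apply: lerXn2r; [by rewrite nnegrE ltW|by rewrite nnegrE addr_ge0|].
by rewrite lerD2l ler_pM2r ?invr_gt0// absz_kR coord_le_enorm.
Qed.

(* An integer is encoded as a pair (sign, absolute value), a box of integer
   vectors as a finite type of functions, so that the sum becomes a product. *)
Lemma lat_sum x (F : seq Z) : 1 <= x -> uniq F -> \sum_(j <- F) lat x j <= (4 * x) ^+ d.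
Proof.
move=> x1 uF; have x0 : 0 < x by exact: lt_le_trans x1.
pose B := \max_(j <- F) \max_(i < d) absz (j 0%R i).
have HB j i : j \in F -> (absz (j 0%R i) < B.+1)%N.
  move=> jF; rewrite ltnS (leq_trans (leq_bigmax (F := fun i => absz (j 0 i)) i))//.
  exact: (leq_bigmax_seq (F := fun j : Z => \max_(i < d) absz (j 0%R i))).
pose code (j : Z) : {ffun 'I_d -> bool * 'I_B.+1} := [ffun i => (j 0 i < 0, inord (absz (j 0 i)))].
pose g (f : {ffun 'I_d -> bool * 'I_B.+1}) : R := \prod_(i < d) (1 + (f i).2%:R / x) ^- 2.
have cE j : j \in F -> lat x j = g (code j).
  by move=> jF; apply: eq_bigr => i _; rewrite ffunE /= inordK// HB.
have cI : {in F &, injective code}.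
  move=> j k jF kF /ffunP H; apply/rowP => i; have := H i; rewrite !ffunE => -[s].
  move=> /(congr1 val); rewrite /= !inordK ?HB// => a.
  have sg (n : int) : n = (if n < 0 then - (absz n)%:Z else (absz n)%:Z).
    by case: ltP => h; [rewrite ltz0_abs// opprK|rewrite gez0_abs].
  by rewrite (sg (j 0 i)) (sg (k 0 i)) s a.
have -> : \sum_(j <- F) lat x j = \sum_(f <- map code F) g f.
  by rewrite big_map; apply: eq_big_seq => j jF; exact: cE.
have um : uniq (map code F) by rewrite map_inj_in_uniq.
have g0 f : 0 <= g f by apply: prodr_ge0 => i _; rewrite invr_ge0 sqr_ge0.
apply: (@le_trans _ _ (\sum_f g f)).
  rewrite big_uniq//= big_mkcond/=; apply: ler_sum => f _; by case: ifP.
rewrite /g -(bigA_distr_bigA (fun i (p : bool * 'I_B.+1) => (1 + p.2%:R / x) ^- 2)) /=.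
rewrite prodr_const card_ord; apply: lerXn2r; rewrite ?nnegrE.
- by apply: sumr_ge0 => p _; rewrite invr_ge0 sqr_ge0.
- by rewrite mulr_ge0// ltW.
(* Each coordinate contributes two signs, hence at most 2 (1 + x) <= 4 x. *)
rewrite -(pair_bigA _ (fun (b : bool) (m : 'I_B.+1) => (1 + m%:R / x) ^- 2))/=.
rewrite sumr_const card_bool; have := sum_sqr_inv B x1.
have : 0 <= x / (1 + B%:R / x) by rewrite divr_ge0 ?(ltW x0)// addr_ge0// divr_ge0// ltW.
rewrite mulr2n; lra.
Qed.

Lemma lat_sum_shift x (F : seq Z) k : 1 <= x -> uniq F ->
  \sum_(j <- F) lat x (j - k) <= (4 * x) ^+ d /\ \sum_(j <- F) lat x (k - j) <= (4 * x) ^+ d.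
Proof.
move=> x1 uF; split.
  rewrite -(big_map (fun j => j - k) xpredT (lat x)); apply: lat_sum => //.
  by rewrite map_inj_uniq//; exact: addIr.
rewrite -(big_map (fun j => k - j) xpredT (lat x)); apply: lat_sum => //.
by rewrite map_inj_uniq// => a b /addrI /oppr_inj.
Qed.
End LatticeSums.

Lemma powRD_gt0 (R : realType) (x r t : R) : 0 < x -> x `^ (r + t) = x `^ r * x `^ t.
Proof. by move=> x0; rewrite powRD// (gt_eqF x0) implybT. Qed.

(** * Japanese brackets and distances between block centres *)

Section Japanese.
Variables (R : realType) (d : nat).
Local Notation Z := ('rV[int]_d).
Implicit Types j k : Z.

Lemma sqr_jb j : jb R j ^+ 2 = 1 + dotR (kR R j) (kR R j).
Proof. by rewrite sqr_sqrtr// addr_ge0// dotR_ge0. Qed.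

Lemma kRB j k : kR R (j - k) = kR R j - kR R k.
Proof. by apply/rowP => i; rewrite !mxE rmorphB. Qed.

Lemma jb_le1D j : jb R j <= 1 + enorm (kR R j).
Proof.
rewrite -(@ler_pXn2r _ 2)// ?nnegrE ?addr_ge0 ?enorm_ge0// ?(ltW (jb_gt0 _ _))//.
by rewrite sqr_jb -sqr_enorm sqrrD expr1n mul1r lerD2r lerDl mulrn_wge0// enorm_ge0.
Qed.

Lemma jb_ge1 j : 1 <= jb R j.
Proof.
rewrite -(@ler_pXn2r _ 2)// ?nnegrE ?(ltW (jb_gt0 _ _))//.
by rewrite sqr_jb expr1n lerDl dotR_ge0.
Qed.

Lemma enorm_le_jb j : enorm (kR R j) <= jb R j.
Proof.
rewrite -(@ler_pXn2r _ 2)// ?nnegrE ?enorm_ge0// ?(ltW (jb_gt0 _ _))//.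
by rewrite sqr_jb sqr_enorm lerDr.
Qed.

Lemma jb_peetre j k : jb R j <= 2 * (1 + enorm (kR R (j - k))) * jb R k.
Proof.
have e0 := enorm_ge0 (kR R (j - k)); have k1 := jb_ge1 k.
apply: (le_trans (jb_le1D j)).
have : enorm (kR R j) <= enorm (kR R (j - k)) + enorm (kR R k).
  by rewrite kRB -{1}(subrK (kR R k) (kR R j)) enormD.
have := enorm_le_jb k; nra.
Qed.

Lemma enormB (V := 'rV[R]_d) (x y : V) : enorm (x - y) = enorm (y - x).
Proof. by rewrite -enormN opprB. Qed.

(** Peetre's inequality for an exponent of either sign; for E < 0 the roles of j and k are
    exchanged. The loss is rounded up to a natural power, to be absorbed by the kernel decay. *)
Lemma jb_powR_peetre (E : R) (n : nat) j k : `|E| <= n%:R ->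
  jb R j `^ E <= (2 * (1 + enorm (kR R (j - k)))) ^+ n * jb R k `^ E.
Proof.
move=> En; set w := 2 * (1 + enorm (kR R (j - k))).
have w1 : 1 <= w by have := enorm_ge0 (kR R (j - k)); rewrite /w; lra.
have w0 : 0 < w by exact: lt_le_trans w1.
have j0 := jb_gt0 R j; have k0 := jb_gt0 R k.
have w0' := ltW w0; have j0' := ltW j0; have k0' := ltW k0.
have pjk : jb R j <= w * jb R k by exact: jb_peetre.
have pkj : jb R k <= w * jb R j by have := jb_peetre k j; rewrite /w !kRB enormB.
have wn : w `^ `|E| <= w ^+ n by rewrite -powR_mulrn ?(ltW w0)// ler_powR.
apply: (@le_trans _ _ (w `^ `|E| * jb R k `^ E)); last by rewrite ler_wpM2r ?powR_ge0.
have [E0|E0] := leP 0 E.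
  rewrite (ger0_norm E0) -powRM//; apply: ge0_ler_powR => //; rewrite nnegrE//.
  by rewrite mulr_ge0.
have h : jb R k `^ (- E) <= w `^ (- E) * jb R j `^ (- E).
  have NE : 0 <= - E by rewrite oppr_ge0 ltW.
  rewrite -powRM//; apply: ge0_ler_powR => //; rewrite nnegrE//.
  by rewrite mulr_ge0.
move: h; rewrite !powRN => h.
have pj : 0 < jb R j `^ E by rewrite powR_gt0.
have pk : 0 < jb R k `^ E by rewrite powR_gt0.
have pw : 0 < w `^ E by rewrite powR_gt0.
move: pj pk pw h; rewrite (ltr0_norm E0) powRN.
move: (jb R j `^ E) (jb R k `^ E) (w `^ E) => J0 K0 W0 pj pk pw.
rewrite -invfM lef_pV2 ?posrE ?mulr_gt0// => h.
by rewrite mulrC ler_pdivlMr// mulrC.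
Qed.

(* The map x |-> <x>^a x is strongly monotone for a >= 0. *)
Lemma kcenter_dist (alpha : R) j k : 0 <= alpha / (1 - alpha) ->
  2^-1 * (rad alpha j + rad alpha k) * enorm (kR R (j - k)) <= enorm (kcenter alpha j - kcenter alpha k).
Proof.
move=> a0; rewrite kRB /kcenter -/(rad alpha j) -/(rad alpha k).
have rj := rad_gt0 alpha j; have rk := rad_gt0 alpha k.
set x := kR R j; set y := kR R k; set A := rad alpha j in rj *; set B := rad alpha k in rk *.
have mono : 0 <= (A - B) * (dotR x x - dotR y y).
  have mon (i l : Z) : dotR (kR R i) (kR R i) <= dotR (kR R l) (kR R l) -> rad alpha i <= rad alpha l.
    by move=> h; apply: ge0_ler_powR; rewrite ?nnegrE ?(ltW (jb_gt0 _ _))// ler_wsqrtr// lerD2l.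
  have [h|h] := leP (dotR x x) (dotR y y).
    by have := mon _ _ h; rewrite -/A -/B => ?; rewrite mulr_le0// subr_le0.
  by have := mon _ _ (ltW h); rewrite -/A -/B => ?; rewrite mulr_ge0// subr_ge0// ltW.
have [e0|en] := eqVneq (enorm (x - y)) 0; first by rewrite e0 mulr0 enorm_ge0.
have ep : 0 < enorm (x - y) by rewrite lt_neqAle eq_sym en enorm_ge0.
rewrite -(ler_pM2r ep); apply: le_trans (le_trans (ler_norm _) (cauchy_schwarz _ _)).
rewrite -[leLHS]mulrA -expr2 sqr_enorm dotR_sqrB !dotRDl !dotRDr !dotRNl !dotRNr !dotRZl (dotRC y x).
move: mono; lra.
Qed.
End Japanese.

Section UpperBound.
Variables (R : realType) (d : nat) (alpha s : R) (eta : 'rV[int]_d -> 'rV[R]_d -> R[i]).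
Local Notation T := (projT2 (RdT R d)).
Local Notation mu := (lebRd R d).
Local Notation V := ('rV[R]_d).
Local Notation rad := (rad alpha).
Hypotheses (adm : admissible alpha eta).

Lemma einv01 (p : \bar R) : (1 <= p)%E -> 0 <= einv p <= 1.
Proof.
case: p => [r|_|//] /=; last by rewrite lexx ler01.
rewrite lee_fin => r1; rewrite invr_ge0 (le_trans ler01 r1)/= invf_le1//.
exact: lt_le_trans r1.
Qed.

(** The block is at most Th r^d times an average [w] of translated [wdecay], with values in [0, 1]
    and integral at most (pi/r)^d, where r = rad j. The positions [y k] are arbitrary: the weights
    [B k] alone control the overlap, so packets can be moved apart at no cost in the modulation
    norm. *)
Lemma LpRd_boxop (I : eqType) (K : seq I) (c y : I -> V) (rho : R) (p : \bar R) j (B : I -> R) (Th : R) :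
  (1 <= p)%E -> 0 < rho -> 0 < Th -> (forall k, 0 <= B k) -> \sum_(k <- K) B k <= Th ->
  (forall k z, k \in K -> cabs (osc z (ebell eta j (c k) rho)) <= B k * rad j ^+ d * wdecay (rad j) z) ->
  (LpRd p (boxop eta j (fun x => (\sum_(k <- K) gatom (c k) (y k) rho x)%R)) <=
   (Th * pi ^+ d * rad j `^ (d%:R * (1 - einv p)))%:E)%E.
Proof.
move=> p1 rho0 Th0 B0 BTh H; have r0 := rad_gt0 alpha j; set r := rad j in r0 H *.
have /andP[e0 e1] := einv01 p1.
pose w (z : T) := Th^-1 * \sum_(k <- K) B k * wdecay r (vecRd z - y k).
have sw0 z : 0 <= \sum_(k <- K) B k * wdecay r (vecRd z - y k).
  by apply: sumr_ge0 => k _; rewrite mulr_ge0// wdecay_ge0.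
have pi1 : 1 <= pi :> R by rewrite (le_trans _ (pi_ge2 R))// ler1n.
have S0 : 0 < (pi / r) ^+ d by rewrite exprn_gt0// divr_gt0// pi_gt0.
apply: (@le_trans _ _ (Th * r ^+ d * ((pi / r) ^+ d) `^ einv p)%:E); last first.
  rewrite lee_fin.
  have -> : ((pi / r) ^+ d) `^ einv p = (pi ^+ d) `^ einv p * r `^ (- (d%:R * einv p)).
    rewrite expr_div_n powRM ?exprn_ge0 ?pi_ge0 ?invr_ge0 ?exprn_ge0 ?(ltW r0)//; congr (_ * _).
    by rewrite -powR_mulrn ?(ltW r0)// -powRN -powRrM mulNr.
  have rE : r ^+ d * r `^ (- (d%:R * einv p)) = r `^ (d%:R * (1 - einv p)).
    rewrite -powR_mulrn ?(ltW r0)// -powRD_gt0//; congr (_ `^ _); ring.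
  have pE : (pi ^+ d) `^ einv p <= pi ^+ d :> R.
    rewrite -[leRHS]powRr1 ?exprn_ge0 ?pi_ge0// ler_powR//; exact: exprn_ege1.
  rewrite [leLHS](_ : _ = Th * (pi ^+ d) `^ einv p * (r ^+ d * r `^ (- (d%:R * einv p)))); last by ring.
  by rewrite rE ler_wpM2r ?powR_ge0// ler_pM2l.
have mw : measurable_fun setT w.
  apply: measurable_funM => //; apply: measurable_sum => k.
  by apply: measurable_funM => //; exact: measurable_wdecay.
have wE (x : T) : Th * r ^+ d * w x = \sum_(k <- K) B k * r ^+ d * wdecay r (vecRd x - y k).
  rewrite /w mulrA (_ : Th * r ^+ d * Th^-1 = r ^+ d); last by field; rewrite gt_eqF.
  by rewrite mulr_sumr; apply: eq_bigr => k _; ring.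
apply: (Lnorm_le (w := w) p1 _ S0) => //.
- by rewrite mulr_ge0 ?(ltW Th0)// exprn_ge0// ltW.
- move=> x; rewrite cabs_ge0/= wE (boxop_sum_gatom adm)// cabsM cabs_real.
  have c1 : `|(2 * pi) ^- d| <= 1 :> R.
    have h : 1 <= (2 * pi) ^+ d :> R by rewrite exprn_ege1//; move: pi1; lra.
    by rewrite ger0_norm ?invr_ge0 ?(le_trans ler01)// invf_le1// (lt_le_trans ltr01).
  apply: (@le_trans _ _ (cabs (\sum_(k <- K) osc (vecRd x - y k) (ebell eta j (c k) rho)))).
    by rewrite ler_piMl// cabs_ge0.
  apply: (le_trans (cabs_sum _ _)).
  by rewrite big_seq [leRHS]big_seq; apply: ler_sum => k kK; exact: H.
- move=> x; rewrite /w mulr_ge0 ?invr_ge0 ?(ltW Th0)//= mulrC ler_pdivrMr// mul1r.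
  apply: le_trans BTh; apply: ler_sum => k _; by rewrite ler_piMr// wdecay_le1.
- have mB k : measurable_fun setT (fun x : T => (B k * wdecay r (vecRd x - y k))%:E).
    by apply/measurable_EFinP; apply: measurable_funM => //; exact: measurable_wdecay.
  have IB k : (\int[mu]_x (B k * wdecay r (vecRd x - y k))%:E = (B k * (pi / r) ^+ d)%:E)%E.
    under eq_integral do rewrite EFinM.
    rewrite ge0_integralZl//; last 3 first.
    - by apply/measurable_EFinP; exact: measurable_wdecay.
    - by move=> x _; rewrite lee_fin wdecay_ge0.
    - by rewrite lee_fin.
    by rewrite integral_wdecay.
  rewrite /w; under eq_integral do rewrite EFinM -sumEFin.
  rewrite ge0_integralZl//; last 3 first.
  - by apply: emeasurable_sum => k.
  - by move=> x _; apply: sume_ge0 => k _; rewrite lee_fin mulr_ge0// wdecay_ge0.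
  - by rewrite lee_fin invr_ge0 ltW.
  rewrite ge0_integral_sum//; last by move=> k x _; rewrite lee_fin mulr_ge0// wdecay_ge0.
  under eq_bigr do rewrite IB.
  rewrite sumEFin -EFinM lee_fin -mulr_suml mulrA ler_piMl ?(ltW S0)//.
  by rewrite mulrC ler_pdivrMr// mul1r.
Qed.
End UpperBound.

(** * Many narrow packets in one shell of frequencies *)

Section UpperMany.
Variables (R : realType) (d : nat) (alpha s : R) (eta : 'rV[int]_d -> 'rV[R]_d -> R[i]) (p q : \bar R).
Local Notation V := ('rV[R]_d).
Local Notation Z := ('rV[int]_d).
Local Notation rad := (rad alpha).
Hypotheses (adm : admissible alpha eta) (d_gt0 : (0 < d)%N) (a_ge0 : 0 <= alpha / (1 - alpha)).
Hypotheses (p1 : (1 <= p)%E) (q1 : (1 <= q)%E).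
Local Notation a := (alpha / (1 - alpha)).
Local Notation E := (s / (1 - alpha) + a * (d%:R * (1 - einv p))).

Lemma powR_comparable (x y c e : R) : 0 < x -> x <= y -> y <= c * x -> y `^ e <= c `^ `|e| * x `^ e.
Proof.
move=> x0 xy yc; have c1 : 1 <= c by rewrite -(ler_pM2r x0) mul1r (le_trans xy).
have c0 : 0 < c by exact: lt_le_trans c1.
have y0 : 0 < y by exact: lt_le_trans xy.
have [e0|e0] := leP 0 e.
  rewrite (ger0_norm e0) -powRM ?(ltW c0) ?(ltW x0)//.
  by apply: ge0_ler_powR; rewrite ?nnegrE ?mulr_ge0 ?(ltW c0) ?(ltW x0) ?(ltW y0).
apply: (@le_trans _ _ (x `^ e)); last first.
  rewrite ler_peMl ?powR_ge0// -(powRr0 c) ler_powR//.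
have ne : 0 <= - e by rewrite oppr_ge0 ltW.
have : x `^ (- e) <= y `^ (- e) by apply: ge0_ler_powR; rewrite ?nnegrE ?(ltW x0) ?(ltW y0).
by rewrite !powRN lef_pV2 ?posrE ?powR_gt0.
Qed.

Lemma weighted_LpRd j (Th : R) (u : V -> R[i]) :
  (LpRd p (boxop eta j u) <= (Th * pi ^+ d * rad j `^ (d%:R * (1 - einv p)))%:E)%E ->
  ((jb R j `^ (s / (1 - alpha)))%:E * LpRd p (boxop eta j u) <= (pi ^+ d * (Th * jb R j `^ E))%:E)%E.
Proof.
move=> H; apply: (le_trans (lee_wpmul2l _ H)); first by rewrite lee_fin powR_ge0.
rewrite -EFinM lee_fin /rad -powRrM powRD_gt0 ?jb_gt0//.
rewrite le_eqVlt; apply/orP; left; apply/eqP; ring.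
Qed.

Lemma shell_jb (N : nat) (k : Z) : (0 < N)%N -> (forall i, (N%:Z <= k 0 i) && (k 0 i < (2 * N)%N%:Z)) ->
  N%:R <= jb R k /\ jb R k <= (1 + 2 * d%:R) * N%:R.
Proof.
move=> N0 H; have N1 : 1 <= N%:R :> R by rewrite ler1n.
have ki i : N%:R <= kR R k 0 i /\ kR R k 0 i <= 2 * N%:R.
  rewrite mxE; have /andP[h1 h2] := H i; split.
    by rewrite -[N%:R]/((N%:Z)%:~R) ler_int.
  by rewrite -natrM -[(2 * N)%:R]/(((2 * N)%N%:Z)%:~R) ler_int ltW.
split.
  apply: le_trans (enorm_le_jb R k); apply: le_trans (coord_le_enorm _ (Ordinal d_gt0)).
  by apply: le_trans (ler_norm _); have [] := ki (Ordinal d_gt0).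
have d1 : 1 <= d%:R :> R by rewrite ler1n.
rewrite -(@ler_pXn2r _ 2)// ?nnegrE ?(ltW (jb_gt0 _ _))//.
rewrite sqr_jb.
have : dotR (kR R k) (kR R k) <= d%:R * (2 * N%:R) ^+ 2.
  rewrite -[d in d%:R]card_ord -sum1_card natr_sum mulr_suml; apply: ler_sum => i _.
  rewrite mul1r -expr2; have [k1 k2] := ki i; apply: lerXn2r => //; rewrite nnegrE.
    by apply: le_trans k1.
  by rewrite mulr_ge0.
rewrite exprMn !expr2 => h.
have NN : 1 <= N%:R * N%:R :> R by nra.
have dN : 0 <= d%:R * (N%:R * N%:R) :> R by rewrite !mulr_ge0.
have ddN : 0 <= d%:R * d%:R * (N%:R * N%:R) :> R by rewrite !mulr_ge0.
by move: h; lra.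
Qed.

(** Block j sees packet k with weight (1 + |j - k|)^(-Nn). The weighted norm at j is then at most a
    constant times N^E times the sum over k of [lat 1 (j - k)]; summation over j yields the number
    of packets, which enters with the power 1/q. *)
Lemma Mnorm_many : exists2 Kc : R, 0 < Kc &
  forall (N : nat) (K : seq Z) (y : Z -> V), (0 < N)%N -> uniq K -> (0 < size K)%N ->
  (forall k, k \in K -> forall i, (N%:Z <= k 0 i) && (k 0 i < (2 * N)%N%:Z)) ->
  (Mnorm alpha s eta p q (fun x => (\sum_(k <- K) gatom (kcenter alpha k) (y k) (N%:R `^ a) x)%R) <=
   (Kc * N%:R `^ E * (size K)%:R `^ einv q)%:E)%E.
Proof.
have half_le (x t z u v : R) : 0 <= t -> 0 <= z -> 2^-1 * (x + t) * z <= u -> u < 2 * v * x -> z * x <= 4 * v * x.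
  by move=> t0 z0; have := mulr_ge0 t0 z0; lra.
have [n0 Hn0] : exists n : nat, `|E| <= n%:R by exists (Num.bound `|E|); apply/ltW/archi_boundP.
(* n0 powers of decay pay for replacing <j>^E by <k>^E, the remaining 2d give the summable weight
   [lat]. *)
pose Nn := (n0 + 2 * d)%N.
have [C2 C20 HC2] := osc_box d_gt0 adm Nn.
pose c1 : R := 1 + 2 * d%:R; have c10 : 0 < c1 by rewrite ltr_pwDl// mulr_ge0.
(* Centres closer than 2 C2 rad j force |j - k| <= 4 C2, hence <j> <= 2 (1 + 4 C2) c1 N. *)
pose C3 := (2 * (1 + 4 * C2) * c1) `^ a.
have C30 : 0 < C3 by rewrite powR_gt0// !mulr_gt0// addr_gt0// mulr_gt0.
have [K0 K00 HK] := HC2 C3 C30.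
pose Kc := pi ^+ d * (K0 * 2 ^+ Nn * 2 ^+ n0 * c1 `^ `|E|) * 4 ^+ d.
have Kc0 : 0 < Kc.
  by rewrite !mulr_gt0 ?exprn_gt0 ?powR_gt0 ?pi_gt0.
exists Kc => // N K y N0 uK sK HKs; set rho := N%:R `^ a.
have Np : 0 < N%:R :> R by rewrite ltr0n.
have rho0 : 0 < rho by rewrite powR_gt0.
pose dst (j k : Z) : R := enorm (kR R (j - k)).
have dst0 j k : 0 <= dst j k by exact: enorm_ge0.
have d1 j k : 0 < 1 + dst j k by rewrite ltr_pwDl.
have four : (4 * 1 : R) ^+ d = 4 ^+ d by rewrite mulr1.
have f0 : 0 < (4 : R) ^+ d by rewrite exprn_gt0.
pose B j k := K0 * 2 ^+ Nn / (1 + dst j k) ^+ Nn.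
have B0 j k : 0 < B j k by rewrite !mulr_gt0 ?invr_gt0 ?exprn_gt0.
(* The factor 4^-d brings the sum over k into [0, 1], as [Mnorm_le] requires. *)
pose w (j : Z) := (4 ^+ d)^-1 * \sum_(k <- K) lat (1 : R) (j - k).
have w01 j : 0 <= w j <= 1.
  rewrite mulr_ge0 ?invr_ge0 ?(ltW f0)//=; last by apply: sumr_ge0 => k _; exact: lat_ge0.
  rewrite /w mulrC ler_pdivrMr// mul1r -four.
  by have [_] := lat_sum_shift j (lexx (1 : R)) uK.
apply: (Mnorm_le q1 (w := w)) => //.
- by rewrite mulr_ge0 ?powR_ge0// ltW.
- by rewrite ltr0n.
- move=> F uF; rewrite /w -mulr_sumr exchange_big/= mulrC ler_pdivrMr//.
  apply: (@le_trans _ _ (\sum_(k <- K) 4 ^+ d)).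
    apply: ler_sum => k _; rewrite -four.
    by have [] := lat_sum_shift k (lexx (1 : R)) uF.
  by rewrite big_const_seq count_predT iter_addr addr0 mulr_natl.
move=> j.
have BTh : 0 < \sum_(k <- K) B j k.
  case: K sK {uK HKs w w01} => // k0 K' _; rewrite big_cons ltr_pwDl// sumr_ge0// => k _.
  exact: ltW.
have H k z : k \in K -> cabs (osc z (ebell eta j (kcenter alpha k) rho)) <=
    B j k * rad j ^+ d * wdecay (rad j) z.
  move=> kK; have [jk1 jk2] := shell_jb N0 (HKs k kK).
  have r0 := rad_gt0 alpha j.
  have rk : rho <= rad k by apply: ge0_ler_powR; rewrite ?nnegrE ?(ltW (jb_gt0 _ _)).
  have rk0 := rad_gt0 alpha k.
  have dist := kcenter_dist j k a_ge0; rewrite -/(dst j k) in dist.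
  have cond : enorm (kcenter alpha j - kcenter alpha k) < 2 * C2 * rad j -> rad j <= C3 * rho.
    move=> hlt; have djk : dst j k <= 4 * C2.
      rewrite -(ler_pM2r r0); exact: half_le (ltW rk0) (dst0 j k) dist hlt.
    rewrite /C3 /rho -powRM ?(ltW Np)//; last by rewrite !mulr_ge0 ?(ltW c10)// addr_ge0// mulr_ge0// ltW.
    apply: ge0_ler_powR; rewrite ?nnegrE ?(ltW (jb_gt0 _ _))//.
      by rewrite !mulr_ge0 ?(ltW c10)// addr_ge0// mulr_ge0// ltW.
    apply: (le_trans (jb_peetre R j k)); rewrite -[leRHS]mulrA -/(dst j k).
    apply: ler_pM; rewrite ?(ltW (jb_gt0 _ _))//; first by rewrite mulr_ge0// ltW// d1.
    by rewrite ler_pM2l// lerD2l.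
  apply: (le_trans (HK j _ rho rho0 cond z)).
  rewrite ler_wpM2r ?wdecay_ge0// [leRHS](_ : _ = K0 * rad j ^+ d * (2 ^+ Nn / (1 + dst j k) ^+ Nn)); last by rewrite /B; ring.
  rewrite (ler_pM2l (mulr_gt0 K00 (exprn_gt0 d r0))).
  (* The centres are at least rad k |j - k| / 2 >= rho |j - k| / 2 apart; the lost factor 2 becomes
     2^Nn. *)
  have low : 2^-1 * (1 + dst j k) <= 1 + enorm (kcenter alpha j - kcenter alpha k) / rho.
    have : 2^-1 * dst j k <= enorm (kcenter alpha j - kcenter alpha k) / rho.
      rewrite ler_pdivlMr//; apply: le_trans dist.
      rewrite -[leLHS]mulrA -[leRHS]mulrA ler_pM2l; last by rewrite invr_gt0 ltr0n.
      rewrite [leLHS]mulrC; apply: ler_wpM2r; first exact: dst0.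
      by apply: (le_trans rk); rewrite lerDr; exact: ltW.
    by move=> h; rewrite mulrDr mulr1; apply: lerD h; rewrite invf_le1// ler1n.
  have lp : 0 < 2^-1 * (1 + dst j k) by rewrite mulr_gt0.
  rewrite -expr_div_n (_ : 2 / (1 + dst j k) = (2^-1 * (1 + dst j k))^-1); last by field; rewrite gt_eqF.
  rewrite exprVn lef_pV2 ?posrE ?exprn_gt0// ?(lt_le_trans lp low)//.
  by apply: lerXn2r => //; rewrite nnegrE ltW// (lt_le_trans lp low).
apply: (le_trans (weighted_LpRd (LpRd_boxop adm y p1 rho0 BTh (fun k => ltW (B0 j k)) (lexx _) H))).
rewrite lee_fin (_ : Kc * N%:R `^ E * w j = pi ^+ d * \sum_(k <- K)
   (K0 * 2 ^+ Nn * 2 ^+ n0 * c1 `^ `|E| * N%:R `^ E) * lat (1 : R) (j - k)); last first.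
  rewrite -mulr_sumr /Kc /w; field; by rewrite gt_eqF.
rewrite ler_pM2l ?exprn_gt0 ?pi_gt0// mulr_suml big_seq [leRHS]big_seq; apply: ler_sum => k kK.
have [jk1 jk2] := shell_jb N0 (HKs k kK).
have h1 := jb_powR_peetre j k Hn0; rewrite -/(dst j k) in h1.
have h2 := powR_comparable E Np jk1 jk2; rewrite -/c1 in h2.
have h3 := lat_enorm (j - k) (ltr01 : 0 < (1 : R)); rewrite divr1 -/(dst j k) in h3.
apply: (@le_trans _ _ (B j k * ((2 * (1 + dst j k)) ^+ n0 * (c1 `^ `|E| * N%:R `^ E)))).
  rewrite ler_pM2l//; apply: (le_trans h1); rewrite ler_wpM2l// exprn_ge0// mulr_ge0// ltW//.
have -> : B j k * ((2 * (1 + dst j k)) ^+ n0 * (c1 `^ `|E| * N%:R `^ E)) =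
   K0 * 2 ^+ Nn * 2 ^+ n0 * c1 `^ `|E| * N%:R `^ E * ((1 + dst j k) ^+ (2 * d))^-1.
  rewrite /B {2}/Nn exprD exprMn; field.
  by rewrite !expf_neq0// gt_eqF.
by rewrite ler_wpM2l// !mulr_ge0 ?exprn_ge0 ?powR_ge0// ltW.
Qed.
End UpperMany.

(** * One wide Gaussian at the origin *)

Section UpperOne.
Variables (R : realType) (d : nat) (alpha s : R) (eta : 'rV[int]_d -> 'rV[R]_d -> R[i]) (p q : \bar R).
Local Notation V := ('rV[R]_d).
Local Notation Z := ('rV[int]_d).
Local Notation rad := (rad alpha).
Hypotheses (adm : admissible alpha eta) (d_gt0 : (0 < d)%N) (a_ge0 : 0 <= alpha / (1 - alpha)).
Hypotheses (p1 : (1 <= p)%E) (q1 : (1 <= q)%E) (s_ge0 : 0 <= s / (1 - alpha)).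
Local Notation a := (alpha / (1 - alpha)).
Local Notation E := (s / (1 - alpha) + a * (d%:R * (1 - einv p))).

(** The centre of block j has size <j>^a |j|; in units of rho = N^(a+1) this is at least |j| / N
    once |j| > N. The blocks thus carry the weight [lat N], of total mass at most (4N)^d. As E >= 0,
    <j>^E <= N^E (1 + |j|/N)^n0 holds down to j = 0. *)
Lemma Mnorm_one : exists2 Kc : R, 0 < Kc & forall (N : nat), (0 < N)%N ->
  (Mnorm alpha s eta p q (fun x => (\sum_(k <- [:: tt]) gatom 0 0 (N%:R `^ (a + 1)) x)%R) <=
   (Kc * N%:R `^ (E + d%:R * einv q))%:E)%E.
Proof.
have /andP[e0 e1] := einv01 p1; have /andP[q0 q1'] := einv01 q1.
have E0 : 0 <= E by apply: addr_ge0 => //; apply: mulr_ge0 => //; apply: mulr_ge0 => //; rewrite subr_ge0.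
have [n0 Hn0] : exists n : nat, E <= n%:R.
  by exists (Num.bound E); apply/ltW/archi_boundP.
pose Nn := (n0 + 2 * d)%N.
have [C2 C20 HC2] := osc_box d_gt0 adm Nn.
(* Here closeness means |j| < 2 C2, so <j> is bounded, while rho >= 1. *)
pose C3 := (1 + 2 * C2) `^ a.
have C20' : 0 < 1 + 2 * C2 by rewrite addr_gt0// mulr_gt0.
have C30 : 0 < C3 by rewrite powR_gt0.
have [K0 K00 HK] := HC2 C3 C30.
pose Kc := pi ^+ d * (K0 * 2 ^+ Nn) * 4 ^+ d.
exists Kc; first by rewrite !mulr_gt0 ?exprn_gt0 ?pi_gt0.
move=> N N0; set rho := N%:R `^ (a + 1).
have N1 : 1 <= N%:R :> R by rewrite ler1n.
have Np : 0 < N%:R :> R by exact: lt_le_trans N1.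
have rho1 : 1 <= rho by rewrite -(powRr0 (N%:R : R)) ler_powR// addr_ge0.
have rho0 : 0 < rho by exact: lt_le_trans rho1.
pose nk (j : Z) : R := enorm (kR R j).
have nk0 j : 0 <= nk j by exact: enorm_ge0.
have g1 j : 0 < 1 + nk j / N%:R by rewrite ltr_pwDl// divr_ge0.
have S0 : 0 < (4 * N%:R : R) ^+ d by rewrite exprn_gt0// mulr_gt0.
apply: (@le_trans _ _ ((pi ^+ d * (K0 * 2 ^+ Nn) * N%:R `^ E) * ((4 * N%:R) ^+ d) `^ einv q)%:E); last first.
  rewrite lee_fin exprMn powRM ?exprn_ge0//.
  have f1 : (4 ^+ d) `^ einv q <= (4 : R) ^+ d.
    by rewrite -[leRHS]powRr1 ?exprn_ge0// ler_powR// exprn_ege1// ler1n.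
  have NE : (N%:R ^+ d) `^ einv q = N%:R `^ (d%:R * einv q) :> R by rewrite -powR_mulrn// -powRrM.
  rewrite NE (powRD_gt0 E (d%:R * einv q) Np) /Kc.
  rewrite [leLHS](_ : _ = pi ^+ d * (K0 * 2 ^+ Nn) * (N%:R `^ E * N%:R `^ (d%:R * einv q)) * (4 ^+ d) `^ einv q); last by ring.
  rewrite [leRHS](_ : _ = pi ^+ d * (K0 * 2 ^+ Nn) * (N%:R `^ E * N%:R `^ (d%:R * einv q)) * 4 ^+ d); last by ring.
  by rewrite ler_wpM2l// !mulr_ge0 ?exprn_ge0 ?powR_ge0 ?pi_ge0// ltW.
pose wl (j : Z) := lat (N%:R : R) j.
apply: (Mnorm_le q1 (w := wl)) => //.
- by rewrite !mulr_ge0 ?exprn_ge0 ?powR_ge0 ?pi_ge0// ltW.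
- by move=> j; rewrite lat_ge0 lat_le1.
- by move=> F uF; exact: lat_sum.
move=> j; rewrite /wl; pose B (_ : unit) := K0 * 2 ^+ Nn / (1 + nk j / N%:R) ^+ Nn.
have B0 u : 0 < B u by rewrite !mulr_gt0 ?invr_gt0 ?exprn_gt0.
have r0 := rad_gt0 alpha j.
have cE : enorm (kcenter alpha j - 0) = rad j * nk j.
  by rewrite subr0 /kcenter enormZ ger0_norm// powR_ge0.
have H (k : unit) z : k \in [:: tt] -> cabs (osc z (ebell eta j 0 rho)) <=
    B k * rad j ^+ d * wdecay (rad j) z.
  move=> _; have cond : enorm (kcenter alpha j - 0) < 2 * C2 * rad j -> rad j <= C3 * rho.
    rewrite cE mulrC ltr_pM2r// => hlt.
    apply: (@le_trans _ _ C3); last by rewrite ler_peMr// ltW.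
    apply: ge0_ler_powR; rewrite ?nnegrE ?(ltW (jb_gt0 _ _)) ?(ltW C20')//.
    by apply: (le_trans (jb_le1D R j)); rewrite lerD2l ltW.
  apply: (le_trans (HK j _ rho rho0 cond z)).
  rewrite ler_wpM2r ?wdecay_ge0// [leRHS](_ : _ = K0 * rad j ^+ d * (2 ^+ Nn / (1 + nk j / N%:R) ^+ Nn)); last by rewrite /B; ring.
  rewrite ler_pM2l ?mulr_gt0 ?exprn_gt0// cE.
  have low : 2^-1 * (1 + nk j / N%:R) <= 1 + rad j * nk j / rho.
    have nN0 : 0 <= nk j / N%:R by rewrite divr_ge0.
    have rn0 : 0 <= rad j * nk j / rho by rewrite !mulr_ge0 ?invr_ge0 ?(ltW r0) ?(ltW rho0).
    have [h|h] := leP (nk j) N%:R.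
      have : nk j / N%:R <= 1 by rewrite ler_pdivrMr// mul1r.
      lra.
    suff : nk j / N%:R <= rad j * nk j / rho by lra.
    have rN : N%:R `^ a <= rad j.
      apply: ge0_ler_powR; rewrite ?nnegrE ?(ltW (jb_gt0 _ _))//.
      exact: (le_trans (ltW h) (enorm_le_jb R j)).
    have rE : rho = N%:R `^ a * N%:R by rewrite /rho powRD_gt0// powRr1.
    have pN : 0 < N%:R `^ a :> R by rewrite powR_gt0.
    rewrite rE invfM mulrA ler_pM2r ?invr_gt0// ler_pdivlMr// mulrC ler_wpM2r//.
  have lp : 0 < 2^-1 * (1 + nk j / N%:R) by rewrite mulr_gt0.
  rewrite -expr_div_n (_ : 2 / (1 + nk j / N%:R) = (2^-1 * (1 + nk j / N%:R))^-1); last by rewrite invfM invrK.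
  rewrite exprVn lef_pV2 ?posrE ?exprn_gt0// ?(lt_le_trans lp low)//.
  by apply: lerXn2r => //; rewrite nnegrE ltW// (lt_le_trans lp low).
have sB : \sum_(k <- [:: tt]) B k <= B tt by rewrite big_seq1.
have W : ((jb R j `^ (s / (1 - alpha)))%:E *
    LpRd p (boxop eta j (fun x => (\sum_(k <- [:: tt]) gatom 0 0 rho x)%R)) <= (pi ^+ d * (B tt * jb R j `^ E))%:E)%E.
  apply: weighted_LpRd.
  exact: (LpRd_boxop adm (c := fun=> 0) (fun=> 0) p1 rho0 (B0 tt) (fun k => ltW (B0 k)) sB H).
apply: (le_trans W).
rewrite lee_fin [leRHS](_ : _ = pi ^+ d * (K0 * (2 ^+ Nn * (N%:R `^ E * lat (N%:R : R) j)))); last by ring.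
rewrite ler_pM2l ?exprn_gt0 ?pi_gt0//.
have h3 := lat_enorm j Np; rewrite -/(nk j) in h3.
have jE : jb R j `^ E <= N%:R `^ E * (1 + nk j / N%:R) ^+ n0.
  apply: (@le_trans _ _ ((N%:R * (1 + nk j / N%:R)) `^ E)).
    apply: ge0_ler_powR; rewrite ?nnegrE ?(ltW (jb_gt0 _ _))//; first by rewrite mulr_ge0// ltW.
    apply: (le_trans (jb_le1D R j)); rewrite mulrDr mulr1 mulrCA divff ?gt_eqF// mulr1.
    by rewrite -/(nk j) lerD2r.
  rewrite powRM ?(ltW (g1 _))// ler_wpM2l ?powR_ge0// -powR_mulrn ?(ltW (g1 _))// ler_powR//.
  by rewrite lerDl divr_ge0.
apply: (@le_trans _ _ (B tt * (N%:R `^ E * (1 + nk j / N%:R) ^+ n0))); first by rewrite ler_pM2l.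
have -> : B tt * (N%:R `^ E * (1 + nk j / N%:R) ^+ n0) =
   K0 * (2 ^+ Nn * (N%:R `^ E * ((1 + nk j / N%:R) ^+ (2 * d))^-1)).
  rewrite /B {2}/Nn exprD; field.
  by rewrite !expf_neq0// gt_eqF.
by rewrite !ler_pM2l ?exprn_gt0 ?powR_gt0.
Qed.
End UpperOne.

(** * Lower bounds for the space-time norm *)

Section Growth.
Variable R : realType.

(** If B < A, an integer N beyond (|C| + 1)^(1/(A-B)) violates the bound. *)
Lemma powR_growth (A B C : R) :
  (forall N : nat, (0 < N)%N -> N%:R `^ A <= C * N%:R `^ B) -> A <= B.
Proof.
move=> H; rewrite leNgt; apply/negP => BA.
have e0 : 0 < A - B by rewrite subr_gt0.
pose X := (`|C| + 1) `^ (A - B)^-1.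
have X0 : 0 <= X by exact: powR_ge0.
pose N := Num.bound X; have XN : X < N%:R by exact: archi_boundP.
have Np : 0 < N%:R :> R by exact: le_lt_trans XN.
have N0 : (0 < N)%N by move: Np; rewrite ltr0n.
have := H N N0; rewrite -{1}(subrK B A) powRD ?(gt_eqF Np) ?implybT// ler_pM2r ?powR_gt0// => h.
have : X `^ (A - B) <= N%:R `^ (A - B).
  by apply: ge0_ler_powR; rewrite ?nnegrE ?(ltW e0) ?(ltW XN) ?(ltW Np).
rewrite /X -powRrM mulVf ?gt_eqF// powRr1 ?addr_ge0// => h2.
have := ler_norm C; lra.
Qed.

Lemma bigsetU_seqP (T : Type) (I : eqType) (K : seq I) (B : I -> set T) x :
  (\big[setU/set0]_(k <- K) B k) x -> exists2 k, k \in K & B k x.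
Proof.
elim: K => [|k K IH]; first by rewrite big_nil.
rewrite big_cons => -[h|/IH[j jK Bj]]; first by exists k; rewrite ?inE ?eqxx.
by exists j; rewrite ?inE ?jK ?orbT.
Qed.

Lemma measure_bigU_seq (dp : measure_display) (T : measurableType dp)
    (mu : {measure set T -> \bar R}) (I : eqType) (K : seq I) (B : I -> set T) (m : R) :
  uniq K -> (forall k, measurable (B k)) -> (forall k, mu (B k) = m%:E) ->
  (forall j k, j \in K -> k \in K -> j != k -> B j `&` B k = set0) ->
  mu (\big[setU/set0]_(k <- K) B k) = ((size K)%:R * m)%:E.
Proof.
move=> + mB muB; elim: K => [|k K IH]; first by rewrite big_nil measure0 mul0r.
rewrite cons_uniq => /andP[kK uK] disj; rewrite big_cons measureU//; last 2 first.
- exact: bigsetU_measurable.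
- apply/seteqP; split => // x [Bk Bx]; have [j jK Bj] := bigsetU_seqP Bx.
  have kj : k != j by apply: contraNneq kK => ->.
  have : (B k `&` B j) x by split.
  by rewrite disj// inE ?eqxx// jK orbT.
apply: (@etrans _ _ (m%:E + ((size K)%:R * m)%:E)%E).
  congr (_ + _)%E; first exact: muB.
  by apply: IH => // i j iK jK; apply: disj; rewrite inE ?iK ?jK orbT.
by rewrite -EFinD -{1}[m]mul1r -mulrDl /= -natr1 [1 + _]addrC.
Qed.

(* [n] boxes of duration [tau * X^-g] and half-width [tau / X^b], against a wave of height [X^(bd)]. *)
Lemma box_volume_powR (d : nat) (X b g e tau n : R) : 0 < X -> 0 < tau -> 0 <= n ->
  (X `^ b) ^+ d * (n * (tau * X `^ (- g) * (2 * (tau / X `^ b)) ^+ d)) `^ e =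
  (tau * (2 * tau) ^+ d) `^ e * n `^ e * X `^ (b * (d%:R * (1 - e)) - g * e).
Proof.
move=> X0 t0 n0.
have D u v : X `^ (u + v) = X `^ u * X `^ v by rewrite powRD// (gt_eqF X0) implybT.
have rd : (X `^ b) ^+ d = X `^ (b * d%:R) by rewrite -powR_mulrn ?powR_ge0// -powRrM.
have -> : n * (tau * X `^ (- g) * (2 * (tau / X `^ b)) ^+ d) =
    n * ((tau * (2 * tau) ^+ d) * X `^ (- g - b * d%:R)).
  by rewrite D [X `^ (- (b * d%:R))]powRN -rd [2 * (tau / _)]mulrA expr_div_n; ring.
have c0 : 0 <= tau * (2 * tau) ^+ d by rewrite mulr_ge0 ?exprn_ge0 ?mulr_ge0 ?(ltW t0).
rewrite powRM//; last by rewrite mulr_ge0// powR_ge0.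
rewrite (powRM _ c0) ?powR_ge0// -powRrM rd.
rewrite (_ : b * (d%:R * (1 - e)) - g * e = b * d%:R + (- g - b * d%:R) * e); last by ring.
rewrite D; ring.
Qed.
End Growth.

Section Lower.
Variables (R : realType) (d : nat) (beta : R).
Hypothesis b02 : 0 < beta <= 2.
Local Notation V := ('rV[R]_d).
Let A : R := Num.sqrt (2 * pi) ^+ d / 2.

(** With phi the phase at c, what remains is (z + t v).(xi - c), v the group velocity, small on the
    tube, and t times the Taylor remainder, small as t <= tau. Both grow no faster than [osc_lower]
    allows. *)
Lemma phase_small (eps Q : R) : 0 < eps -> 0 <= Q ->
  exists2 tau, 0 < tau <= 1 & forall (c z : V) (rho t : R),
  0 < rho -> rho <= enorm c -> enorm c `^ beta * (rho / enorm c) ^+ 2 <= Q -> 0 <= t <= tau ->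
  (forall i, `|z 0 i + t * ((beta * enorm c `^ beta / enorm c ^+ 2) *: c) 0 i| <= tau / rho) ->
  exists phi, forall xi, `|dotR z xi + t * enorm xi `^ beta - phi| <=
    eps * (1 + dotR (xi - c) (xi - c) / rho ^+ 2) ^+ 2.
Proof.
(* d from the linear term, 33 Q from [phase_taylor], and 1 to keep D positive. *)
move=> eps0 Q0; pose D := d%:R + 33 * Q + 1.
have D0 : 0 < D by rewrite ltr_wpDl// addr_ge0// mulr_ge0.
exists (Num.min 1 (eps / D)); first by rewrite lt_min ltr01 divr_gt0// ge_min lexx.
set tau := Num.min _ _ => c z rho t rho0 rc HQ /andP[t0 tt]; set v := _ *: c => Hz.
have tau0 : 0 < tau by rewrite lt_min ltr01 divr_gt0.
have tD : tau * D <= eps by rewrite -ler_pdivlMr// ge_min lexx orbT.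
exists (dotR z c + t * enorm c `^ beta) => xi.
have PT := phase_taylor xi b02 rho0 rc HQ; rewrite -/v in PT.
set W := dotR (xi - c) (xi - c) in PT *.
have W0 : 0 <= W / rho ^+ 2 by rewrite divr_ge0 ?dotR_ge0 ?sqr_ge0.
pose u := rho^-1 *: (xi - c).
have zu : `|dotR (rho *: (z + t *: v)) u| <= tau * d%:R * (1 + dotR u u).
  apply: sum_coord_le; first exact: ltW.
  move=> i; rewrite !mxE normrM (gtr0_norm rho0) mulrC -ler_pdivlMr//.
  by have := Hz i; rewrite /v !mxE.
have uE : dotR u u = W / rho ^+ 2.
  by rewrite /u dotRZl dotRZr /W; field; rewrite gt_eqF.
have zE : dotR (rho *: (z + t *: v)) u = dotR z (xi - c) + t * dotR v (xi - c).
  by rewrite /u dotRZl dotRZr dotRDl dotRZl; field; rewrite gt_eqF.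
rewrite zE uE in zu.
have -> : dotR z xi + t * enorm xi `^ beta - (dotR z c + t * enorm c `^ beta) =
   (dotR z (xi - c) + t * dotR v (xi - c)) + t * (enorm xi `^ beta - enorm c `^ beta - dotR v (xi - c)).
  by rewrite !dotRDr !dotRNr; ring.
apply: (le_trans (ler_normD _ _)); rewrite normrM (ger0_norm t0).
set P := `|_ - _ - _| in PT *; move: W0 zu PT; set w := W / rho ^+ 2 => w0 zu PT.
have tP : t * P <= tau * (33 * Q * (1 + w) ^+ 2) by apply: ler_pM => //; exact: normr_ge0.
have ww : 1 + w <= (1 + w) ^+ 2 by rewrite expr2 ler_peMl ?addr_ge0// lerDl.
have zu' : tau * d%:R * (1 + w) <= tau * d%:R * (1 + w) ^+ 2 by rewrite ler_wpM2l// mulr_ge0// ltW.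
have : tau * D * (1 + w) ^+ 2 <= eps * (1 + w) ^+ 2 by rewrite ler_wpM2r// sqr_ge0.
have : 0 <= tau * (1 + w) ^+ 2 by rewrite mulr_ge0 ?sqr_ge0// ltW.
move: zu zu' tP; rewrite /D; move: ((1 + w) ^+ 2) => W2; lra.
Qed.

(** No expansion at the origin: with w = |xi|^2 / rho^2, t |xi|^beta <= t rho^beta (1 + w), because
    beta / 2 <= 1. *)
Lemma phase_small0 (eps : R) : 0 < eps ->
  exists2 tau, 0 < tau <= 1 & forall (z : V) (rho t : R), 0 < rho -> 0 <= t -> t * rho `^ beta <= tau ->
  (forall i, `|z 0 i| <= tau / rho) -> forall xi, `|dotR z xi + t * enorm xi `^ beta - 0| <=
    eps * (1 + dotR (xi - 0) (xi - 0) / rho ^+ 2) ^+ 2.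
Proof.
move=> eps0; pose D : R := d%:R + 1.
have D0 : 0 < D by rewrite ltr_wpDl.
exists (Num.min 1 (eps / D)); first by rewrite lt_min ltr01 divr_gt0// ge_min lexx.
set tau := Num.min _ _ => z rho t rho0 t0 tt Hz xi.
have tau0 : 0 < tau by rewrite lt_min ltr01 divr_gt0.
have tD : tau * D <= eps by rewrite -ler_pdivlMr// ge_min lexx orbT.
rewrite !subr0; set w := dotR xi xi / rho ^+ 2.
have w0 : 0 <= w by rewrite divr_ge0 ?dotR_ge0 ?sqr_ge0.
have zu : `|dotR (rho *: z) (rho^-1 *: xi)| <= tau * d%:R * (1 + dotR (rho^-1 *: xi) (rho^-1 *: xi)).
  apply: sum_coord_le; first exact: ltW.
  by move=> i; rewrite !mxE normrM (gtr0_norm rho0) mulrC -ler_pdivlMr.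
have zE : dotR (rho *: z) (rho^-1 *: xi) = dotR z xi by rewrite dotRZl dotRZr; field; rewrite gt_eqF.
have uE : dotR (rho^-1 *: xi) (rho^-1 *: xi) = w by rewrite dotRZl dotRZr /w; field; rewrite gt_eqF.
rewrite zE uE in zu.
have tw : t * enorm xi `^ beta <= tau * (1 + w).
  rewrite enorm_powR (_ : dotR xi xi = rho ^+ 2 * w); last by rewrite /w; field; rewrite gt_eqF.
  have rb : (rho ^+ 2) `^ (beta / 2) = rho `^ beta.
    by rewrite -powR_mulrn ?(ltW rho0)// -powRrM mulrC divfK.
  rewrite powRM ?sqr_ge0// rb mulrA; apply: ler_pM => //; rewrite ?powR_ge0 ?mulr_ge0 ?powR_ge0//.
  have /andP[b0 b2] := b02.
  apply: (@le_trans _ _ ((1 + w) `^ (beta / 2))).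
    by apply: ge0_ler_powR; [lra|rewrite nnegrE|rewrite nnegrE addr_ge0|lra].
  by rewrite -[leRHS]powRr1 ?addr_ge0// ler_powR ?lerDl// ler_pdivrMr// mul1r.
apply: (le_trans (ler_normD _ _)); rewrite (ger0_norm (mulr_ge0 t0 (powR_ge0 _ _))).
have ww : 1 + w <= (1 + w) ^+ 2 by rewrite expr2 ler_peMl ?addr_ge0// lerDl.
have : tau * D * (1 + w) <= eps * (1 + w) ^+ 2.
  apply: (@le_trans _ _ (eps * (1 + w))); first by rewrite ler_wpM2r// addr_ge0.
  by rewrite ler_pM2l.
move: zu tw; rewrite /D; lra.
Qed.
End Lower.

(** * Superposition of separated packets *)

Section LowerBound.
Variables (R : realType) (d : nat) (beta : R) (p : \bar R).
Hypotheses (b02 : 0 < beta <= 2) (p1 : (1 <= p)%E).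
Local Notation V := ('rV[R]_d).
Local Notation Z := ('rV[int]_d).
Local Notation A := (Num.sqrt (2 * pi) ^+ d / 2 : R).

(** On its own tube each packet has height A rho^d, while the others together reach at most half of
    it. The modulus of the sum is therefore at least half the height on the union of the tubes,
    whose measures add up. *)
Lemma LpIRd_lower (I : eqType) (K : seq I) (c y v : I -> V) (rho tau delta : R) :
  uniq K -> (0 < size K)%N -> 0 < rho -> 0 < tau <= 1 -> 0 < delta ->
  (forall k t (z : V), k \in K -> 0 <= t <= tau -> (forall i, `|z 0 i + t * v k 0 i| <= delta) ->
     A * rho ^+ d <= cabs (osc z (pbell beta t (c k) rho))) ->
  (forall k j z, k \in K -> j \in K -> j != k -> mbox tau delta (y k) (v k) z ->
     cabs (osc (vecRd z.2 - y j) (pbell beta z.1 (c j) rho)) <= A * rho ^+ d / (2 * (size K)%:R)) ->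
  (((2 * pi) ^- d * (A / 2) * rho ^+ d * ((size K)%:R * (tau * (2 * delta) ^+ d)) `^ einv p)%:E <=
   LpIRd p (fun t => Sbeta beta t (fun x => (\sum_(k <- K) gatom (c k) (y k) rho x)%R)))%E.
Proof.
move=> uK sK rho0 /andP[tau0 tau1] delta0 main tail.
set n : R := (size K)%:R; have n1 : 1 <= n by rewrite ler1n.
have n0 : 0 < n by exact: lt_le_trans n1.
have pi2 : 0 < 2 * pi :> R by rewrite mulr_gt0// pi_gt0.
have A0 : 0 < A * rho ^+ d by rewrite mulr_gt0 ?exprn_gt0// divr_gt0// exprn_gt0// sqrtr_gt0.
have Z0 : 0 < (2 * pi) ^- d :> R by rewrite invr_gt0 exprn_gt0.
have boxmain k z : k \in K -> mbox tau delta (y k) (v k) z ->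
    A * rho ^+ d <= cabs (osc (vecRd z.2 - y k) (pbell beta z.1 (c k) rho)).
  by move=> kK [zt zb]; apply: main.
pose B := \big[setU/set0]_(k <- K) mbox tau delta (y k) (v k).
pose f (z : projT2 (RdT R d.+1)) : R := if 0 <= z.1 <= 1 then
  cabs (Sbeta beta z.1 (fun x => \sum_(k <- K) gatom (c k) (y k) rho x) (vecRd z.2)) else 0.
have m0 : 0 < tau * (2 * delta) ^+ d by rewrite mulr_gt0 ?exprn_gt0 ?mulr_gt0.
have muB : lebRd R d.+1 B = (n * (tau * (2 * delta) ^+ d))%:E.
  apply: measure_bigU_seq => //.
  - by move=> k; exact: measurable_mbox.
  - by move=> k; rewrite measure_mbox// ltW.
  (* At a common point of two tubes one packet would be both at least A rho^d and at most A rho^d /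
     (2 n). *)
  - move=> j k jK kK jk; apply/seteqP; split => // z [zj zk].
    have kj : k != j by rewrite eq_sym.
    have h1 := boxmain _ _ kK zk; have h2 := tail _ _ _ jK kK kj zj.
    have : A * rho ^+ d <= A * rho ^+ d / (2 * n) by exact: le_trans h2.
    rewrite ler_pdivlMr ?mulr_gt0// ger_pMr//; lra.
have fB z : B z -> (2 * pi) ^- d * (A / 2) * rho ^+ d <= `|f z|.
  move=> Bz; have [k kK zk] := bigsetU_seqP Bz.
  have /andP[z0 zt] : 0 <= z.1 <= tau by case: zk.
  rewrite /f z0 (le_trans zt tau1)/= ger0_norm ?cabs_ge0// Sbeta_sum_gatom// cabsM cabs_real (gtr0_norm Z0).
  rewrite -!mulrA ler_pM2l// (bigD1_seq k)//=.
  set F := osc _ _; set S := \sum_(_ <- _ | _) _.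
  have hF : A * rho ^+ d <= cabs F by exact: boxmain.
  have hS : cabs S <= A * rho ^+ d / 2.
    rewrite /S -big_filter; apply: (le_trans (cabs_sum _ _)); rewrite big_filter /=.
    apply: (@le_trans _ _ (\sum_(j <- K) A * rho ^+ d / (2 * n))).
      rewrite big_mkcond big_seq [leRHS]big_seq; apply: ler_sum => j jK.
      case: ifP => jk; first by apply: tail jk zk.
      by rewrite divr_ge0 ?(ltW A0)// mulr_ge0// ltW.
    rewrite big_const_seq count_predT iter_addr addr0 -mulr_natl -/n.
    by rewrite le_eqVlt; apply/orP; left; apply/eqP; field; rewrite gt_eqF.
  have : cabs F <= cabs (F + S) + cabs S.
    by have := cabsD (F + S) (- S); rewrite addrK cabsN.
  move: hF hS; rewrite -/n; lra.
have -> : LpIRd p (fun t => Sbeta beta t (fun x => (\sum_(k <- K) gatom (c k) (y k) rho x)%R)) =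
    Lnorm (lebRd R d.+1) p (fun z => (f z)%:E).
  by rewrite /LpIRd; congr (Lnorm _ _ _); apply/funext => z; rewrite /f; case: ifP.
apply: (@Lnorm_ge R _ _ (lebRd R d.+1) p f B) => //.
- by rewrite !mulr_gt0 ?exprn_gt0 ?invr_gt0 ?exprn_gt0// ?sqrtr_gt0.
- exact: mulr_gt0.
- by apply: bigsetU_measurable => k _; exact: measurable_mbox.
- by rewrite muB.
Qed.

(** Positions y_k = L k: distinct integer vectors differ by at least 1 in some coordinate. L adds up
    all tail radii, the half-width of the tubes and the largest displacement within time 1. *)
Lemma separated_tail (K : seq Z) (c v : Z -> V) (rho tau delta eps : R) :
  0 < rho -> 0 < eps -> tau <= 1 -> 0 <= delta ->
  exists y : Z -> V, forall k j z, k \in K -> j \in K -> j != k -> mbox tau delta (y k) (v k) z ->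
    cabs (osc (vecRd z.2 - y j) (pbell beta z.1 (c j) rho)) <= eps.
Proof.
move=> rho0 eps0 tau1 delta0.
have /choice[Zf HZ] : forall j : Z, exists Zj : R, 0 < Zj /\ forall t (z : V), 0 <= t <= 1 ->
    (exists i, Zj <= `|z 0 i|) -> cabs (osc z (pbell beta t (c j) rho)) <= eps.
  by move=> j; have [Zj Zj0 H] := osc_tail b02 (c j) rho0 eps0; exists Zj; split.
pose ZZ := \sum_(j <- K) Zf j; pose W := \sum_(k <- K) enorm (v k).
have leZ j : j \in K -> Zf j <= ZZ.
  move=> jK; rewrite /ZZ (big_rem j)//= lerDl; apply: sumr_ge0 => i _; apply: ltW.
  by case: (HZ i).
have leW j : j \in K -> enorm (v j) <= W.
  by move=> jK; rewrite /W (big_rem j)//= lerDl; apply: sumr_ge0 => i _; exact: enorm_ge0.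
pose L := ZZ + delta + W; exists (fun k => L *: kR R k) => k j z kK jK jk [/andP[z0 zt] zb].
case: (HZ j) => _; apply; first by rewrite z0 (le_trans zt).
have [i ji] : exists i, j 0 i != k 0 i.
  apply/existsP; apply: contraNT jk; rewrite negb_exists => /forallP H.
  by apply/eqP/rowP => i; have := H i; rewrite negbK => /eqP.
exists i; have := zb i; rewrite !mxE => zi.
have vi : `|v k 0 i| <= W by exact: le_trans (coord_le_enorm _ _) (leW k kK).
have tv : `|z.1 * v k 0 i| <= W.
  by rewrite normrM (ger0_norm z0) (le_trans _ vi)// ler_piMl// (le_trans zt).
have L0 : 0 <= L.
  rewrite !addr_ge0//; apply: sumr_ge0 => l _; last exact: enorm_ge0.
  by apply: ltW; case: (HZ l).
have Lji : L <= `|L * (j 0 i)%:~R - L * (k 0 i)%:~R|.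
  rewrite -mulrBr normrM (ger0_norm L0) ler_peMr// -rmorphB/= -intr_norm.
  by rewrite -[1]/(1%:~R) ler_int -gtz0_ge1 normr_gt0 subr_eq0.
have := leZ j jK; move: zi tv Lji; rewrite /L.
set X := coordRd _ _ ; set a1 := _ * _%:~R; set a2 := _ * _%:~R; set vv := _ * v k 0 i => h1 h2 h3 h4.
have := ler_normD (X - a1 + vv) (- vv); rewrite normrN addrK.
have := ler_normD (X - a1) (- (X - a2)); rewrite normrN opprB (_ : X - a1 + (a2 - X) = a2 - a1); last by ring.
lra.
Qed.

(** Here the choice alpha = 1 - beta / 2 enters: (a + 1) (2 - beta) = 2a, so rho^2 = (N^(a+1))^(2 -
    beta) <= |c|^(2 - beta), and the second-order part of the phase is bounded uniformly in N. *)
Lemma shell_kcenter (N : nat) (k : Z) : (0 < d)%N -> (0 < N)%N ->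
  (forall i, (N%:Z <= k 0 i) && (k 0 i < (2 * N)%N%:Z)) ->
  let alpha := 1 - beta / 2 in let c := kcenter alpha k in let rho := N%:R `^ (alpha / (1 - alpha)) in
  rho <= enorm c /\ enorm c `^ beta * (rho / enorm c) ^+ 2 <= 1.
Proof.
move=> d0 N0 Hk alpha c rho; have /andP[be0 be2] := b02.
have aE : alpha / (1 - alpha) = 2 / beta - 1.
  by rewrite /alpha (_ : 1 - (1 - beta / 2) = beta / 2); [field; rewrite gt_eqF | ring].
have a0 : 0 <= alpha / (1 - alpha) by rewrite aE subr_ge0 ler_pdivlMr// mul1r.
rewrite /rho /c /kcenter; move: a0 aE; set a := alpha / _ => a0 aE.
have N1 : 1 <= N%:R :> R by rewrite ler1n.
have Np : 0 < N%:R :> R by exact: lt_le_trans N1.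
have Nk : N%:R <= enorm (kR R k).
  apply: le_trans (coord_le_enorm _ (Ordinal d0)); apply: le_trans (ler_norm _).
  by rewrite mxE -[N%:R]/((N%:Z)%:~R) ler_int; have /andP[] := Hk (Ordinal d0).
have Nj : N%:R <= jb R k.
  apply: (le_trans Nk); rewrite /enorm /jb ler_wsqrtr// lerDr//.
rewrite enormZ (ger0_norm (powR_ge0 _ _)).
have pN : 0 < N%:R `^ a :> R by rewrite powR_gt0.
have j0 : 0 <= jb R k by exact: sqrtr_ge0.
have Nja : N%:R `^ a <= jb R k `^ a by apply: ge0_ler_powR; rewrite ?nnegrE.
have NM : N%:R `^ a * N%:R <= jb R k `^ a * enorm (kR R k) by apply: ler_pM; rewrite ?powR_ge0.
move: NM; set M := _ * enorm _ => NM.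
have rN : N%:R `^ a <= N%:R `^ a * N%:R :> R by rewrite ler_peMr// ltW.
have rM : N%:R `^ a <= M by exact: le_trans NM.
have M0 : 0 < M by exact: lt_le_trans rM.
split=> //; rewrite expr_div_n mulrA ler_pdivrMr ?exprn_gt0// mul1r.
have ME : M ^+ 2 = M `^ beta * M `^ (2 - beta).
  rewrite -powRD ?(gt_eqF M0) ?implybT// (_ : beta + (2 - beta) = 2%:R) ?powR_mulrn ?ltW//; ring.
rewrite ME ler_pM2l ?powR_gt0//.
have NE : (N%:R `^ a) ^+ 2 = (N%:R `^ a * N%:R) `^ (2 - beta) :> R.
  rewrite -powR_mulrn ?powR_ge0// -powRrM.
  have -> : N%:R `^ a * N%:R = N%:R `^ (a + 1) :> R by rewrite powRD ?(gt_eqF Np) ?implybT// powRr1.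
  rewrite -powRrM.
  by congr (_ `^ _); rewrite aE; field; rewrite gt_eqF.
rewrite NE; apply: ge0_ler_powR; rewrite ?nnegrE ?subr_ge0 ?mulr_ge0 ?powR_ge0 ?enorm_ge0//.
Qed.
End LowerBound.

(** * Necessary conditions *)

Lemma Mnorm_ge0 (R : realType) (d : nat) (alpha s : R) (eta : 'rV[int]_d -> 'rV[R]_d -> R[i])
  (p q : \bar R) (u : 'rV[R]_d -> R[i]) : (0 <= Mnorm alpha s eta p q u)%E.
Proof.
case: q => [r||] /=; first exact: poweR_ge0.
all: apply: (@le_trans _ _ ((jb R (0 : 'rV[int]_d) `^ (s / (1 - alpha)))%:E * LpRd p (boxop eta 0 u))%E);
  [by rewrite mule_ge0 ?lee_fin ?powR_ge0 ?Lnorm_ge0 | by apply: ereal_sup_ubound; exists 0].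
Qed.

Section Necessity.
Variables (R : realType) (d : nat) (beta s : R) (p q : \bar R) (eta : 'rV[int]_d -> 'rV[R]_d -> R[i]) (C : R).
Local Notation alpha := (1 - beta / 2).
Local Notation a := (alpha / (1 - alpha)).
Local Notation Z := ('rV[int]_d).
Local Notation V := ('rV[R]_d).
Local Notation A := (Num.sqrt (2 * pi) ^+ d / 2 : R).
Hypotheses (d0 : (0 < d)%N) (b02 : 0 < beta <= 2) (p1 : (1 <= p)%E) (q1 : (1 <= q)%E).
Hypothesis adm : admissible alpha eta.
Hypothesis HC : forall u : V -> R[i], cschwartz u ->
  (LpIRd p (fun t => Sbeta beta t u) <= C%:E * Mnorm alpha s eta p q u)%E.

Lemma alphaE : a = 2 / beta - 1.
Proof.
have /andP[be0 _] := b02.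
by rewrite (_ : 1 - (1 - beta / 2) = beta / 2); [field; rewrite gt_eqF | ring].
Qed.

Lemma a_ge0 : 0 <= a.
Proof. by have /andP[be0 be2] := b02; rewrite alphaE subr_ge0 ler_pdivlMr// mul1r. Qed.

(** [C] has no prescribed sign; |C| allows multiplication by an upper bound of the modulation
    norm. *)
Lemma test_ineq (u : V -> R[i]) (x y : R) : cschwartz u ->
  (x%:E <= LpIRd p (fun t => Sbeta beta t u))%E -> (Mnorm alpha s eta p q u <= y%:E)%E ->
  x <= `|C| * y.
Proof.
move=> su lo hi; rewrite -lee_fin; apply: (le_trans lo); apply: (le_trans (HC su)); rewrite EFinM.
apply: (@le_trans _ _ (`|C|%:E * Mnorm alpha s eta p q u)%E).
  by rewrite lee_wpmul2r ?Mnorm_ge0// lee_fin ler_norm.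
by rewrite lee_wpmul2l// lee_fin.
Qed.

Let A0 : 0 < A.
Proof. by rewrite divr_gt0// exprn_gt0// sqrtr_gt0 mulr_gt0// pi_gt0. Qed.

Let Z0 : 0 < (2 * pi) ^- d * (A / 2) :> R.
Proof.
apply: mulr_gt0; last by apply: divr_gt0 => //; exact: A0.
by rewrite invr_gt0 exprn_gt0// mulr_gt0// pi_gt0.
Qed.

(** Both sides contain N^(a d (1 - 1/p)), from the tube volume below and from the block norms above.
    After cancellation only the weight N^(2s/beta) and powers of the number of packets remain. *)
Lemma lattice_test : exists C' : R, forall (N : nat) (K : seq Z), (0 < N)%N -> uniq K -> (0 < size K)%N ->
  (forall k, k \in K -> forall i, (N%:Z <= k 0 i) && (k 0 i < (2 * N)%N%:Z)) ->
  (size K)%:R `^ einv p <= C' * (N%:R `^ (s / (1 - alpha)) * (size K)%:R `^ einv q).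
Proof.
have [eps eps0 osclow] := @osc_lower R d beta.
have [tau /andP[tau0 tau1] Htau] := @phase_small R d beta b02 eps 1 eps0 ler01.
have [Kc Kc0 HM] := @Mnorm_many R d alpha s eta p q adm d0 a_ge0 p1 q1.
pose c0 := (2 * pi) ^- d * (A / 2) * (tau * (2 * tau) ^+ d) `^ einv p.
have c00 : 0 < c0 by rewrite (mulr_gt0 Z0)// powR_gt0// mulr_gt0// exprn_gt0// mulr_gt0.
exists (`|C| * Kc / c0) => N K N0 uK sK shell.
have Np : 0 < N%:R :> R by rewrite ltr0n.
have n0 : 0 < (size K)%:R :> R by rewrite ltr0n.
pose rho : R := N%:R `^ a; have rho0 : 0 < rho by rewrite powR_gt0.
have delta0 : 0 < tau / rho by rewrite divr_gt0.
pose v k : V := (beta * enorm (kcenter alpha k) `^ beta / enorm (kcenter alpha k) ^+ 2) *: kcenter alpha k.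
have main k t (z : V) : k \in K -> 0 <= t <= tau -> (forall i, `|z 0 i + t * v k 0 i| <= tau / rho) ->
    A * rho ^+ d <= cabs (osc z (pbell beta t (kcenter alpha k) rho)).
  move=> kK tt Hz; have [rc HQ] := shell_kcenter b02 d0 N0 (shell k kK).
  have [phi Hphi] := Htau _ z rho t rho0 rc HQ tt Hz.
  exact: osclow rho0 Hphi.
have eps1 : 0 < A * rho ^+ d / (2 * (size K)%:R).
  by apply: divr_gt0; [apply: mulr_gt0 => //; exact: exprn_gt0 | exact: mulr_gt0].
have [y Hy] := separated_tail b02 K (kcenter alpha) v rho0 eps1 tau1 (ltW delta0).
have tau01 : 0 < tau <= 1 by rewrite tau0.
have lo := LpIRd_lower p1 uK sK rho0 tau01 delta0 main Hy.
have := test_ineq (cschwartz_sum_gatom K (kcenter alpha) y rho0) lo (HM N K y N0 uK sK shell).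
have := box_volume_powR d a 0 (einv p) Np tau0 (ltW n0).
rewrite oppr0 powRr0 mulr1 mul0r subr0 -/rho (powRD_gt0 _ _ Np) => BV.
rewrite -[leLHS]mulrA BV; set G := N%:R `^ (a * _).
have G0 : 0 < G by rewrite powR_gt0.
move=> h; rewrite mulrAC ler_pdivlMr// -(ler_pM2r G0).
rewrite [leLHS](_ : _ = (2 * pi) ^- d * (A / 2) * ((tau * (2 * tau) ^+ d) `^ einv p * (size K)%:R `^ einv p * G)); last by rewrite /c0; ring.
apply: (le_trans h); rewrite le_eqVlt; apply/orP; left; apply/eqP; ring.
Qed.

(** The index list [[:: tt]] presents the single Gaussian as a sum of one term, so that the lemmas
    on sums apply; the condition on the other packets is then void. *)
Lemma focus_test : 0 <= s / (1 - alpha) -> exists C' : R, forall N : nat, (0 < N)%N ->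
  N%:R `^ ((a + 1) * (d%:R * (1 - einv p)) - 2 * einv p) <=
  C' * N%:R `^ (s / (1 - alpha) + a * (d%:R * (1 - einv p)) + d%:R * einv q).
Proof.
move=> s0; have /andP[be0 be2] := b02.
have [eps eps0 osclow] := @osc_lower R d beta.
have [tau /andP[tau0 tau1] Htau] := @phase_small0 R d beta b02 eps eps0.
have [Kc Kc0 HM] := @Mnorm_one R d alpha s eta p q adm d0 a_ge0 p1 q1 s0.
pose c0 := (2 * pi) ^- d * (A / 2) * (tau * (2 * tau) ^+ d) `^ einv p.
have c00 : 0 < c0 by rewrite (mulr_gt0 Z0)// powR_gt0// mulr_gt0// exprn_gt0// mulr_gt0.
exists (`|C| * Kc / c0) => N N0.
have N1 : 1 <= N%:R :> R by rewrite ler1n.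
have Np : 0 < N%:R :> R by exact: lt_le_trans N1.
pose rho : R := N%:R `^ (a + 1); have rho0 : 0 < rho by rewrite powR_gt0.
have delta0 : 0 < tau / rho by rewrite divr_gt0.
have N2 : 0 < N%:R `^ (- 2) :> R by rewrite powR_gt0.
have N21 : N%:R `^ (- 2) <= 1 :> R by apply: (@le_trans _ _ (N%:R `^ 0)); [rewrite ler_powR// oppr_le0 | rewrite powRr0].
have tau01 : 0 < tau * N%:R `^ (- 2) <= 1.
  by rewrite mulr_gt0//= (le_trans _ tau1)// ler_piMr// ltW.
(* beta (a + 1) = 2, which makes N^(-2) the lifetime of the focus. *)
have rb : rho `^ beta = N%:R `^ 2.
  by rewrite /rho -powRrM alphaE; congr (_ `^ _); field; rewrite gt_eqF.
pose z0 (_ : unit) : V := 0.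
have main k t (z : V) : k \in [:: tt] -> 0 <= t <= tau * N%:R `^ (- 2) ->
    (forall i, `|z 0 i + t * z0 k 0 i| <= tau / rho) ->
    A * rho ^+ d <= cabs (osc z (pbell beta t (z0 k) rho)).
  move=> _ /andP[t0 tt] Hz; apply: (osclow rho t 0 0 z rho0); apply: Htau => //.
    rewrite rb; apply: (@le_trans _ _ (tau * N%:R `^ (- 2) * N%:R `^ 2)); first by rewrite ler_wpM2r ?powR_ge0.
    by rewrite -mulrA -powRD_gt0// addNr powRr0 mulr1.
  by move=> i; have := Hz i; rewrite mxE mulr0 addr0.
have tail (k j : unit) z : k \in [:: tt] -> j \in [:: tt] -> j != k ->
    mbox (tau * N%:R `^ (- 2)) (tau / rho) (z0 k) (z0 k) z ->
    cabs (osc (vecRd z.2 - z0 j) (pbell beta z.1 (z0 j) rho)) <= A * rho ^+ d / (2 * (size [:: tt])%:R).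
  by case: k; case: j; rewrite eqxx.
have lo := LpIRd_lower p1 (isT : uniq [:: tt]) (isT : (0 < size [:: tt])%N) rho0 tau01 delta0 main tail.
have := test_ineq (cschwartz_sum_gatom [:: tt] z0 z0 rho0) lo (HM N N0).
have := box_volume_powR d (a + 1) 2 (einv p) Np tau0 (ler01 : 0 <= (1 : R)).
rewrite powR1 mulr1 -/rho [size _]/= => BV.
rewrite -[leLHS]mulrA BV => h; rewrite mulrAC ler_pdivlMr//.
rewrite [leLHS]mulrC /c0 -[leLHS]mulrA; apply: (le_trans h).
by rewrite -[leRHS]mulrA.
Qed.

Lemma necessity_s_ge0 : 0 <= s / (1 - alpha).
Proof.
have [C' H] := lattice_test; apply: (@powR_growth R _ _ C') => N N0.
pose k : Z := \row_i N%:Z.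
have := H N [:: k] N0 isT isT; rewrite powRr0 !powR1 mulr1; apply => j.
by rewrite inE => /eqP-> i; rewrite mxE lexx /= ltz_nat mul2n -addnn -{1}[N]addn0 ltn_add2l.
Qed.

Lemma necessity_lattice : d%:R * einv p <= s / (1 - alpha) + d%:R * einv q.
Proof.
have [C' H] := lattice_test; apply: (@powR_growth R _ _ C') => N N0.
have Np : 0 < N%:R :> R by rewrite ltr0n.
pose g (f : {ffun 'I_d -> 'I_N}) : Z := \row_i (N + f i)%N%:Z.
have gi : injective g.
  move=> f f' /rowP h; apply/ffunP => i; apply/val_inj; have := h i; rewrite !mxE => -[].
  exact: addnI.
pose K := [seq g f | f <- enum {: {ffun 'I_d -> 'I_N}}].
have sK : size K = (N ^ d)%N by rewrite size_map -cardE card_ffun !card_ord.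
have := H N K N0; rewrite sK map_inj_uniq// enum_uniq expn_gt0 N0 => /(_ isT isT) h.
have E x : (N ^ d)%:R `^ x = N%:R `^ (d%:R * x) :> R by rewrite natrX -powR_mulrn ?(ltW Np)// -powRrM.
move: h; rewrite !E -powRD_gt0//; apply => k /mapP[f _ ->] i.
by rewrite mxE lez_nat leq_addr ltz_nat mul2n -addnn ltn_add2l ltn_ord.
Qed.

Lemma necessity_focus : (a + 1) * (d%:R * (1 - einv p)) - 2 * einv p <=
  s / (1 - alpha) + a * (d%:R * (1 - einv p)) + d%:R * einv q.
Proof. by have [C' H] := focus_test necessity_s_ge0; exact: powR_growth H. Qed.
End Necessity.

Theorem theorem1p3 (R : realType) (d : nat) (beta s : R) (p q : \bar R)
    (eta : 'rV[int]_d -> 'rV[R]_d -> R[i]) :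
  (1 <= d)%N -> 0 < beta <= 2 -> (1 <= p)%E -> (1 <= q)%E ->
  admissible (1 - beta / 2) eta ->
  (exists C : R, forall u : 'rV[R]_d -> R[i], cschwartz u ->
     (LpIRd p (fun t => Sbeta beta t u) <= C%:E * Mnorm (1 - beta / 2) s eta p q u)%E) ->
  Num.max 0
    (Num.max (beta * d%:R / 2 * (einv p - einv q))
             (beta * d%:R / 2 * (1 - einv p - einv q) - beta * einv p)) <= s.
Proof.
move=> d0 b02 p1 q1 adm [C HC]; have /andP[be0 be2] := b02.
have h1 := necessity_s_ge0 d0 b02 p1 q1 adm HC.
have h2 := necessity_lattice d0 b02 p1 q1 adm HC.
have h3 := necessity_focus d0 b02 p1 q1 adm HC.
have sE : s / (1 - (1 - beta / 2)) = 2 / beta * s.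
  by rewrite (_ : 1 - (1 - beta / 2) = beta / 2); [field; rewrite gt_eqF | ring].
(* The exponents of N are linear in x = 2 s / beta. In [h3] the terms (a + 1) d (1 - 1/p) and a d (1
   - 1/p) leave a difference free of a, and multiplication by beta / 2 gives the stated bounds. *)
move: h1 h2 h3; rewrite sE; set a := _ / (1 - _); set x := 2 / beta * s => h1 h2 h3.
have xs : beta / 2 * x = s by rewrite /x; field; rewrite gt_eqF.
have b2 : 0 < beta / 2 by rewrite divr_gt0.
rewrite !ge_max -xs; apply/and3P; split.
- by rewrite mulr_ge0// ltW.
- rewrite (_ : beta * d%:R / 2 * (einv p - einv q) = beta / 2 * (d%:R * (einv p - einv q))); last by field.
  by rewrite ler_pM2l//; move: h2; lra.
- rewrite (_ : _ - _ = beta / 2 * (d%:R * (1 - einv p - einv q) - 2 * einv p)); last by field.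
  by rewrite ler_pM2l//; move: h3; lra.
Qed.
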